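(* Let $\gamma\in(\frac23,1)$ and assume that $J(x)\sim|x|^{-(1+\gamma)}$ as $|x|\to\infty$. Then there exists a constant $c>0$ such that for every $\rho\in(0,1)$, $$\limsup_{\beta\downarrow\beta_0}\frac{F(\rho,\beta)}{F(\beta)}\ \le\ 1-c\rho\ <\ 1.$$
   Context: Standing setup (Random Walk Pinning Model). $J:\mathbb Z\to[0,\infty)$ is symmetric, satisfies $\sum_{x\in\mathbb Z}J(x)=1$, and is a non-increasing function of $|x|$; moreover $J(x)=\varphi(|x|)(1+|x|)^{-(1+\gamma)}$ with $\gamma\in(0,1)$ and $\varphi$ slowly varying at infinity. $W=(W_t)_{t\ge0}$ is the continuous-time random walk on $\mathbb Z$ started at $0$ with jump rate $1$ and jump distribution $J$; its law is denoted $\mathrm P$. It is transient. For $\rho\in[0,1)$, let $X_t=W^{(1)}_{(1-\rho)t}$ and $Y_t=W^{(2)}_{\rho t}$, where $W^{(1)},W^{(2)}$ are independent copies of $W$. The law of $X$ is denoted $\mathbf P$ (expectation $\mathbf E$) and the law of $Y$ is denoted $\mathbb P$ (expectation $\mathbb E$). For $\beta>0$, $T>0$, the (quenched) partition function is $$Z^Y_{\beta,T}:=\mathbf E\Big[e^{\beta\int_0^T\mathbf 1_{\{X_t=Y_t\}}\,dt}\Big].$$ The quenched free energy is $F(\rho,\beta):=\lim_{T\to\infty}\frac1T\log Z^Y_{\beta,T}=\lim_{T\to\infty}\frac1T\mathbb E[\log Z^Y_{\beta,T}]$ (the limit exists $\mathbb P$-a.s. and in $L^1(\mathbb P)$ and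 is non-negative). The homogeneous free energy is $F(\beta):=F(0,\beta)$. Set $\beta_0:=\big(\int_0^\infty \mathrm P(W_t=0)\,dt\big)^{-1}\in(0,\infty)$; then $F(\beta)=0$ for $\beta\le\beta_0$ and $F(\beta)>0$ for $\beta>\beta_0$. *)

(* Defs.v *)
From HB Require Import structures.
From mathcomp Require Import all_boot all_order all_algebra.
From mathcomp Require Import all_classical all_reals all_analysis.

Set Implicit Arguments.
Unset Strict Implicit.
Unset Printing Implicit Defensive.

Import Order.TTheory GRing.Theory Num.Theory.
Import numFieldNormedType.Exports.

Local Open Scope classical_set_scope.
Local Open Scope ring_scope.

Definition int_infty : set_system int :=
  filter_from setT (fun N : nat => [set x : int | (N <= `|x|)%N]).

Global Instance int_infty_filter : ProperFilter int_infty.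
Proof.
apply: filter_from_proper; last by move=> N _; exists N%:Z => /=.
apply: filter_from_filter; first by exists 0%N.
move=> M N _ _; exists (maxn M N) => // x /=.
by rewrite geq_max => /andP[].
Qed.

Definition slowly_varying (R : realType) (phi : R -> R) : Prop :=
  [/\ measurable_fun (`]0%R, +oo[ : set R) phi,
      forall t, 0 < t -> 0 < phi t &
      forall l, 0 < l -> phi (l * t) / phi t @[t --> +oo] --> (1 : R)].

Definition jump_kernel (R : realType) (gamma : R) (J : int -> R) : Prop :=
  [/\ forall x, 0 <= J x,
      forall x, J (- x) = J x,
      \esum_(x in [set: int]) (J x)%:E = 1%E,
      forall x y : int, (`|x| <= `|y|)%N -> J y <= J x &
      exists2 phi : R -> R, slowly_varying phi &
        forall x : int,
          J x = phi `|x|%N%:R * (1 + `|x|%N%:R) `^ (- (1 + gamma))].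

Definition mutually_independent (R : realType) (d : measure_display)
    (Omega : measurableType d) (P : probability Omega R)
    (I : choiceType) (G : I -> set_system Omega) : Prop :=
  forall (s : seq I) (A : I -> set Omega), uniq s ->
    (forall i, i \in s -> G i (A i)) ->
    P (\bigcap_(i in [set` s]) A i) = (\prod_(i <- s) P (A i))%E.

(* Holding times tau and jumps xi: tau n ~ Exp(1), xi n ~ J, and the whole
   family (indexed by nat + nat) is independent; int carries the discrete
   sigma-algebra. *)
Definition walk_data (R : realType) (d : measure_display)
    (Omega : measurableType d) (P : probability Omega R) (J : int -> R)
    (tau : nat -> {RV P >-> R}) (xi : nat -> Omega -> int) : Prop :=
  [/\ forall n (A : set R), measurable A ->
        P (tau n @^-1` A) = exponential_prob 1 A,
      forall n x, measurable (xi n @^-1` [set x]),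
      forall n x, P (xi n @^-1` [set x]) = (J x)%:E &
      mutually_independent P (fun i : nat + nat =>
        match i with
        | inl n => [set tau n @^-1` A | A in measurable]
        | inr n => [set xi n @^-1` B | B in [set: set int]]
        end)].

(* Number of jumps up to time t: the least n such that the (n+1)-st jump time
   exceeds t.  The default value 0 is used only on the null event that the jump
   times are bounded by t. *)
Definition jump_count (R : realType) (tau : nat -> R) (t : R) : nat :=
  if pselect (exists n, t < \sum_(i < n.+1) tau i) is left h
  then ex_minn h else 0%N.

Definition is_ctrw (R : realType) (d : measure_display)
    (Omega : measurableType d) (P : probability Omega R) (J : int -> R)
    (W : R -> Omega -> int) : Prop :=
  exists (tau : nat -> {RV P >-> R}) (xi : nat -> Omega -> int),
    walk_data J tau xi /\
    forall t omega, 0 <= t ->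
      W t omega = \sum_(i < jump_count (fun n => tau n omega) t) xi i omega.

Definition collision_time (R : realType) (X Y : R -> int) (T : R) : R :=
  (\int[lebesgue_measure]_(t in `[0%R, T]) \1_[set s | X s = Y s] t)%R.

(* Z^Y_{beta,T} for a fixed path Y: only X_t = W_{(1-rho)t} is averaged. *)
Definition partition_function (R : realType) (d : measure_display)
    (Omega : measurableType d) (P : probability Omega R)
    (W : R -> Omega -> int) (rho beta T : R) (Y : R -> int) : R :=
  fine 'E_P[fun omega =>
    expR (beta * collision_time (fun t => W ((1 - rho) * t) omega) Y T)].

(* The path Y_t = W_{rho t} is read at a second sample point omega', whereas X
   uses omega: under P (x) P the two coordinates are independent copies of W,
   and the bold E and blackboard E of the model are the integrals over omega
   and omega', respectively. *)
Definition free_energy (R : realType) (d : measure_display)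
    (Omega : measurableType d) (P : probability Omega R)
    (W : R -> Omega -> int) (rho beta : R) : R :=
  lim (T^-1 * fine 'E_P[fun omega' =>
         ln (partition_function P W rho beta T (fun t => W (rho * t) omega'))]
       @[T --> +oo]).

Definition hom_free_energy (R : realType) (d : measure_display)
    (Omega : measurableType d) (P : probability Omega R)
    (W : R -> Omega -> int) (beta : R) : R := free_energy P W 0 beta.

Definition beta0 (R : realType) (d : measure_display)
    (Omega : measurableType d) (P : probability Omega R)
    (W : R -> Omega -> int) : R :=
  (fine (\int[lebesgue_measure]_(t in `[0%R, +oo[)
           P [set omega | W t omega = 0%R]))^-1.

(* Main.v *)
(* Let [F] be the homogeneous free energy at [beta], assumed positive, and take
   [lam > F].  Discretizing time, [F < lam] says that [beta * G 0 < 1], where [G]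
   is the resolvent at [1 + lam] of convolution with [J] applied to the point
   mass at [0].

   For the quenched upper bound, tilt the law of [Y] so that the jumps of length
   at least [K] are favoured by a factor [e].  By Jensen's inequality
   [E (ln Z) <= ln (E (Z * e ^ cnt)) - E cnt], where [cnt] counts the long jumps
   of [Y]; with [t] the mass of the long jumps, [E cnt] is about [rho * t * T].
   In [E (Z * e ^ cnt)] the difference walk has the jump kernel [J] with its long
   jumps multiplied by [1 + rho * (e - 1)], and a supersolution built from the
   resolvent [H] of that kernel shows that the growth rate is at most
   [lam + eta] as soon as [beta * H 0 < 1], [H] being taken at [1 + lam + eta].
   If [G] and [H] are the two resolvents and [e'] is the perturbation of the
   kernel, the resolvent identity [eta * <G, H> + H 0 = G 0 + <G, e' H>] gives
   [H 0 <= G 0] once [<G, e' H> <= eta * <G, H>].  Here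
   [<G, e' H> <= sup e' * O(lam ^ -2)], whereas [<G, H> >= c / (lam ^ 2 * N)] if
   [N] is the distance that the walk covers in time [1 / lam].  The tails of [J]
   allow one to choose [K], a large multiple of [N], with [t] comparable to [lam]
   and [N * J K] small compared to [t], so that [eta = rho * t / 4] works and a
   gain of order [rho * t], hence of order [rho * lam], remains. *)

Require Import Defs.
From HB Require Import structures.
From mathcomp Require Import all_boot all_order all_algebra.
From mathcomp Require Import all_classical all_reals all_analysis.
From mathcomp Require Import measurable_realfun.
From mathcomp Require Import ring lra.

Set Implicit Arguments.
Unset Strict Implicit.
Unset Printing Implicit Defensive.

Import Order.TTheory GRing.Theory Num.Theory.
Import numFieldNormedType.Exports.

Local Open Scope classical_set_scope.
Local Open Scope ring_scope.

(** * Sums over the integers and convolution operators *)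

Section esum_extra.
Context (R : realType).
Local Open Scope ereal_scope.

(** Why the tilt gains: to collect the reward in [Z], the difference walk must keep returning to
    [0], and a jump of length at least [K] lands so diffusely, with mass at most [J K] at any site,
    that it hardly helps a return. Favouring long jumps therefore raises the annealed growth rate by
    much less than [rho * t], while Jensen's inequality subtracts almost the full mean [rho * t * T]
    of their number.

    The paths enter only through the lists of jumps in the cells of a time grid of mesh [delta].
    These lists are discrete variables with an explicit law, so expectations become sums in
    [\bar R], and the weights of the paths, whose measurability is never examined, are compared
    almost surely with functions of these lists. Cells with at least two jumps contribute order
    [delta ^ 2], and the mesh is fixed after [lam], [rho] and [t].

    The amount [eta = rho * t / 4] is spent twice, once on moving the spectral parameter and once on
    the mesh, against a subtracted term of at least [3 * rho * t / 4] per unit of time;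
    [rho * t / 4] is left. *)

Lemma esum_seq_le (T : choiceType) (s : seq T) (a : T -> \bar R) : uniq s ->
  (forall x, 0 <= a x) -> \sum_(x <- s) a x <= \esum_(x in [set: T]) a x.
Proof.
move=> us a0; apply: esum_ge; exists [set` s]; first by split.
by rewrite fsbig_seq.
Qed.

Lemma esum_term_le (T : choiceType) (t : T) (a : T -> \bar R) :
  (forall x, 0 <= a x) -> a t <= \esum_(x in [set: T]) a x.
Proof.
by move=> a0; have := @esum_seq_le _ [:: t] a isT a0; rewrite big_seq1.
Qed.

(** The factor may be [+oo], because sums are scaled by values of functions with values in [\bar R].
    In that case either all terms vanish or a single term already gives [+oo]. *)
Lemma esumZl (T : choiceType) (c : \bar R) (f : T -> \bar R) : 0 <= c ->
  (forall x, 0 <= f x) ->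
  \esum_(x in [set: T]) (c * f x) = c * \esum_(x in [set: T]) f x.
Proof.
move=> c0 f0; case: c c0 => [c| |//].
- rewrite lee_fin => c0; rewrite /esum -(ereal_supZl _ c0); last first.
    by apply/set0P; exists 0 => /=; exists set0; [exact: fsets_set0|rewrite fsbig_set0].
  congr ereal_sup; apply/seteqP; split => [_ [A [Af _] <-]|_ [_ [A [Af _] <-] <-]] /=.
    exists (\sum_(x \in A) f x); last by rewrite ge0_mule_fsumr.
    by exists A => //; split.
  by exists A; [split|rewrite ge0_mule_fsumr].
- move=> _; have [h0|hn0] := eqVneq (\esum_(x in [set: T]) f x) 0.
    rewrite h0 mule0 esum1// => z _; suff -> : f z = 0 by rewrite mule0.
    by apply/eqP; rewrite eq_le f0 andbT -h0; exact: esum_term_le.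
  rewrite gt0_mulye ?lt0e ?hn0 ?esum_ge0//.
  have [z hz] : exists z, f z != 0.
    apply/not_existsP => /= H; move/eqP: hn0; apply; apply: esum1 => z _.
    by apply/eqP/negPn/negP; exact: H.
  apply/eqP; rewrite -leye_eq.
  apply: le_trans (@esum_term_le _ z (fun z => +oo * f z) _).
    by rewrite gt0_mulye// lt0e hz f0.
  by move=> y; rewrite mule_ge0.
Qed.

Lemma esumC (T U : choiceType) (a : T -> U -> \bar R) :
  (forall x y, 0 <= a x y) ->
  \esum_(x in [set: T]) \esum_(y in [set: U]) a x y =
  \esum_(y in [set: U]) \esum_(x in [set: T]) a x y.
Proof.
move=> a0; rewrite esum_esum; last by move=> *; exact: a0.
rewrite esum_esum; last by move=> *; exact: a0.
rewrite (@reindex_esum _ _ _ ([set: U] `*`` (fun=> [set: T]))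
   ([set: T] `*`` (fun=> [set: U])) (fun p => (p.2, p.1))) //.
split => //.
- by move=> [x y] [x' y'] _ _ /= [-> ->].
- by move=> [x y] _ /=; exists (y, x).
Qed.

Lemma esum_delta (T : choiceType) (t : T) (a : T -> \bar R) :
  (forall x, 0 <= a x) ->
  \esum_(x in [set: T]) (if x == t then a x else 0) = a t.
Proof.
move=> a0; have := @esum_set1 _ _ t a (a0 t); rewrite esum_mkcond => <-.
apply: eq_esum => x _; case: eqP => [->|xt]; first by rewrite mem_set.
by rewrite memNset.
Qed.

Lemma esum_int_shift (z : int) (f : int -> \bar R) :
  \esum_(x in [set: int]) f (x + z)%R = \esum_(x in [set: int]) f x.
Proof.
apply/esym; apply: (@reindex_esum _ _ _ setT setT (fun x => (x + z)%R)).
split => //; first by move=> x y _ _ /addIr.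
by move=> x _; exists (x - z)%R => //=; rewrite subrK.
Qed.

Lemma esum_int_opp (f : int -> \bar R) :
  \esum_(x in [set: int]) f (- x)%R = \esum_(x in [set: int]) f x.
Proof.
apply/esym; apply: (@reindex_esum _ _ _ setT setT (fun x => (- x)%R)).
by split => // x y _ _ /oppr_inj.
Qed.

End esum_extra.

Section kernel_operator.
Context (R : realType).
Implicit Types (k : int -> R) (f g : int -> \bar R).
Local Open Scope ereal_scope.

(** Functions take values in [\bar R] and are used only when nonnegative, so that sums can be
    exchanged freely; finiteness is proved separately where a subtraction occurs. *)
Definition kop k f x : \bar R := \esum_(z in [set: int]) ((k z)%:E * f (x + z)%R).

Definition epair f g : \bar R := \esum_(x in [set: int]) (f x * g x).

Definition edelta : int -> \bar R := fun x => (x == 0%R)%:R%:E.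

Lemma edelta_ge0 x : 0 <= edelta x.
Proof. by rewrite /edelta lee_fin. Qed.

Lemma kop_ge0 k f : (forall z, (0 <= k z)%R) -> (forall x, 0 <= f x) ->
  forall x, 0 <= kop k f x.
Proof.
by move=> k0 f0 x; apply: esum_ge0 => z _; rewrite mule_ge0 ?lee_fin.
Qed.

Lemma kop_le k k' f g : (forall z, (0 <= k z)%R) -> (forall x, 0 <= f x) ->
  (forall z, (k z <= k' z)%R) -> (forall x, f x <= g x) ->
  forall x, kop k f x <= kop k' g x.
Proof.
move=> k0 f0 kk fg x; apply: le_esum => z _.
by rewrite lee_pmul ?lee_fin.
Qed.

Lemma kopD k f g : (forall z, (0 <= k z)%R) -> (forall x, 0 <= f x) ->
  (forall x, 0 <= g x) -> forall x, kop k (fun y => f y + g y) x = kop k f x + kop k g x.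
Proof.
move=> k0 f0 g0 x; rewrite /kop -esumD; last 2 first.
  by move=> z _; rewrite mule_ge0 ?lee_fin.
  by move=> z _; rewrite mule_ge0 ?lee_fin.
by apply: eq_esum => z _; rewrite ge0_muleDr.
Qed.

Lemma kopDl k k' f : (forall z, (0 <= k z)%R) -> (forall z, (0 <= k' z)%R) ->
  (forall x, 0 <= f x) ->
  forall x, kop (fun z => k z + k' z)%R f x = kop k f x + kop k' f x.
Proof.
move=> k0 k0' f0 x; rewrite /kop -esumD; last 2 first.
  by move=> z _; rewrite mule_ge0 ?lee_fin.
  by move=> z _; rewrite mule_ge0 ?lee_fin.
by apply: eq_esum => z _; rewrite EFinD ge0_muleDl ?lee_fin.
Qed.

Lemma kopZ k f (c : R) : (0 <= c)%R -> (forall z, (0 <= k z)%R) ->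
  (forall x, 0 <= f x) -> forall x, kop k (fun y => c%:E * f y) x = c%:E * kop k f x.
Proof.
move=> c0 k0 f0 x; rewrite /kop -esumZl//; last first.
  by move=> z; rewrite mule_ge0 ?lee_fin.
by apply: eq_esum => z _; rewrite muleCA.
Qed.

Lemma kopZl k f (c : R) : (0 <= c)%R -> (forall z, (0 <= k z)%R) ->
  (forall x, 0 <= f x) -> forall x, kop (fun z => c * k z)%R f x = c%:E * kop k f x.
Proof.
move=> c0 k0 f0 x; rewrite /kop -esumZl//; last first.
  by move=> z; rewrite mule_ge0 ?lee_fin.
by apply: eq_esum => z _; rewrite EFinM muleA.
Qed.

Lemma epairC f g : epair f g = epair g f.
Proof. by apply: eq_esum => x _; rewrite muleC. Qed.

Lemma epair_ge0 f g : (forall x, 0 <= f x) -> (forall x, 0 <= g x) -> 0 <= epair f g.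
Proof. by move=> f0 g0; apply: esum_ge0 => x _; rewrite mule_ge0. Qed.

Lemma epair_le f g f' g' : (forall x, 0 <= f x) -> (forall x, 0 <= g x) ->
  (forall x, f x <= f' x) -> (forall x, g x <= g' x) -> epair f g <= epair f' g'.
Proof. by move=> f0 g0 ff gg; apply: le_esum => x _; rewrite lee_pmul. Qed.

Lemma epairD f g h : (forall x, 0 <= f x) -> (forall x, 0 <= g x) ->
  (forall x, 0 <= h x) -> epair f (fun x => g x + h x) = epair f g + epair f h.
Proof.
move=> f0 g0 h0; rewrite /epair -esumD; last 2 first.
  by move=> z _; rewrite mule_ge0.
  by move=> z _; rewrite mule_ge0.
by apply: eq_esum => z _; rewrite ge0_muleDr.
Qed.

Lemma epairZ f g (c : R) : (0 <= c)%R -> (forall x, 0 <= f x) ->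
  (forall x, 0 <= g x) -> epair f (fun x => c%:E * g x) = c%:E * epair f g.
Proof.
move=> c0 f0 g0; rewrite /epair -esumZl//; last first.
  by move=> z; rewrite mule_ge0 ?lee_fin.
by apply: eq_esum => z _; rewrite muleCA.
Qed.

Lemma epair_delta f : (forall x, 0 <= f x) -> epair f edelta = f 0%R.
Proof.
move=> f0; rewrite /epair -[RHS](@esum_delta _ _ _ f)//.
by apply: eq_esum => x _; rewrite /edelta; case: eqP => _; rewrite ?mule1 ?mule0.
Qed.

Lemma kop_self_adjoint k f g : (forall z, (0 <= k z)%R) -> (forall z, k (- z)%R = k z) ->
  (forall x, 0 <= f x) -> (forall x, 0 <= g x) ->
  epair (kop k f) g = epair f (kop k g).
Proof.
move=> k0 ke f0 g0.
transitivity (\esum_(x in [set: int]) \esum_(z in [set: int])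
   ((k z)%:E * f (x + z)%R * g x)).
  apply: eq_esum => x _; rewrite muleC -esumZl//; last first.
    by move=> z; rewrite mule_ge0 ?lee_fin.
  by apply: eq_esum => z _; rewrite muleC.
rewrite esumC; last by move=> x y; rewrite !mule_ge0 ?lee_fin.
transitivity (\esum_(x in [set: int]) \esum_(z in [set: int])
   (f x * ((k z)%:E * g (x + z)%R))); last first.
  by apply: eq_esum => x _; rewrite esumZl// => z; rewrite mule_ge0 ?lee_fin.
rewrite [RHS]esumC; last by move=> x y; rewrite !mule_ge0 ?lee_fin.
(* On the right [z] becomes [- z]. The two translations of [x] then bring both inner sums to [f] at
   [x + z + z] and [g] at [x + z]. *)
rewrite -[RHS]esum_int_opp; apply: eq_esum => z _.
rewrite -(esum_int_shift z) -[RHS](esum_int_shift (z + z)%R).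
apply: eq_esum => x _.
by rewrite ke [RHS]muleCA muleA addrAC addrA addrK -addrA.
Qed.

End kernel_operator.

Arguments edelta {R} x.

(** * Resolvents of convolution operators *)

Section resolvent.
Context (R : realType).
Implicit Types (k : int -> R) (f g : int -> \bar R).
Local Open Scope ereal_scope.

Lemma esum_nat_recl (f : nat -> \bar R) : (forall n, 0 <= f n) ->
  \esum_(n in [set: nat]) f n = f 0%N + \esum_(n in [set: nat]) f n.+1.
Proof.
move=> f0; rewrite -!nneseries_esumT//.
rewrite (nneseries_recl (P := xpredT))//; congr (_ + _).
have := @nneseries_addn R (fun n => f n) 1 (fun n => f0 n).
by move=> <-; apply: eq_eseriesr => i _; rewrite addn1.
Qed.

Lemma esum_nat_le (f : nat -> \bar R) (c : \bar R) : (forall n, 0 <= f n) ->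
  (forall n, \sum_(0 <= i < n) f i <= c) -> \esum_(n in [set: nat]) f n <= c.
Proof.
move=> f0 fc; rewrite -nneseries_esumT//; apply: lime_le.
  by apply: is_cvg_nneseries => n _ _; exact: f0.
by apply: nearW => n; exact: fc.
Qed.

Lemma kop_esum (T : choiceType) k (f : T -> int -> \bar R) : (forall z, (0 <= k z)%R) ->
  (forall i x, 0 <= f i x) -> forall x,
  kop k (fun y => \esum_(i in [set: T]) f i y) x = \esum_(i in [set: T]) kop k (f i) x.
Proof.
move=> k0 f0 x; rewrite [RHS]esumC; last by move=> i z; rewrite mule_ge0 ?lee_fin.
by apply: eq_esum => z _; rewrite esumZl ?lee_fin.
Qed.

Definition nterm k (a : R) n x : \bar R :=
  ((a^-1)^+n.+1)%:E * iter n (kop k) (@edelta R) x.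

(* Neumann series of [(a - k)^-1] applied to the point mass at [0]. *)
Definition resolvent k (a : R) x : \bar R := \esum_(n in [set: nat]) nterm k a n x.

Lemma iter_kop_ge0 k f n x : (forall z, (0 <= k z)%R) -> (forall x, 0 <= f x) ->
  0 <= iter n (kop k) f x.
Proof. by move=> k0 f0; elim: n x => //= n IH x; exact: kop_ge0. Qed.

Section fixed_kernel.
Variables (k : int -> R) (a : R).
Hypotheses (k0 : forall z, (0 <= k z)%R) (a0 : (0 < a)%R).

Lemma nterm_ge0 n x : 0 <= nterm k a n x.
Proof.
rewrite mule_ge0 ?iter_kop_ge0 ?lee_fin ?exprn_ge0 ?invr_ge0 ?ltW//.
by move=> y; exact: edelta_ge0.
Qed.

Lemma resolvent_ge0 x : 0 <= resolvent k a x.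
Proof. by apply: esum_ge0 => n _; exact: nterm_ge0. Qed.

Lemma ntermS n x : a%:E * nterm k a n.+1 x = kop k (nterm k a n) x.
Proof.
rewrite /nterm kopZ ?exprn_ge0 ?invr_ge0 ?(ltW a0)//; last first.
  by move=> y; apply: iter_kop_ge0 => // z; exact: edelta_ge0.
by rewrite muleA -EFinM exprS mulrA divff ?gt_eqF// mul1r.
Qed.

Lemma nterm0 x : a%:E * nterm k a 0 x = edelta x.
Proof.
rewrite /nterm muleA -EFinM expr1 divff; last by rewrite gt_eqF.
by rewrite mul1r.
Qed.

Lemma resolventE x : a%:E * resolvent k a x = edelta x + kop k (resolvent k a) x.
Proof.
rewrite {1}/resolvent esum_nat_recl; last by move=> n; exact: nterm_ge0.
rewrite ge0_muleDr ?nterm_ge0 ?esum_ge0//; last by move=> *; exact: nterm_ge0.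
rewrite nterm0; congr (_ + _).
rewrite -esumZl ?lee_fin ?(ltW a0)//; last by move=> n; exact: nterm_ge0.
rewrite kop_esum//; last exact: nterm_ge0.
by apply: eq_esum => n _; rewrite ntermS.
Qed.

(* Minimum principle, by induction on the partial sums of the Neumann series. *)
Lemma resolvent_min (u : int -> \bar R) (c d : R) : (0 <= c)%R -> (0 <= d)%R ->
  (forall x, 0 <= u x) ->
  (forall x, kop k u x + c%:E * edelta x + d%:E <= a%:E * u x) ->
  forall x, c%:E * resolvent k a x + (d / a)%:E <= u x.
Proof.
move=> c0 d0 u0 hu.
have hda x : (d / a)%:E <= u x.
  rewrite -(@lee_pmul2l _ a%:E)// ?lte_fin//.
  rewrite -EFinM mulrCA divff ?gt_eqF// mulr1; apply: le_trans (hu x).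
  rewrite leeDr// adde_ge0 ?kop_ge0//.
  by rewrite mule_ge0 ?lee_fin ?edelta_ge0.
have key n x : c%:E * \sum_(0 <= i < n) nterm k a i x + (d / a)%:E <= u x.
  elim: n x => [|n IH] x; first by rewrite big_nil mule0 add0e.
  rewrite -(@lee_pmul2l _ a%:E)// ?lte_fin//.
  apply: le_trans (hu x).
  rewrite ge0_muleDr ?lee_fin ?divr_ge0 ?(ltW a0)//; last first.
    by rewrite mule_ge0 ?lee_fin ?sume_ge0// => i _; exact: nterm_ge0.
  rewrite -EFinM mulrCA divff ?gt_eqF// mulr1 leeD2r//.
  rewrite big_nat_recl// muleCA ge0_muleDr ?nterm_ge0 ?sume_ge0//; last first.
    by move=> *; exact: nterm_ge0.
  rewrite nterm0 ge0_muleDr ?edelta_ge0//; last first.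
    by rewrite mule_ge0 ?lee_fin ?(ltW a0) ?sume_ge0// => *; exact: nterm_ge0.
  rewrite addeC leeD2r//.
  have -> : a%:E * (\sum_(0 <= i < n) nterm k a i.+1 x) =
     kop k (fun y => \sum_(0 <= i < n) nterm k a i y) x.
    rewrite ge0_sume_distrr; last by move=> *; exact: nterm_ge0.
    elim: {IH} n => [|n IHn].
      rewrite big_nil /kop esum1// => z _; by rewrite big_nil mule0.
    rewrite big_nat_recr//= IHn ntermS -kopD//; last 2 first.
    - by move=> y; rewrite sume_ge0// => *; exact: nterm_ge0.
    - by move=> y; exact: nterm_ge0.
    by apply: eq_esum => z _; rewrite big_nat_recr.
  rewrite -kopZ//; last by move=> y; rewrite sume_ge0// => *; exact: nterm_ge0.
  apply: kop_le => // [y|y].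
    by rewrite mule_ge0 ?lee_fin ?sume_ge0// => *; exact: nterm_ge0.
  (* The constant [d / a] of the induction hypothesis is dropped under [kop]; the next step recovers
     it from [d] itself. *)
  by apply: le_trans (IH y); rewrite leeDl// lee_fin divr_ge0// ltW.
move=> x; rewrite -leeBrDr// -esumZl ?lee_fin//; last by move=> n; exact: nterm_ge0.
apply: esum_nat_le => [n|n].
  by rewrite mule_ge0 ?lee_fin ?nterm_ge0.
rewrite -ge0_sume_distrr; last by move=> *; exact: nterm_ge0.
by rewrite leeBrDr//; exact: key.
Qed.

End fixed_kernel.

Lemma resolvent_le k k' a a' : (forall z, (0 <= k z)%R) ->
  (forall z, (k z <= k' z)%R) -> (0 < a' <= a)%R -> forall x,
  resolvent k a x <= resolvent k' a' x.
Proof.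
move=> k0 kk /andP[a0 aa] x; apply: le_esum => n _; apply: lee_pmul.
- by rewrite lee_fin exprn_ge0// invr_ge0 ltW// (lt_le_trans a0).
- by apply: iter_kop_ge0 => // y; exact: edelta_ge0.
- rewrite lee_fin lerXn2r ?nnegrE ?invr_ge0 ?(ltW a0)//.
    by rewrite (le_trans (ltW a0)).
  by rewrite lef_pV2 ?posrE// (lt_le_trans a0).
- elim: n x => //= n IH x; apply: kop_le => // y.
  by apply: iter_kop_ge0 => // z; exact: edelta_ge0.
Qed.

Lemma kop_cst k (kap : R) (c : \bar R) : 0 <= c -> (forall z, (0 <= k z)%R) ->
  \esum_(z in [set: int]) (k z)%:E = kap%:E -> forall x, kop k (fun=> c) x = kap%:E * c.
Proof.
move=> c0 k0 <- x; rewrite muleC -esumZl//.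
by apply: eq_esum => z _; rewrite muleC.
Qed.

Lemma esum_kop k (kap : R) f : (forall z, (0 <= k z)%R) ->
  (forall x, 0 <= f x) -> \esum_(z in [set: int]) (k z)%:E = kap%:E ->
  \esum_(x in [set: int]) kop k f x = kap%:E * \esum_(x in [set: int]) f x.
Proof.
move=> k0 f0 <-; rewrite esumC; last by move=> x y; rewrite mule_ge0 ?lee_fin.
rewrite muleC -esumZl ?esum_ge0//.
apply: eq_esum => z _; rewrite esumZl ?lee_fin// muleC; congr (_ * _).
exact: esum_int_shift.
Qed.

Section mass.
Variables (k : int -> R) (kap a : R).
Hypotheses (k0 : forall z, (0 <= k z)%R) (a0 : (kap < a)%R).
Hypothesis kmass : \esum_(z in [set: int]) (k z)%:E = kap%:E.

Let kap0 : (0 <= kap)%R.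
Proof. by rewrite -lee_fin -kmass esum_ge0// => z _; rewrite lee_fin. Qed.

Let apos : (0 < a)%R. Proof. exact: le_lt_trans a0. Qed.

(** Summing the resolvent equation gives [a * m = 1 + kap * m], which [m = +oo] may satisfy as well.
    So the partial Neumann sums are bounded by [(a - kap)^-1] first, by induction. *)
Lemma resolvent_mass :
  \esum_(x in [set: int]) resolvent k a x = ((a - kap)^-1)%:E.
Proof.
have ak : (0 < a - kap)%R by rewrite subr_gt0.
set m := \esum_(x in _) _.
have m0 : 0 <= m by apply: esum_ge0 => x _; exact: resolvent_ge0.
have mE : a%:E * m = 1 + kap%:E * m.
  rewrite /m -(esum_kop k0 _ kmass)//; last by move=> x; exact: resolvent_ge0.
  rewrite -esumZl ?lee_fin ?(ltW apos)//; last by move=> x; exact: resolvent_ge0.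
  rewrite -[1](_ : \esum_(x in [set: int]) (@edelta R x) = 1); last first.
    transitivity (\esum_(x in [set: int]) (if x == 0%R then 1 else 0 : \bar R)).
      by apply: eq_esum => x _; rewrite /edelta; case: eqP.
    by rewrite (@esum_delta R _ 0%R (fun=> 1)).
  rewrite -esumD; last 2 first.
  - by move=> x _; exact: edelta_ge0.
  - by move=> x _; apply: kop_ge0 => // y; exact: resolvent_ge0.
  by apply: eq_esum => x _; rewrite resolventE.
have mfin : m \is a fin_num.
  rewrite ge0_fin_numE//; apply: le_lt_trans (ltry ((a - kap)^-1)%R).
  rewrite /m esumC; last by move=> x n; exact: nterm_ge0.
  apply: esum_nat_le => [n|n].
    by apply: esum_ge0 => x _; exact: nterm_ge0.
  elim: n => [|n IH]; first by rewrite big_nil lee_fin invr_ge0 ltW.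
  rewrite -(@lee_pmul2l _ a%:E)// ?lte_fin//.
  rewrite big_nat_recl// ge0_muleDr ?sume_ge0 ?esum_ge0//; last 2 first.
  - by move=> *; exact: nterm_ge0.
  - by move=> *; rewrite esum_ge0// => *; exact: nterm_ge0.
  rewrite ge0_sume_distrr; last by move=> *; rewrite esum_ge0// => *; exact: nterm_ge0.
  rewrite -esumZl ?lee_fin ?(ltW apos)//; last by move=> x; exact: nterm_ge0.
  rewrite (_ : \esum_(x in _) _ = 1); last first.
    transitivity (\esum_(x in [set: int]) (if x == 0%R then 1 else 0 : \bar R)).
      by apply: eq_esum => x _; rewrite nterm0// /edelta; case: eqP.
    by rewrite (@esum_delta R _ 0%R (fun=> 1)).
  under eq_bigr => i _.
    rewrite -esumZl ?lee_fin ?(ltW apos)//; last by move=> x; exact: nterm_ge0.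
    under eq_esum => x _ do rewrite ntermS//.
    rewrite (esum_kop k0 _ kmass)//; last by move=> x; exact: nterm_ge0.
    over.
  rewrite /= -ge0_sume_distrr; last by move=> *; rewrite esum_ge0// => *; exact: nterm_ge0.
  rewrite -EFinM.
  apply: le_trans (_ : 1 + kap%:E * ((a - kap)^-1)%:E <= _).
    by rewrite leeD2l// lee_wpmul2l ?lee_fin.
  rewrite -EFinM -EFinD lee_fin -subr_ge0 le_eqVlt; apply/orP; left.
  by apply/eqP/esym/eqP; rewrite subr_eq0; apply/eqP; field; rewrite gt_eqF.
have {}mE : (a * fine m = 1 + kap * fine m)%R.
  by apply: EFin_inj; rewrite EFinD !EFinM fineK.
rewrite -(fineK mfin).
by congr (_%:E); apply: (mulfI (lt0r_neq0 ak)); rewrite divff ?gt_eqF// mulrBl mE addrK.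
Qed.

Lemma resolvent_fin x : resolvent k a x \is a fin_num.
Proof.
rewrite ge0_fin_numE ?resolvent_ge0//.
apply: le_lt_trans (@esum_term_le _ _ x (resolvent k a) _) _.
  by move=> y; exact: resolvent_ge0.
by rewrite resolvent_mass ltry.
Qed.

End mass.

End resolvent.

(** * Comparison of resolvents *)

Section green_comparison.
Context (R : realType).
Implicit Types (k : int -> R) (f g : int -> \bar R).
Local Open Scope ereal_scope.

Lemma esum_int (f : int -> \bar R) : (forall x, 0 <= f x) ->
  \esum_(x in [set: int]) f x =
  \esum_(n in [set: nat]) f n%:Z%R + \esum_(n in [set: nat]) f (- n.+1%:Z)%R.
Proof.
move=> f0; rewrite (esumID (range Posz))//; congr (_ + _).
  by rewrite setTI esum_image// => m n _ _ [].
rewrite setTI (_ : ~` range Posz = range Negz); last first.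
  apply/seteqP; split => [[n|n] /= h|_ /= [n _ <-] [m _ //]].
    by exfalso; apply: h; exists n.
  by exists n.
by rewrite esum_image// => [m n _ _ []//]; apply: eq_esum => n _; rewrite NegzE.
Qed.

Lemma esum_ball_le (N : nat) :
  \esum_(x in [set: int]) (if (`|x| < N)%N then 1 else 0) <= (2 * N%:R)%:E :> \bar R.
Proof.
have key (g : nat -> nat) : (forall n, n <= g n)%N ->
    \esum_(n in [set: nat]) (if (g n < N)%N then 1 else 0) <= (N%:R)%:E :> \bar R.
  move=> gn; apply: esum_nat_le => [n|n]; first by case: ifP.
  apply: le_trans (_ : (minn n N)%:R%:E <= _); last by rewrite lee_fin ler_nat geq_minr.
  elim: n => [|n IH]; first by rewrite big_nil min0n.
  rewrite big_nat_recr//=.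
  case: ltnP => h; last first.
    by rewrite adde0 (le_trans IH)// lee_fin ler_nat leq_min geq_minr geq_min leqnSn.
  have hn : (n < N)%N by exact: leq_ltn_trans (gn n) h.
  apply: le_trans (leeD2r _ IH) _.
  by rewrite -EFinD lee_fin -(natrD _ _ 1) ler_nat (minn_idPl (ltnW hn)) (minn_idPl hn) addn1.
rewrite esum_int; last by move=> x; case: ifP.
rewrite mulr2n mulrDl mul1r EFinD; apply: leeD.
  by apply: (key id).
have := key succn (fun n => leqnSn n).
by under eq_esum => n _ do rewrite -(absz_nat n.+1) -abszN.
Qed.

(** The equation of [H] is paired with [G] and that of [G] with [H]; the symmetry of [k] makes the
    two terms [<G, k H>] equal. They may be cancelled because [<G, H>] is at most the product of the
    two masses. *)
Lemma resolvent_perturbation k e (kk ke a a' : R) :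
  (forall z, (0 <= k z)%R) -> (forall z, (0 <= e z)%R) ->
  (forall z, k (- z)%R = k z) ->
  \esum_(z in [set: int]) (k z)%:E = kk%:E ->
  \esum_(z in [set: int]) (e z)%:E = ke%:E ->
  (kk < a)%R -> (kk + ke < a')%R -> (a <= a')%R ->
  let G := resolvent k a in let H := resolvent (fun z => k z + e z)%R a' in
  (a' - a)%:E * epair G H + H 0%R = G 0%R + epair G (kop e H).
Proof.
move=> k0 e0 kev mk me hka hka' aa G H.
have mke : \esum_(z in [set: int]) ((k z + e z)%R)%:E = (kk + ke)%:E.
  by rewrite EFinD -mk -me -esumD// => z _; rewrite lee_fin.
have ke0 z : (0 <= k z + e z)%R by rewrite addr_ge0.
have kk0 : (0 <= kk)%R by rewrite -lee_fin -mk esum_ge0// => z _; rewrite lee_fin.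
have a0 : (0 < a)%R by exact: le_lt_trans hka.
have a0' : (0 < a')%R by exact: lt_le_trans aa.
have G0 x : 0 <= G x by exact: resolvent_ge0.
have H0 x : 0 <= H x by exact: resolvent_ge0.
have mG := resolvent_mass k0 hka mk; rewrite -/G in mG.
have mH := resolvent_mass ke0 hka' mke; rewrite -/H in mH.
have E1 : a%:E * epair G H = H 0%R + epair G (kop k H).
  rewrite -kop_self_adjoint// epairC -epairZ ?(ltW a0)//.
  rewrite -(epair_delta H0) (epairC (kop k G)) -epairD//; last 2 first.
  - exact: edelta_ge0.
  - by move=> x; exact: kop_ge0.
  by congr epair; apply/funext => x; rewrite resolventE.
have E2 : a'%:E * epair G H = G 0%R + (epair G (kop k H) + epair G (kop e H)).
  rewrite -epairZ ?(ltW a0')// -(epair_delta G0) -!epairD//; last 4 first.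
  - exact: edelta_ge0.
  - by move=> x; rewrite adde_ge0// kop_ge0.
  - by move=> x; exact: kop_ge0.
  - by move=> x; exact: kop_ge0.
  by congr epair; apply/funext => x; rewrite resolventE// kopDl.
have GHfin : epair G H \is a fin_num.
  rewrite ge0_fin_numE ?epair_ge0//.
  apply: (@le_lt_trans _ _ (((a - kk)^-1)%:E * ((a' - (kk + ke))^-1)%:E)); last by rewrite -EFinM ltry.
  rewrite -mH -esumZl ?lee_fin ?invr_ge0 ?subr_ge0 ?(ltW hka)//.
  apply: le_esum => x _; apply: lee_pmul => //.
  by rewrite -mG; apply: esum_term_le.
have khfin : epair G (kop k H) \is a fin_num.
  rewrite ge0_fin_numE ?epair_ge0//; last by move=> x; exact: kop_ge0.
  apply: (@le_lt_trans _ _ (a%:E * epair G H)); last by rewrite -(fineK GHfin) -EFinM ltry.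
  by rewrite E1 leeDr.
have E3 : a'%:E * epair G H = (a' - a)%:E * epair G H + a%:E * epair G H.
  by rewrite -ge0_muleDl ?lee_fin ?subr_ge0 ?(ltW a0)// -EFinD subrK.
move: E3; rewrite E2 E1 [RHS]addeA => /(congr1 (fun u => u - epair G (kop k H))).
by rewrite [RHS]addeK// addeA addeAC addeK// => ->.
Qed.

(** A bounded substitute for the square, fit for kernels without second moment: for [r > 0] it
    vanishes at [0], equals [1] beyond distance [r], and keeps the parallelogram inequality. *)
Definition testf (r : R) (x : int) : R := Num.min 1%R ((x%:~R / r) ^+ 2)%R.

Lemma testf_ge0 r x : (0 <= testf r x)%R.
Proof. by rewrite le_min ler01 sqr_ge0. Qed.

Lemma testf_le1 r x : (testf r x <= 1)%R.
Proof. by rewrite ge_min lexx. Qed.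

(** If one of [testf r x], [testf r z] equals [1], the right side is at least [2], which bounds any
    left side. Otherwise the right side is not truncated, and the parallelogram law applies. *)
Lemma testf_parallelogram r x z :
  (testf r (x + z) + testf r (x - z) <= 2 * testf r x + 2 * testf r z)%R.
Proof.
have h0 := testf_ge0 r x; have h0' := testf_ge0 r z.
have h1 := testf_le1 r (x + z); have h1' := testf_le1 r (x - z).
have [hx|hx] := leP 1%R ((x%:~R / r) ^+ 2)%R.
  have -> : testf r x = 1%R by rewrite /testf; apply/min_idPl.
  lra.
have [hz|hz] := leP 1%R ((z%:~R / r) ^+ 2)%R.
  have -> : testf r z = 1%R by rewrite /testf; apply/min_idPl.
  lra.
have -> : testf r x = ((x%:~R / r) ^+ 2)%R by rewrite /testf; apply/min_idPr/ltW.
have -> : testf r z = ((z%:~R / r) ^+ 2)%R by rewrite /testf; apply/min_idPr/ltW.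
apply: le_trans (_ : (((x + z)%:~R / r) ^+ 2 + ((x - z)%:~R / r) ^+ 2 <= _)%R).
  by rewrite lerD// ge_min lexx orbT.
by rewrite rmorphD rmorphB /= !mulrDl mulNr; lra.
Qed.

(** Doubling the sum and pairing [z] with [- z] exposes the parallelogram inequality; thus one step
    of the walk raises the mean of [testf] by at most [m]. *)
Lemma kop_testf k r (m : R) : (forall z, (0 <= k z)%R) ->
  (forall z, k (- z)%R = k z) ->
  \esum_(z in [set: int]) (k z)%:E = 1 ->
  \esum_(z in [set: int]) (k z * testf r z)%:E = m%:E ->
  forall x, kop k (fun y => (testf r y)%:E) x <= (testf r x)%:E + m%:E.
Proof.
move=> k0 kev mk mm x.
have t0 y : 0 <= (testf r y)%:E by rewrite lee_fin testf_ge0.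
rewrite -(@lee_pmul2l _ 2%:E)// ge0_muleDr//; last first.
  by rewrite -mm esum_ge0// => z _; rewrite lee_fin mulr_ge0 ?testf_ge0.
rewrite [leLHS]mule_natl mule2n.
rewrite {2}/kop -[X in _ + X]esum_int_opp /kop -esumD; last 2 first.
- by move=> z _; rewrite mule_ge0 ?lee_fin ?testf_ge0.
- by move=> z _; rewrite mule_ge0 ?lee_fin ?testf_ge0.
apply: le_trans (_ : \esum_(z in [set: int]) ((2 * testf r x)%:E * (k z)%:E + 2%:E * (k z * testf r z)%:E) <= _).
  apply: le_esum => z _; rewrite kev -!EFinM -!EFinD lee_fin.
  have := ler_wpM2l (k0 z) (testf_parallelogram r x z).
  lra.
rewrite esumD; last 2 first.
- by move=> z _; rewrite lee_fin !mulr_ge0 ?testf_ge0.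
- by move=> z _; rewrite lee_fin !mulr_ge0 ?testf_ge0.
rewrite !esumZl ?lee_fin ?mulr_ge0 ?testf_ge0//; last first.
  by move=> z; rewrite lee_fin mulr_ge0 ?testf_ge0.
by rewrite mk mm mule1 EFinM.
Qed.

(** After time [t] the mean of [testf] is at most [m * t], and [m / mu ^+ 2] is the integral of
    [m * t * exp (- mu * t)]. The proof pairs [testf] with the resolvent equation, where the point
    mass drops out since [testf] vanishes at [0]. *)
Lemma epair_resolvent_testf k r (m mu : R) : (forall z, (0 <= k z)%R) ->
  (forall z, k (- z)%R = k z) ->
  \esum_(z in [set: int]) (k z)%:E = 1 ->
  \esum_(z in [set: int]) (k z * testf r z)%:E = m%:E -> (0 < mu)%R ->
  epair (fun y => (testf r y)%:E) (resolvent k (1 + mu)) <= (m / mu ^+ 2)%:E.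
Proof.
move=> k0 kev mk mm mu0.
set f := fun y => _; set G := resolvent _ _.
have t0 y : 0 <= f y by rewrite lee_fin testf_ge0.
have a0 : (0 < 1 + mu)%R by rewrite addr_gt0.
have G0 x : 0 <= G x by exact: resolvent_ge0.
have mG := @resolvent_mass _ k 1%R (1 + mu)%R k0 (ltac:(lra)) mk.
rewrite -/G addrC addKr in mG.
have m0 : (0 <= m)%R.
  by rewrite -lee_fin -mm esum_ge0// => z _; rewrite lee_fin mulr_ge0 ?testf_ge0.
have ffin : epair f G \is a fin_num.
  rewrite ge0_fin_numE ?epair_ge0//.
  apply: (@le_lt_trans _ _ (mu^-1)%:E); last by rewrite ltry.
  rewrite -mG; apply: le_esum => x _.
  by rewrite -[leRHS]mul1e lee_wpmul2r// lee_fin testf_le1.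
have E1 : (1 + mu)%:E * epair f G <= epair f G + (m / mu)%:E.
  rewrite -epairZ ?(ltW a0)//.
  have -> : (fun x => (1 + mu)%:E * G x) = fun x => edelta x + kop k G x.
    by apply/funext => x; rewrite resolventE.
  rewrite epairD//; last 2 first.
  - exact: edelta_ge0.
  - by move=> x; exact: kop_ge0.
  rewrite epair_delta// /f /testf mul0r expr0n/= (min_r ler01) add0e.
  rewrite -kop_self_adjoint//.
  apply: (@le_trans _ _ (epair (fun x => f x + m%:E) G)).
    apply: epair_le => //; first by move=> x; exact: kop_ge0.
    exact: kop_testf.
  rewrite epairC epairD// (epairC G f) leeD2l//.
  by rewrite /epair; under eq_esum => x _ do rewrite muleC; rewrite esumZl ?lee_fin// mG.
move: E1; rewrite -(fineK ffin) -EFinM -EFinD !lee_fin => E1.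
rewrite expr2 invfM mulrA ler_pdivlMr//.
by move: E1; rewrite mulrDl mul1r lerD2l mulrC.
Qed.

(** [G] has mass [1 / (2 * lam)], of which at most [1 / (4 * lam)] lies outside the ball of radius
    [N]. The rest sits on at most [2 * N] sites, so Cauchy-Schwarz bounds the sum of squares from
    below. *)
Lemma epair_resolvent_lower k (N : nat) (m lam : R) : (forall z, (0 <= k z)%R) ->
  (forall z, k (- z)%R = k z) -> \esum_(z in [set: int]) (k z)%:E = 1 ->
  \esum_(z in [set: int]) (k z * testf N%:R z)%:E = m%:E ->
  (0 < N)%N -> (0 < lam)%R -> (m <= lam)%R ->
  ((32 * lam ^+ 2 * N%:R)^-1)%:E <=
  epair (resolvent k (1 + 2 * lam)) (resolvent k (1 + 2 * lam)).
Proof.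
move=> k0 kev mk mm N0 lam0 mlam; set G := resolvent _ _.
have mu0 : (0 < 2 * lam)%R by rewrite mulr_gt0.
have a0 : (0 < 1 + 2 * lam)%R by rewrite addr_gt0.
have G0 x : 0 <= G x by exact: resolvent_ge0.
have mG := @resolvent_mass _ k 1%R (1 + 2 * lam)%R k0 (ltac:(lra)) mk.
rewrite -/G addrC addKr in mG.
have Gfin x : G x \is a fin_num by apply: (resolvent_fin k0 _ mk); lra.
have tG : epair (fun y => (testf N%:R y)%:E) G <= ((4 * lam)^-1)%:E.
  apply: le_trans (epair_resolvent_testf k0 kev mk mm mu0) _.
  rewrite lee_fin exprMn ler_pdivrMr; last by rewrite mulr_gt0// exprn_gt0.
  rewrite (_ : ((4 * lam)^-1 * (2 ^+ 2 * lam ^+ 2) = lam)%R) //.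
  by field; rewrite gt_eqF.
(* Cauchy-Schwarz is used in the form [2 * t * g <= g ^+ 2 + t ^+ 2] on the ball; [t] is the
   remaining mass [1 / (4 * lam)] divided by the [2 * N] sites. *)
pose t : R := ((8 * lam * N%:R)^-1)%R.
have N0' : (0 < N%:R :> R)%R by rewrite ltr0n.
have t0 : (0 < t)%R by rewrite invr_gt0 !mulr_gt0.
have key : ((2 * t)%:E * (\esum_(x in [set: int]) G x) <=
  epair G G + ((t ^+ 2)%:E * (2 * N%:R)%:E + (2 * t)%:E * epair (fun y => (testf N%:R y)%:E) G))%E.
  apply: (@le_trans _ _ (epair G G + ((t ^+ 2)%:E * (\esum_(x in [set: int]) (if (`|x| < N)%N then 1 else 0)) + (2 * t)%:E * epair (fun y => (testf N%:R y)%:E) G))).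
    rewrite -!esumZl ?lee_fin ?mulr_ge0 ?sqr_ge0 ?(ltW t0)//; last 2 first.
    - by move=> x; rewrite mule_ge0 ?lee_fin ?testf_ge0.
    - by move=> x; case: ifP.
    rewrite -!esumD; last 4 first.
    - by move=> x _; rewrite mule_ge0.
    - move=> x _; rewrite adde_ge0//.
        by case: ifP => _; rewrite mule_ge0 ?lee_fin ?sqr_ge0.
      by rewrite !mule_ge0 ?lee_fin ?testf_ge0 ?mulr_ge0 ?(ltW t0).
    - by move=> x _; case: ifP => _; rewrite mule_ge0 ?lee_fin ?sqr_ge0.
    - by move=> x _; rewrite !mule_ge0 ?lee_fin ?testf_ge0 ?mulr_ge0 ?(ltW t0).
    apply: le_esum => x _; rewrite -(fineK (Gfin x)).
    have g0 : (0 <= fine (G x))%R by rewrite fine_ge0.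
    case: ifPn => hx.
      rewrite mule1 -!EFinM -!EFinD lee_fin.
      have h1 : (0 <= 2 * t * (testf N%:R x * fine (G x)))%R.
        by rewrite !mulr_ge0 ?testf_ge0 ?(ltW t0).
      have := sqr_ge0 (fine (G x) - t)%R; lra.
    rewrite mule0 add0e -!EFinM -!EFinD lee_fin.
    have -> : testf N%:R x = 1%R.
      rewrite /testf; apply/min_idPl.
      rewrite expr_div_n ler_pdivlMr ?exprn_gt0// mul1r.
      rewrite -[leRHS]real_normK ?num_real// -intr_norm -natr_absz.
      by rewrite lerXn2r ?nnegrE// ler_nat leqNgt.
    rewrite mul1r lerDr; exact: sqr_ge0.
  rewrite leeD2l// leeD2r// lee_wpmul2l ?lee_fin ?sqr_ge0//.
  exact: esum_ball_le.
have key2 : (2 * t / (2 * lam))%:E <= epair G G + (t ^+ 2 * (2 * N%:R) + 2 * t / (4 * lam))%:E.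
  rewrite mG -EFinM in key; apply: (le_trans key).
  rewrite leeD2l// EFinD; apply: leeD; first by rewrite EFinM.
  by rewrite [leRHS]EFinM lee_wpmul2l// lee_fin mulr_ge0// ltW.
rewrite -leeBlDr// -EFinB in key2; apply: le_trans key2.
rewrite lee_fin /t le_eqVlt; apply/orP; left; apply/eqP; field.
by rewrite !gt_eqF.
Qed.

(* Compares the two sides of the resolvent identity
   [eta * <G, H> + H 0 = G 0 + <G, e H>]: the lower bound on [<G, H>] is of order
   [1 / (lam ^ 2 * N)] and the upper bound on [<G, e H>] of order [s / lam ^ 2]. *)
Lemma green_comparison k e (N : nat) (m lam eta ke s : R) :
  (forall z, (0 <= k z)%R) -> (forall z, (0 <= e z)%R) ->
  (forall z, k (- z)%R = k z) ->
  \esum_(z in [set: int]) (k z)%:E = 1 ->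
  \esum_(z in [set: int]) (e z)%:E = ke%:E ->
  \esum_(z in [set: int]) (k z * testf N%:R z)%:E = m%:E ->
  (0 < N)%N -> (0 < lam)%R -> (m <= lam)%R -> (0 <= eta <= lam)%R ->
  (ke <= lam / 2)%R -> (forall z, (e z <= s)%R) -> (64 * s * N%:R <= eta)%R ->
  resolvent (fun z => k z + e z)%R (1 + (lam + eta)) 0%R <= resolvent k (1 + lam) 0%R.
Proof.
move=> k0 e0 kev mk me mm N0 lam0 mlam /andP[eta0 etal] kel es hs.
have ke0 : (0 <= ke)%R by rewrite -lee_fin -me esum_ge0// => z _; rewrite lee_fin.
have s0 : (0 <= s)%R by exact: le_trans (es 0%R).
have h := @resolvent_perturbation k e 1%R ke (1 + lam)%R (1 + (lam + eta))%R k0 e0 kev mk me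
   (ltac:(lra)) (ltac:(lra)) (ltac:(lra)).
move: h; set G := resolvent k _; set H := resolvent _ (1 + (lam + eta)) => /= h.
have mke : \esum_(z in [set: int]) ((k z + e z)%R)%:E = (1 + ke)%:E.
  by rewrite EFinD -mk -me -esumD// => z _; rewrite lee_fin.
have G0 x : 0 <= G x by apply: resolvent_ge0 => //; lra.
have H0 x : 0 <= H x by apply: resolvent_ge0 => [z|]; [rewrite addr_ge0|lra].
have mG := @resolvent_mass _ k 1%R (1 + lam)%R k0 (ltac:(lra)) mk.
rewrite -/G addrC addKr in mG.
have mH := @resolvent_mass _ (fun z => k z + e z)%R (1 + ke)%R (1 + (lam + eta))%R
  (fun z => addr_ge0 (k0 z) (e0 z)) (ltac:(lra)) mke.
rewrite -/H in mH.
(* [kop e H] is at most [s] times the mass of [H], which is at most [2 / lam] because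
   [ke <= lam / 2]; the mass of [G] is [1 / lam]. *)
have ub : epair G (kop e H) <= (s * (2 / lam ^+ 2))%:E.
  apply: (@le_trans _ _ (epair G (fun=> (s * (2 / lam))%:E))).
    apply: epair_le => // x; first exact: kop_ge0.
    apply: (@le_trans _ _ (s%:E * \esum_(z in [set: int]) H z)).
      rewrite -esumZl// -(esum_int_shift x); apply: le_esum => z _.
      by rewrite addrC lee_wpmul2r// lee_fin.
    rewrite mH -EFinM lee_fin ler_wpM2l//.
    rewrite -[X in (X <= _)%R]mul1r ler_pdivrMr; last lra.
    rewrite mulrAC ler_pdivlMr// mul1r; lra.
  rewrite epairC /epair esumZl//; last by rewrite lee_fin mulr_ge0// divr_ge0// ltW.
  rewrite mG -EFinM lee_fin le_eqVlt; apply/orP; left; apply/eqP; field.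
  by rewrite gt_eqF.
(* Since [eta <= lam] and [e] is nonnegative, [G] and [H] both dominate the resolvent of [k] at
   [1 + 2 * lam]. *)
have lb : ((32 * lam ^+ 2 * N%:R)^-1)%:E <= epair G H.
  apply: le_trans (epair_resolvent_lower k0 kev mk mm N0 lam0 mlam) _.
  apply: epair_le => x; [| |apply: resolvent_le => // |apply: resolvent_le => //].
  - by apply: resolvent_ge0 => //; lra.
  - by apply: resolvent_ge0 => //; lra.
  - by apply/andP; split; lra.
  - by move=> z; rewrite lerDl.
  - by apply/andP; split; lra.
have N0' : (0 < N%:R :> R)%R by rewrite ltr0n.
have {}ub : epair G (kop e H) <= (1 + (lam + eta) - (1 + lam))%:E * epair G H.
  apply: (le_trans ub); apply: (@le_trans _ _ (eta%:E * ((32 * lam ^+ 2 * N%:R)^-1)%:E)).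
    rewrite -EFinM lee_fin ler_pdivlMr; last by rewrite !mulr_gt0 ?exprn_gt0.
    rewrite (_ : (s * (2 / lam ^+ 2) * (32 * lam ^+ 2 * N%:R) = 64 * s * N%:R)%R)//.
    by field; rewrite gt_eqF.
  by rewrite (_ : (1 + (lam + eta) - (1 + lam) = eta)%R) ?lee_wpmul2l ?lee_fin//; lra.
have pfin : (1 + (lam + eta) - (1 + lam))%:E * epair G H \is a fin_num.
  rewrite fin_numM// ge0_fin_numE ?epair_ge0//.
  apply: (@le_lt_trans _ _ ((lam^-1)%:E * \esum_(x in [set: int]) H x)).
    rewrite -esumZl ?lee_fin ?invr_ge0 ?(ltW lam0)//.
    apply: le_esum => x _; rewrite lee_wpmul2r// -mG.
    exact: (@esum_term_le _ _ x G).
  by rewrite mH -EFinM ltry.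
have : (1 + (lam + eta) - (1 + lam))%:E * epair G H + H 0%R <=
  (1 + (lam + eta) - (1 + lam))%:E * epair G H + G 0%R.
  by rewrite h addeC leeD2r.
by rewrite leeD2lE.
Qed.

End green_comparison.

(** * Length scales of the jump kernel *)

Section kernel_scales.
Context (R : realType) (gamma : R) (J : int -> R).
Hypothesis gamma01 : 0 < gamma < 1.

Let gamma0 : 0 < gamma. Proof. by case/andP: gamma01. Qed.
Let gamma1 : gamma < 1. Proof. by case/andP: gamma01. Qed.

Let q (n : nat) : R := n%:R `^ (- gamma).
Let s (n : nat) : R := n%:R `^ (- (1 + gamma)).

Lemma powRN1D (n : nat) : (0 < n)%N -> s n = q n / n%:R.
Proof.
move=> n0; rewrite /s /q opprD powRD; last first.
  by apply/implyP => _; rewrite pnatr_eq0 -lt0n.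
by rewrite powR_inv1// mulrC.
Qed.

Let q_gt0 n : (0 < n)%N -> 0 < q n.
Proof. by move=> n0; apply: powR_gt0; rewrite ltr0n. Qed.

Let s_gt0 n : (0 < n)%N -> 0 < s n.
Proof. by move=> n0; apply: powR_gt0; rewrite ltr0n. Qed.

Lemma ler_powRN (r : R) (m n : nat) : 0 <= r -> (0 < m)%N -> (m <= n)%N ->
  n%:R `^ (- r) <= m%:R `^ (- r).
Proof.
move=> r0 m0 mn; have n0 : (0 < n)%N by exact: leq_trans mn.
rewrite !powRN lef_pV2 ?posrE ?powR_gt0 ?ltr0n//.
by rewrite ge0_ler_powR ?nnegrE ?ler_nat.
Qed.

(* The sum of [s] telescopes: [s (n + 1)] is at most the increment of [- q / gamma]. *)
Lemma powRN_telescope n : (0 < n)%N -> gamma * s n.+1 <= q n - q n.+1.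
Proof.
move=> n0; rewrite powRN1D// lerBrDr.
have y0 : 0 < n.+1%:R :> R by rewrite ltr0n.
have n0' : 0 < n%:R :> R by rewrite ltr0n.
have -> : q n = q n.+1 * (n%:R / n.+1%:R) `^ (- gamma).
  rewrite /q -powRM ?divr_ge0//; congr (_ `^ _).
  by rewrite mulrCA divff ?mulr1// pnatr_eq0.
rewrite mulrCA -[X in _ + X <= _]mulr1 -mulrDr ler_pM2l ?q_gt0//.
have u0 : 0 < n%:R / n.+1%:R :> R by rewrite divr_gt0.
(* For [u = n / (n + 1)], [u ^ (- gamma)] is at least [1 - gamma * ln u], and
   [ln u <= u - 1 = - 1 / (n + 1)]. *)
rewrite /powR gt_eqF//; apply: le_trans (expR_ge1Dx _).
rewrite addrC lerD2l mulNr -mulrN ler_pM2l// lerNr.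
have -> : n%:R / n.+1%:R = 1 + (- n.+1%:R^-1) :> R.
  by rewrite -[in LHS](addrK 1 n%:R) natr1 mulrBl divff ?pnatr_eq0// mul1r.
apply: le_ln1Dx; rewrite ltrN2 invf_lt1//.
by rewrite ltr1n ltnS.
Qed.

Hypothesis J0 : forall x, 0 <= J x.
Hypothesis Jev : forall x, J (- x) = J x.
Hypothesis Jmass : (\esum_(x in [set: int]) (J x)%:E = 1)%E.
Hypothesis Jmono : forall x y : int, (`|x| <= `|y|)%N -> J y <= J x.
Hypothesis Jasymp :
  J x / `|x|%N%:R `^ (- (1 + gamma)) @[x --> int_infty] --> (1 : R).

Let J1 x : J x <= 1.
Proof.
rewrite -lee_fin -Jmass.
by apply: (@esum_term_le _ _ x (fun x => (J x)%:E)) => y; rewrite lee_fin.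
Qed.

(** From some [M] on, the asymptotics give the factors [1 / 2] and [2]. Below [M] the lower bound
    comes from [J M] by monotonicity and the upper one from [J <= 1]; both constants are adjusted by
    [s M]. *)
Lemma kernel_two_sided : exists c C : R, [/\ 0 < c, 0 < C &
  forall n, (0 < n)%N -> c * s n <= J n%:Z <= C * s n].
Proof.
have : \forall x \near int_infty, `|1 - J x / `|x|%N%:R `^ (- (1 + gamma))| < 2^-1.
  by move/cvgrPdist_lt : Jasymp; apply; rewrite invr_gt0.
move=> [M0 _ hM0].
pose M := M0.+1.
have hM n : (M <= n)%N -> 2^-1 * s n <= J n%:Z <= 2 * s n.
  move=> Mn; have n0 : (0 < n)%N by exact: leq_trans Mn.
  have := hM0 n%:Z (ltnW Mn); rewrite /= -/(s n) ltr_norml => /andP[h1 h2].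
  apply/andP; split; first by rewrite -ler_pdivlMr ?s_gt0//; lra.
  by rewrite -ler_pdivrMr ?s_gt0//; lra.
have sM : 0 < s M by exact: s_gt0.
have sle m n : (0 < m)%N -> (m <= n)%N -> s n <= s m.
  by move=> m0 mn; apply: ler_powRN; rewrite // addr_ge0// ltW.
have s1 : s 1 = 1 by rewrite /s powR1.
have s_le1 n : (0 < n)%N -> s n <= 1 by move=> n0; rewrite -s1 sle.
exists (2^-1 * s M), (Num.max 2 (s M)^-1); split.
- by rewrite mulr_gt0.
- by rewrite lt_max ltr0n.
- move=> n n0; case: (leqP M n) => hn.
    have /andP[h1 h2] := hM _ hn; apply/andP; split.
      apply: le_trans h1; rewrite -mulrA ler_wpM2l//.
      by rewrite -[leRHS]mul1r ler_wpM2r ?s_le1// (ltW (s_gt0 n0)).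
    by apply: le_trans h2 _; rewrite ler_wpM2r ?(ltW (s_gt0 n0))// le_max lexx.
  apply/andP; split.
    apply: le_trans (_ : J M%:Z <= _); last by apply: Jmono; rewrite !absz_nat ltnW.
    have /andP[h1 _] := hM _ (leqnn M); apply: le_trans h1.
    by rewrite -[leRHS]mulr1 -!mulrA ler_wpM2l// ler_wpM2l ?s_le1// ltW.
  apply: le_trans (J1 _) _.
  apply: le_trans (_ : (s M)^-1 * s n <= _).
    by rewrite mulrC ler_pdivlMr// mul1r sle// ltnW.
  by rewrite ler_wpM2r ?(ltW (s_gt0 n0))// le_max lexx orbT.
Qed.

(** Up to [N], each term is at most [C * s N], because [n ^ (1 - gamma)] increases with [n]; these
    [N] terms give [C * q N]. Beyond [N] the telescoping bound gives [C * q N / gamma]. The factor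
    [2] counts both signs. *)
Lemma truncated_moment_le (C : R) : 0 < C ->
  (forall n, (0 < n)%N -> J n%:Z <= C * s n) ->
  forall N, (0 < N)%N ->
  (\esum_(z in [set: int]) (J z * testf N%:R z)%:E <= (2 * (C * (1 + gamma^-1)) * q N)%:E)%E.
Proof.
move=> C0 hC N N0.
have N0' : 0 < N%:R :> R by rewrite ltr0n.
pose f (n : nat) : R := J n%:Z * testf N%:R n%:Z.
have f0 n : 0 <= f n by rewrite mulr_ge0 ?testf_ge0.
have fz : f 0 = 0 by rewrite /f /testf mul0r expr0n/= (min_r ler01) mulr0.
have fE : (\esum_(n in [set: nat]) (f n)%:E = \esum_(n in [set: nat]) (f n.+1)%:E)%E.
  by rewrite esum_nat_recl ?fz ?add0e// => n; rewrite lee_fin.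
rewrite esum_int; last by move=> x; rewrite lee_fin mulr_ge0 ?testf_ge0.
rewrite [X in (X + _)%E]fE.
have -> : (\esum_(n in [set: nat]) (J (- n.+1%:Z) * testf N%:R (- n.+1%:Z))%:E =
  \esum_(n in [set: nat]) (f n.+1)%:E)%E.
  apply: eq_esum => n _; rewrite Jev /f; congr (_ * _)%:E.
  by rewrite /testf mulrNz mulNr sqrrN.
suff H : (\esum_(n in [set: nat]) (f n.+1)%:E <= ((C * (1 + gamma^-1)) * q N)%:E)%E.
  by apply: le_trans (leeD H H) _; rewrite -EFinD lee_fin; lra.
apply: esum_nat_le => [n|n]; first by rewrite lee_fin.
rewrite sumEFin lee_fin.
have small i : (i.+1 <= N)%N -> f i.+1 <= C * s N.
  move=> iN; apply: (@le_trans _ _ (C * s i.+1 * (i.+1%:R / N%:R) ^+ 2)).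
    rewrite /f ler_pM// ?testf_ge0 ?hC//.
    by rewrite /testf ge_min lexx orbT.
  rewrite -mulrA ler_wpM2l ?(ltW C0)//.
  rewrite !powRN1D// expr_div_n.
  have i0 : 0 < i.+1%:R :> R by rewrite ltr0n.
  have -> : q i.+1 / i.+1%:R * (i.+1%:R ^+ 2 / N%:R ^+ 2) =
     (q i.+1 * i.+1%:R) / N%:R ^+ 2 by field; rewrite !gt_eqF.
  have -> : q N / N%:R = (q N * N%:R) / N%:R ^+ 2 by field; rewrite gt_eqF.
  rewrite ler_pM2r ?invr_gt0 ?exprn_gt0//.
  have qE k : (0 < k)%N -> q k * k%:R = k%:R `^ (1 - gamma).
    move=> k0; rewrite powRD; first by rewrite powRr1// mulrC.
    by apply/implyP => _; rewrite pnatr_eq0 -lt0n.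
  by rewrite !qE// ge0_ler_powR ?nnegrE ?ler_nat// subr_ge0 ltW.
have le1 M : (M <= N)%N -> \sum_(0 <= i < M) f i.+1 <= M%:R * (C * s N).
  elim: M => [|M IH] hM; first by rewrite big_nil mul0r.
  rewrite big_nat_recr//= -natr1 mulrDl mul1r lerD ?small//.
  by apply: IH; exact: ltnW.
have le1' M : (M <= N)%N -> \sum_(0 <= i < M) f i.+1 <= C * q N.
  move=> hM; apply: le_trans (le1 _ hM) _.
  apply: (@le_trans _ _ (N%:R * (C * s N))).
    by rewrite ler_wpM2r ?ler_nat// mulr_ge0 ?(ltW C0)// (ltW (s_gt0 N0)).
  rewrite powRN1D// le_eqVlt; apply/orP; left; apply/eqP; field.
  by rewrite gt_eqF.
have le2 j : \sum_(0 <= i < N + j) f i.+1 <= C * q N + C * gamma^-1 * (q N - q (N + j)%N).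
  elim: j => [|j IH]; first by rewrite addn0 subrr mulr0 addr0 le1'.
  rewrite addnS big_nat_recr//=; apply: le_trans (lerD IH (lexx _)) _.
  have Nj : (0 < N + j)%N by rewrite addn_gt0 N0.
  have hh : f (N + j).+1 <= C * s (N + j).+1.
    apply: le_trans (hC _ _); rewrite // /f -[leRHS]mulr1 ler_wpM2l//.
    exact: testf_le1.
  have : f (N + j).+1 <= C * gamma^-1 * (q (N + j)%N - q (N + j).+1).
    apply: le_trans hh _; rewrite -mulrA ler_pM2l// mulrC ler_pdivlMr// mulrC.
    exact: powRN_telescope.
  lra.
case: (leqP n N) => hn.
  apply: le_trans (le1' _ hn) _; rewrite -mulrA ler_pM2l// -[leLHS]mul1r.
  by rewrite ler_wpM2r ?(ltW (q_gt0 N0))// lerDl invr_ge0 ltW.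
rewrite -(subnKC (ltnW hn)); apply: le_trans (le2 _) _.
have qq : 0 < q (N + (n - N))%N by rewrite q_gt0// addn_gt0 N0.
have : 0 < C * gamma^-1 * q (N + (n - N))%N by rewrite !mulr_gt0 ?invr_gt0.
lra.
Qed.

Definition far_kernel (K : nat) (z : int) : R := if (K <= `|z|)%N then J z else 0.

Lemma far_kernel_ge0 K z : 0 <= far_kernel K z.
Proof. by rewrite /far_kernel; case: ifP. Qed.

Lemma far_kernel_mass_ge K : (0 < K)%N ->
  ((K%:R * J (K + K)%N%:Z)%:E <= \esum_(z in [set: int]) (far_kernel K z)%:E)%E.
Proof.
move=> K0.
apply: le_trans (@esum_seq_le _ _ [seq Posz n | n <- iota K K] _ _ _); last 2 first.
- by rewrite map_inj_uniq ?iota_uniq// => m n [].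
- by move=> z; rewrite lee_fin far_kernel_ge0.
rewrite big_map sumEFin lee_fin.
apply: (@le_trans _ _ (\sum_(n <- iota K K) J (K + K)%N%:Z)).
  by rewrite big_const_seq count_predT size_iota iter_addr_0 mulr_natl.
rewrite big_seq [leRHS]big_seq; apply: ler_sum => n.
rewrite mem_iota => /andP[h1 h2]; rewrite /far_kernel absz_nat h1.
by apply: Jmono; rewrite !absz_nat ltnW.
Qed.

(** [N] is the least scale with [C2 * q N <= lam / 8], so [q N] has exact order [lam]. This bounds
    [m], and also [t], since [testf] is [1] beyond [N <= K]. With [K = M * N], the far mass is at
    least [K * J (2 * K)], of order [q K], whereas [N * J K] has order [q K / M]; a large [M] yields
    the last inequality. *)
Lemma kernel_scales (A B : R) : 0 < A -> 0 < B -> exists2 c : R, 0 < c &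
  forall lam, 0 < lam <= B -> exists N K : nat, exists m t : R,
  [/\ (0 < N)%N,
   (\esum_(z in [set: int]) (J z * testf N%:R z)%:E = m%:E)%E /\ m <= lam / 8,
   (\esum_(z in [set: int]) (far_kernel K z)%:E = t%:E)%E /\ (0 < K)%N,
   c * lam <= t <= lam / 8 &
   A * J K%:Z * N%:R <= t].
Proof.
move=> A0 B0; have [c1 [C1 [c10 C10 hcC]]] := kernel_two_sided.
(* The summand [B] makes [N = 1] fail [good] for every [lam <= B], so that [N.-1] is positive and
   minimality can be exploited there. *)
pose C2 := 2 * (C1 * (1 + gamma^-1)) + B.
have g1 : 0 < 1 + gamma^-1 by rewrite addr_gt0// invr_gt0.
have C20 : 0 < C2 by rewrite addr_gt0// !mulr_gt0.
have [M hM] : exists M : nat, 4 * A * C1 / c1 <= M%:R.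
  exists (Num.truncn (4 * A * C1 / c1)).+1; apply/ltW/truncnS_gt.
have M0 : (0 < M)%N.
  rewrite lt0n; apply/negP => /eqP M0; move: hM; rewrite M0 leNgt => /negP; apply.
  by rewrite divr_gt0// !mulr_gt0.
exists (c1 / 4 * q M * (16 * C2)^-1).
  by rewrite !mulr_gt0 ?invr_gt0 ?q_gt0// mulr_gt0.
move=> lam /andP[lam0 lamB].
pose good (N : nat) := (0 < N)%N && (C2 * q N <= lam / 8).
have exN : exists N, good N.
  pose x := (C2 * 8 / lam) `^ (gamma^-1).
  exists (Num.truncn x).+1; rewrite /good /=.
  rewrite ler_pdivlMr// mulrAC /q powRN ler_pdivrMr ?powR_gt0//.
  rewrite -ler_pdivrMl//.
  have -> : lam^-1 * (C2 * 8) = x `^ gamma.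
    by rewrite /x -powRrM mulVf ?gt_eqF// powRr1 ?divr_ge0 ?mulr_ge0 ?ltW// mulrC.
  by rewrite ge0_ler_powR ?nnegrE ?powR_ge0 ?(ltW gamma0)// ltW// truncnS_gt.
case: (ex_minnP exN) => N /andP[N0 hN] Nmin.
have N1 : (1 < N)%N.
  rewrite ltn_neqAle N0 andbT; apply/negP => /eqP N1.
  move: hN; rewrite -N1 /q powR1 mulr1 leNgt => /negP; apply.
  apply: (@le_lt_trans _ _ B); first lra.
  by rewrite ltrDr !mulr_gt0.
(* By minimality [N.-1] is not [good], and [q N.-1 <= 2 ^ gamma * q N <= 2 * q N] because
   [N <= 2 * N.-1]. *)
have qN : lam / (16 * C2) <= q N.
  have : lam / 8 < C2 * q N.-1.
    rewrite ltNge; apply/negP => h.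
    have : (N <= N.-1)%N by apply: Nmin; rewrite /good h andbT; move: N1; case: (N) => [|[]].
    by rewrite leqNgt prednK ?leqnn.
  move=> h; rewrite ler_pdivrMr ?mulr_gt0//.
  have hq : q N.-1 <= 2 * q N.
    apply: (@le_trans _ _ (2 `^ gamma * q N)); last first.
      rewrite ler_wpM2r ?(ltW (q_gt0 N0))// -[leRHS]powRr1//.
      by rewrite ler_powR// ?ler1n// ltW.
    have -> : 2 `^ gamma * q N = (N%:R / 2) `^ (- gamma).
      rewrite /q powRM// ?invr_ge0// mulrC; congr (_ * _).
      by rewrite powRN -[2^-1]powR_inv1// -powRrM mulN1r powRN invrK.
    have NP : (0 < N.-1)%N by rewrite -ltnS prednK.
    rewrite /q !powRN lef_pV2 ?posrE ?powR_gt0 ?divr_gt0 ?ltr0n//.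
    rewrite ge0_ler_powR ?nnegrE ?(ltW gamma0) ?divr_ge0//.
    rewrite ler_pdivrMr// -(prednK N0) /= -natr1 mulr_natr mulr2n lerD2l.
    by rewrite ler1n -ltnS prednK.
  have : C2 * q N.-1 <= C2 * (2 * q N) by rewrite ler_pM2l.
  lra.
pose K := (M * N)%N.
have K0 : (0 < K)%N by rewrite muln_gt0 M0.
have NK : (N <= K)%N by rewrite leq_pmull.
have mfin : (\esum_(z in [set: int]) (J z * testf N%:R z)%:E <= (lam / 8)%:E)%E.
  apply: le_trans (truncated_moment_le C10 _ N0) _.
    by move=> n n0; case/andP: (hcC n n0).
  rewrite lee_fin; apply: le_trans hN; rewrite ler_wpM2r ?(ltW (q_gt0 N0))//.
  by rewrite lerDl ltW.
have m0 : (0 <= \esum_(z in [set: int]) (J z * testf N%:R z)%:E)%E.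
  by apply: esum_ge0 => z _; rewrite lee_fin mulr_ge0 ?testf_ge0.
have t0 : (0 <= \esum_(z in [set: int]) (far_kernel K z)%:E)%E.
  by apply: esum_ge0 => z _; rewrite lee_fin far_kernel_ge0.
have tm : (\esum_(z in [set: int]) (far_kernel K z)%:E <=
   \esum_(z in [set: int]) (J z * testf N%:R z)%:E)%E.
  apply: le_esum => z _; rewrite lee_fin /far_kernel; case: ifP => hz; last first.
    by rewrite mulr_ge0 ?testf_ge0.
  have -> : testf N%:R z = 1 :> R; last by rewrite mulr1.
  rewrite /testf; apply/min_idPl.
  rewrite expr_div_n ler_pdivlMr ?exprn_gt0 ?ltr0n// mul1r.
  rewrite -[leRHS]real_normK ?num_real// -intr_norm -natr_absz.
  by rewrite lerXn2r ?nnegrE// ler_nat (leq_trans NK).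
have Efin x : (0 <= x)%E -> (x <= (lam / 8)%:E)%E -> x = (fine x)%:E.
  by move=> x0 xl; rewrite fineK// ge0_fin_numE// (le_lt_trans xl)// ltry.
exists N, K, (fine (\esum_(z in [set: int]) (J z * testf N%:R z)%:E)%E),
  (fine (\esum_(z in [set: int]) (far_kernel K z)%:E)%E).
have tfin := Efin _ t0 (le_trans tm mfin).
have tlow := far_kernel_mass_ge K0.
have KK0 : 0 < K%:R :> R by rewrite ltr0n.
have sKK : s K / 4 <= s (K + K)%N.
  rewrite /s addnn -mul2n natrM powRM// mulrC ler_wpM2r ?powR_ge0//.
  rewrite powRN lef_pV2 ?posrE ?powR_gt0//.
  have -> : 4 = 2 `^ 2 :> R by rewrite (powR_mulrn 2)// expr2 -natrM.
  by apply: ler_powR; [rewrite ler1n|have := gamma1; lra].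
have tlow2 : K%:R * (c1 * (s K / 4)) <= fine (\esum_(z in [set: int]) (far_kernel K z)%:E)%E.
  rewrite -lee_fin -tfin; apply: le_trans tlow; rewrite lee_fin ler_pM2l//.
  have /andP[h _] := hcC (K + K)%N (ltac:(by rewrite addn_gt0 K0)).
  by apply: le_trans h; rewrite ler_pM2l.
split => //.
- by split; [exact: Efin|rewrite -lee_fin -Efin].
- apply/andP; split; last by rewrite -lee_fin -tfin (le_trans tm).
  apply: le_trans tlow2; rewrite powRN1D//.
  have -> : K%:R * (c1 * (q K / K%:R / 4)) = c1 / 4 * q K by field; rewrite gt_eqF.
  have -> : q K = q M * q N by rewrite /q natrM powRM.
  have -> : c1 / 4 * q M / (16 * C2) * lam = c1 / 4 * q M * (lam / (16 * C2)) by ring.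
  by rewrite mulrA ler_pM2l// mulr_gt0 ?divr_gt0 ?q_gt0.
- apply: le_trans tlow2.
  have /andP[_ h] := hcC K K0.
  apply: (@le_trans _ _ (A * (C1 * s K) * N%:R)).
    by rewrite ler_wpM2r// ler_wpM2l// ltW.
  have -> : A * (C1 * s K) * N%:R = s K * (A * C1 * N%:R) by ring.
  have -> : K%:R * (c1 * (s K / 4)) = s K * (K%:R * c1 / 4) by ring.
  rewrite ler_pM2l ?s_gt0// /K natrM.
  move: hM; rewrite ler_pdivrMr// => hM.
  have N0' : 0 < N%:R :> R by rewrite ltr0n.
  have : 4 * A * C1 * N%:R <= M%:R * c1 * N%:R by rewrite ler_pM2r.
  lra.
Qed.

End kernel_scales.

(** * Independence of the holding times *)

Section exponential_fubini.
Context (R : realType) (d : measure_display) (T : measurableType d).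
Variable Q : probability T R.
Local Open Scope ereal_scope.
Local Notation mu := (@lebesgue_measure R).

(** The product is first computed through sections in the second variable, where [exponential_prob]
    unfolds to a Lebesgue integral of the density; Tonelli for Lebesgue measure and [Q] swaps the
    order back. *)
Lemma exponential_fubini (E : set (measurableTypeR R * T)) : measurable E ->
  (exponential_prob (1 : R) \x Q) E =
  \int[mu]_s ((exponential_pdf 1 s)%:E * Q (xsection E s)).
Proof.
move=> mE.
have pdf0 s : (0 <= exponential_pdf 1 s :> R)%R by exact: exponential_pdf_ge0.
rewrite /product_measure1.
have -> : Q \o xsection E = fubini_F Q (EFin \o \1_E).
  by rewrite indic_fubini_tonelli_FE.
rewrite indic_fubini_tonelli// indic_fubini_tonelli_GE//.
transitivity (\int[Q]_y \int[mu]_s ((exponential_pdf 1 s)%:E * (\1_E (s, y))%:E)).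
  apply: eq_integral => y _; rewrite /= /exponential_prob integral_mkcond.
  apply: eq_integral => s _; rewrite patchE mem_ysection indicE.
  by case: ((s, y) \in E) => /=; rewrite ?mule1 ?mule0.
pose f (z : measurableTypeR R * T) := (exponential_pdf 1 z.1)%:E * (\1_E z)%:E.
have f0 z : 0 <= f z by rewrite mule_ge0 ?lee_fin.
have mf : measurable_fun [set: (measurableTypeR R * T)%type] f.
  apply: emeasurable_funM; last exact/measurable_EFinP/measurable_indic.
  apply/measurable_EFinP; apply: measurableT_comp => //.
  exact: measurable_exponential_pdf.
rewrite -(@fubini_tonelli _ _ _ _ _ mu Q f mf f0).
apply: eq_integral => s _; rewrite /fubini_F /f /= ge0_integralZl//.
- congr (_ * _); rewrite -(setIT (xsection E s)) -integral_indic//; last exact: measurable_xsection.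
  apply: eq_integral => y _; congr (_%:E).
  by rewrite !indicE mem_xsection.
- apply/measurable_EFinP; rewrite (_ : (fun _ => _) = \1_(xsection E s)).
    by apply: measurable_indic; exact: measurable_xsection.
  by apply/funext => y; rewrite !indicE mem_xsection.
- by rewrite lee_fin.
Qed.

End exponential_fubini.

(** * Conditioning on one holding time *)

Section disintegration.
Context (R : realType) (d : measure_display) (Omega : measurableType d).
Variables (P : probability Omega R) (J : int -> R).
Variables (tau : nat -> {RV P >-> R}) (xi : nat -> Omega -> int).
Hypothesis wd : walk_data J tau xi.

Definition index_events (i : nat + nat) : set_system Omega :=
  match i with
  | inl n => [set tau n @^-1` A | A in measurable]
  | inr n => [set xi n @^-1` B | B in [set: set int]]
  end.

(** A pi-system generating the sigma-algebra of the variables with index in [Q]. Families over all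
    indices, trivial off a finite list, make intersections componentwise. *)
Definition cylinders (Q : pred (nat + nat)) : set_system Omega :=
  [set B | exists (A : nat + nat -> set Omega) (s : seq (nat + nat)),
     [/\ forall i, index_events i (A i),
         forall i, ~~ (Q i && (i \in s)) -> A i = setT &
         B = \bigcap_i A i]].

Lemma index_eventsT i : index_events i setT.
Proof. by case: i => n /=; exists setT. Qed.

Lemma index_eventsI i A B : index_events i A -> index_events i B -> index_events i (A `&` B).
Proof.
case: i => n /= [A' mA <-] [B' mB <-].
  by exists (A' `&` B') => //; exact: measurableI.
by exists (A' `&` B').
Qed.

Lemma measurable_xi n (B : set int) : measurable (xi n @^-1` B).
Proof.
rewrite (_ : xi n @^-1` B =
    \bigcup_x (if x \in B then xi n @^-1` [set x] else set0)); last first.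
  apply/seteqP; split => [w Bw|w [x _]].
    by exists (xi n w) => //; rewrite mem_set.
  by case: ifPn => // /set_mem Bx /= ->.
apply: countable_bigcupT_measurable => // x; case: ifPn => // _.
by case: wd => _ + _ _; exact.
Qed.

Lemma index_events_measurable i A : index_events i A -> measurable A.
Proof.
case: i => n /= [B mB <-]; last exact: measurable_xi.
by rewrite -[X in measurable X]setTI; exact: measurable_funPT.
Qed.

Lemma cylinders_measurable Q : cylinders Q `<=` measurable.
Proof.
move=> B [A [s [hA hs ->]]].
rewrite (_ : \bigcap_i A i = \bigcap_(i in [set` s]) A i).
  by apply: fin_bigcap_measurable => // i _; exact: index_events_measurable (hA i).
apply/seteqP; split => [w Aw i _|w Aw i _]; first exact: Aw.
have [si|si] := boolP (i \in s); first exact: Aw.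
by rewrite hs// negb_and si orbT.
Qed.

Lemma cylindersT Q : cylinders Q setT.
Proof.
exists (fun=> setT), [::]; split => //; first by move=> i; exact: index_eventsT.
by rewrite bigcapT.
Qed.

Lemma cylindersI Q : setI_closed (cylinders Q).
Proof.
move=> _ _ [A [s [hA hs ->]]] [A' [s' [hA' hs' ->]]].
exists (fun i => A i `&` A' i), (s ++ s'); split.
- by move=> i; exact: index_eventsI.
- move=> i; rewrite mem_cat andb_orr negb_or => /andP[/hs -> /hs' ->].
  by rewrite setIT.
- by rewrite bigcapI.
Qed.

Lemma cylindersS (Q Q' : pred (nat + nat)) : (forall i, Q i -> Q' i) ->
  cylinders Q `<=` cylinders Q'.
Proof.
move=> QQ B [A [s [hA hs ->]]]; exists A, s; split => // i /negP h.
by apply: hs; apply/negP => /andP[/QQ q si]; apply: h; rewrite q.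
Qed.

Lemma cylinders_tau (Q : pred (nat + nat)) n A : Q (inl n) -> measurable A ->
  cylinders Q (tau n @^-1` A).
Proof.
move=> Qn mA.
exists (fun i => if i == inl n then tau n @^-1` A else setT), [:: inl n]; split.
- move=> i; case: eqP => [->|_]; last exact: index_eventsT.
  by exists A.
- move=> i; rewrite inE; case: eqP => [->|//]; by rewrite Qn.
- apply/seteqP; split => [w Aw i _|w /(_ (inl n) I)]; last by rewrite eqxx.
  by case: eqP.
Qed.

Lemma cylinders_indep (Q : pred (nat + nat)) n C B : ~~ Q (inl n) -> measurable C ->
  cylinders Q B -> P (tau n @^-1` C `&` B) = (P (tau n @^-1` C) * P B)%E.
Proof.
move=> Qn mC [A [s [hA hs ->]]].
case: wd => _ _ _ ind.
pose s0 := [seq i <- undup s | i != inl n].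
have us0 : uniq s0 by rewrite filter_uniq// undup_uniq.
have ns0 : inl n \notin s0 by rewrite mem_filter eqxx.
have An : A (inl n) = setT by apply: hs; rewrite (negbTE Qn).
have capE : \bigcap_i A i = \bigcap_(i in [set` s0]) A i.
  apply/seteqP; split => [w Aw i _|w Aw i _]; first exact: Aw.
  have [si|si] := boolP (i \in s0); first exact: Aw.
  have [->|ne] := eqVneq i (inl n); first by rewrite An.
  rewrite hs//; move: si; rewrite mem_filter ne mem_undup /= => /negbTE ->.
  by rewrite andbF.
pose A' i := if i == inl n then tau n @^-1` C else A i.
have hA' i : index_events i (A' i).
  by rewrite /A'; case: eqP => [->|_] //; exists C.
have E1 : tau n @^-1` C `&` \bigcap_i A i = \bigcap_(i in [set` inl n :: s0]) A' i.
  rewrite capE; apply/seteqP; split => [w [Cw Aw] i /=|w Aw].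
    rewrite inE /A' => /orP[/eqP ->|si]; first by rewrite eqxx.
    by case: eqP => // _; exact: Aw.
  split; first by have := Aw (inl n); rewrite /A' eqxx; apply; rewrite /= mem_head.
  move=> i /= si; have := Aw i; rewrite /A' /= inE si orbT => /(_ isT).
  by case: eqP => // ei; move: si ns0; rewrite ei => ->.
rewrite E1 (ind (inl n :: s0) A'); last 2 first.
- by rewrite /= ns0.
- by move=> i _; have := hA' i; case: i.
rewrite big_cons {1}/A' eqxx capE (ind s0 A us0); last first.
  by move=> i _; have := hA i; case: i.
congr (_ * _)%E; apply: eq_big_seq => i si; rewrite /A'; case: eqP => // ei.
by move: si ns0; rewrite ei => ->.
Qed.

(** With the event of [tau n] fixed, both sides are finite measures in [B] that agree on a
    pi-system, hence on the sigma-algebra it generates. *)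
Lemma sigma_cylinders_indep (Q : pred (nat + nat)) n C B : ~~ Q (inl n) -> measurable C ->
  <<s cylinders Q >> B -> P (tau n @^-1` C `&` B) = (P (tau n @^-1` C) * P B)%E.
Proof.
move=> Qn mC sB.
have mtC : measurable (tau n @^-1` C).
  by rewrite -[X in measurable X]setTI; exact: measurable_funPT.
have fP : P (tau n @^-1` C) \is a fin_num by exact: fin_num_measure.
have p0 : (0 <= fine (P (tau n @^-1` C)))%R by rewrite fine_ge0.
pose m1 := mrestr P mtC.
pose m2 := mscale (NngNum p0) P.
have m2E A : m2 A = (P (tau n @^-1` C) * P A)%E.
  by rewrite /m2 /mscale /=; congr (_ * _)%E; exact: fineK.
suff : m1 B = m2 B by rewrite m2E /m1 /mrestr setIC.
apply: (@g_sigma_algebra_measure_unique _ R Omega (cylinders Q) (@cylinders_measurable Q)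
  (fun=> setT) (fun=> cylindersT Q) _ m1 m2 (@cylindersI Q) _ _ B sB).
- by rewrite bigcup_const//; exists 0%N.
- move=> A cA; apply: etrans (esym (m2E A)).
  rewrite [LHS](_ : _ = P (tau n @^-1` C `&` A)); last by rewrite setIC.
  exact: cylinders_indep cA.
- move=> _; rewrite [ltLHS](_ : _ = P (tau n @^-1` C)); last by rewrite -[in RHS](setTI (_ @^-1` C)).
  by rewrite -ge0_fin_numE.
Qed.

(** The later holding times and all jumps: the jumps are kept so that an event depending on them can
    be carried through the conditioning on [tau n]. *)
Definition future n : pred (nat + nat) := fun i => if i is inl j then (n < j)%N else true.

Definition futureType n := g_sigma_algebraType (cylinders (future n)).

Lemma future_measurable n (A : set Omega) : <<s cylinders (future n) >> A -> measurable A.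
Proof.
by apply: (@smallest_sub _ (@sigma_algebra Omega setT)); [exact: sigma_algebra_measurable|exact: cylinders_measurable].
Qed.

Lemma tau_future n j : (n < j)%N ->
  measurable_fun setT (fun w : futureType n => tau j w).
Proof.
move=> nj _ A mA; rewrite setTI; apply: sub_sigma_algebra.
exact: cylinders_tau.
Qed.

(** The sample point itself, seen through the coarser sigma-algebra of the future, serves as the
    second variable: its joint law with [tau n] is a product measure by [sigma_cylinders_indep]. *)
Lemma disintegration n (E : set (measurableTypeR R * futureType n)) : measurable E ->
  P [set w | E (tau n w, w)] =
  (\int[lebesgue_measure]_s
     ((exponential_pdf 1 s)%:E * P [set w | E (s, w)]))%E.
Proof.
move=> mE.
pose idf : Omega -> futureType n := fun w => w.
have midf : measurable_fun setT idf.
  by move=> _ A mA; rewrite setTI; exact: future_measurable mA.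
have mpair : measurable_fun setT (fun w : Omega => (tau n w : measurableTypeR R, idf w)).
  apply: measurable_fun_pair => //.
  have mt : measurable_fun setT (tau n) by [].
  exact: mt.
pose Pg := distribution P (mfun_Sub (mem_set midf) : {mfun Omega >-> futureType n}).
pose nu := distribution P (mfun_Sub (mem_set mpair) : {mfun Omega >-> (measurableTypeR R * futureType n)%type}).
transitivity (nu E) => //.
have H : (exponential_prob (1 : R) \x Pg)%E E = nu E.
  apply: product_measure_unique => // A B mA mB.
  have := @sigma_cylinders_indep (future n) n A B.
  rewrite /= ltnn => /(_ isT mA mB).
  by case: wd => /(_ n A mA) <- _ _ _.
apply: etrans (esym H) _.
rewrite exponential_fubini//; apply: eq_integral => s _; congr (_ * P _)%E.
by apply/seteqP; split => w /=; rewrite /xsection /= inE.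
Qed.

End disintegration.

(** * The Poisson law of the jump counts *)

Section poisson_events.
Context (R : realType).
Implicit Types (t : nat -> R) (a r : R) (m : nat).

(** [C] is the event required after the interval, and [a] is the age of the current waiting time. A
    renewal resets the age to [0] and leaves the length [a + r - t 0]; without one the age grows to
    [a + r]. *)
Fixpoint renewal_step (C : (nat -> R) -> R -> Prop) m t a r : Prop :=
  if m is m'.+1 then
    [/\ a < t 0, t 0 <= a + r &
        renewal_step C m' (fun j => t j.+1) 0 (a + r - t 0)]
  else C t (a + r).

(* For [l = [:: (r1, m1); ...; (rn, mn)]]: the waiting times [t] exceed [a] at
   first, and exactly [mi] renewals occur in the [i]-th of the consecutive
   intervals of lengths [r1, ..., rn] that start at time [a]. *)
Fixpoint renewal_event (l : seq (R * nat)) t a : Prop :=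
  if l is (r, m) :: l' then renewal_step (renewal_event l') m t a r else a < t 0.

Section measurability.
Context (d : measure_display) (Z : measurableType d).

Lemma measurable_lt_set (f g : Z -> R) : measurable_fun setT f ->
  measurable_fun setT g -> measurable [set z | f z < g z].
Proof.
move=> mf mg; have := measurable_fun_ltr mf mg.
by move=> /(_ measurableT [set true]); rewrite setTI; exact.
Qed.

Lemma measurable_le_set (f g : Z -> R) : measurable_fun setT f ->
  measurable_fun setT g -> measurable [set z | f z <= g z].
Proof.
move=> mf mg; have := measurable_fun_ler mf mg.
by move=> /(_ measurableT [set true]); rewrite setTI; exact.
Qed.

Definition measurable_event (C : (nat -> R) -> R -> Prop) :=
  forall (t : nat -> Z -> R) (a : Z -> R), (forall j, measurable_fun setT (t j)) ->
  measurable_fun setT a -> measurable [set z | C (fun j => t j z) (a z)].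

Lemma measurable_renewal_step C : measurable_event C ->
  forall m (t : nat -> Z -> R) (a r : Z -> R), (forall j, measurable_fun setT (t j)) ->
  measurable_fun setT a -> measurable_fun setT r ->
  measurable [set z | renewal_step C m (fun j => t j z) (a z) (r z)].
Proof.
move=> mC; elim => [|m IH] t a r mt ma mr /=.
  by apply: mC => //; exact: measurable_funD.
rewrite (_ : [set z | _] = [set z | a z < t 0 z] `&` [set z | t 0 z <= a z + r z] `&`
  [set z | renewal_step C m (fun j => t j.+1 z) 0 (a z + r z - t 0 z)]); last first.
  by apply/seteqP; split => [z []|z [[]]].
apply: measurableI; first apply: measurableI.
- exact: measurable_lt_set.
- by apply: measurable_le_set => //; exact: measurable_funD.
- apply: (IH (fun j => t j.+1) (fun=> 0)) => //.
  by apply: measurable_funB => //; exact: measurable_funD.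
Qed.

Lemma measurable_renewal_event l : measurable_event (renewal_event l).
Proof.
elim: l => [|[r m] l IH] t a mt ma /=; first exact: measurable_lt_set.
exact: (measurable_renewal_step IH m mt ma (measurable_cst r)).
Qed.

End measurability.

Definition poisson_weight r m : R := expR (- r) * (r ^+ m / m`!%:R).

Lemma integral_expn_sub (a b c : R) m : a <= b ->
  (\int[lebesgue_measure]_(s in `]a, b]) (c * (b - s) ^+ m)%:E =
   (c * ((b - a) ^+ m.+1 / m.+1%:R))%:E)%E.
Proof.
rewrite le_eqVlt => /predU1P[->|ab].
  by rewrite set_itvoc0 integral_set0 subrr expr0n/= mul0r mulr0.
pose F (s : R) : R := - c / m.+1%:R * (b - s) ^+ m.+1.
have FE : F = (- c / m.+1%:R) \*: ((fun s : R => b - s) ^+ m.+1).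
  have e1 n (f : R -> R) s : (f ^+ n) s = f s ^+ n.
    by elim: n => // n IH; rewrite !exprS -IH.
  by apply/funext => s; rewrite /F -(e1 _ (fun s => b - s)).
have dF s : is_derive s (1 : R) F (c * (b - s) ^+ m).
  have d1 : is_derive s (1 : R) (fun s : R => b - s) (- 1).
    have := is_deriveB (is_derive_cst b s 1) (is_derive_id s 1).
    rewrite sub0r.
    exact.
  have := is_deriveZ (- c / m.+1%:R) (is_deriveX m.+1 d1).
  rewrite -FE => d2; apply: is_derive_eq.
  rewrite /GRing.scale /=; field.
  by rewrite addrC natr1 pnatr_eq0.
have cF : continuous F.
  by move=> s; apply/differentiable_continuous/derivable1_diffP; case: (dF s).
have cf : continuous (fun s : R => c * (b - s) ^+ m).
  move=> s; apply: cvgM; first exact: cvg_cst.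
  apply: (@continuous_comp _ _ _ (fun s : R => b - s) (fun x : R => x ^+ m)).
    by apply: cvgB; [exact: cvg_cst|exact: cvg_id].
  exact: exprn_continuous.
rewrite integral_itv_obnd_cbnd; last first.
  by apply/measurable_EFinP/measurable_funTS; exact: continuous_measurable_fun.
rewrite (@continuous_FTC2 _ _ F) //.
- rewrite /F subrr expr0n/= mulr0 -EFinB; congr (_%:E); field.
  by rewrite addrC natr1 pnatr_eq0.
- exact: continuous_subspaceT.
- split.
  + by move=> s _; case: (dF s).
  + by apply: cvg_at_right_filter; exact: cF.
  + by apply: cvg_at_left_filter; exact: cF.
- by move=> s _; rewrite derive1E; apply: derive_val.
Qed.

Lemma exponential_prob_tail (a : R) : 0 <= a ->
  exponential_prob 1 `]a, +oo[ = (expR (- a))%:E.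
Proof.
move=> a0; rewrite /exponential_prob integral_itv_obnd_cbnd; last first.
  by apply/measurable_EFinP/measurable_funTS; exact: measurable_exponential_pdf.
have cE : continuous (fun z : R => - expR (- 1 * z)).
  move=> z; apply: cvgN; apply: continuous_comp; last exact: continuous_expR.
  by apply: cvgM; [exact: cvg_cst|exact: cvg_id].
rewrite (@ge0_continuous_FTC2y _ _ (fun x => - (expR (- 1 * x))) _ 0)//.
- by rewrite mulN1r EFinN oppeK add0e.
- by move=> x _; apply: exponential_pdf_ge0.
- apply: (@continuous_subspaceW R^o _ _ [set` `[0, +oo[%R]); last exact: within_continuous_exponential_pdf.
  by move=> x /=; rewrite !in_itv/= !andbT; exact: le_trans.
- rewrite -oppr0; apply: cvgN.
  rewrite (_ : (fun x => expR (- 1 * x)) = (fun z : R => expR (- z))); first exact: cvgr_expR.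
  by apply/funext => x; rewrite mulN1r.
- by apply/cvg_at_right_filter; exact: cE.
- move=> x; rewrite in_itv/= andbT => ax; apply: derive1_exponential_pdf.
  by rewrite in_itv/= andbT (le_lt_trans a0).
Qed.

End poisson_events.

Section poisson_law.
Context (R : realType) (d : measure_display) (Omega : measurableType d).
Variables (P : probability Omega R) (J : int -> R).
Variables (tau : nat -> {RV P >-> R}) (xi : nat -> Omega -> int).
Hypothesis wd : walk_data J tau xi.

Definition jumps_only : pred (nat + nat) := fun i => if i is inr _ then true else false.

Definition shifted k (w : Omega) : nat -> R := fun j => tau (j + k)%N w.

Lemma jumps_only_future k (B : set Omega) : <<s cylinders tau xi jumps_only >> B ->
  <<s cylinders tau xi (future k) >> B.
Proof.
apply: sub_smallest2r; first exact: smallest_sigma_algebra.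
by apply: cylindersS => -[].
Qed.

Lemma tau_tail k a (B : set Omega) : 0 <= a -> <<s cylinders tau xi jumps_only >> B ->
  P (B `&` [set w | a < tau k w]) = (P B * (expR (- a))%:E)%E.
Proof.
move=> a0 cB.
have H : P (tau k @^-1` `]a, +oo[) = (expR (- a))%:E.
  case: wd => /(_ k `]a, +oo[%classic (measurable_itv _)) -> _ _ _.
  exact: exponential_prob_tail.
rewrite setIC (_ : [set w | a < tau k w] = tau k @^-1` `]a, +oo[); last first.
  by apply/seteqP; split => w /=; rewrite in_itv/= andbT.
by rewrite (@sigma_cylinders_indep _ _ _ _ _ _ _ wd jumps_only)// H muleC.
Qed.

(** The first holding time is integrated out. Its density and the exponential in the induction
    hypothesis multiply to the constant [expR (- (a + r))], so only a power of [a + r - s] remains,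
    and its integral raises the Poisson exponent by one. The jump event [B] is carried along to
    obtain independence from the jumps. *)
Lemma renewal_step_law (C : (nat -> R) -> R -> Prop) (c : R) : 0 <= c ->
  (forall k, @measurable_event R _ (measurableTypeR R * futureType tau xi k)%type C) ->
  (forall k a B, 0 <= a -> <<s cylinders tau xi jumps_only >> B ->
     P (B `&` [set w | C (shifted k w) a]) = (P B * (expR (- a) * c)%:E)%E) ->
  forall m k a r B, 0 <= a -> 0 <= r -> <<s cylinders tau xi jumps_only >> B ->
  P (B `&` [set w | renewal_step C m (shifted k w) a r]) =
  (P B * (expR (- a) * (poisson_weight r m * c))%:E)%E.
Proof.
move=> c0 mC hC; elim => [|m IH] k a r B a0 r0 cB /=.
  rewrite hC ?addr_ge0//; congr (_ * _%:E)%E.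
  by rewrite /poisson_weight expr0 fact0 divff// mulr1 opprD expRD mulrA.
have mB : measurable B.
  by apply: (@future_measurable _ _ _ _ _ _ _ wd 0); exact: jumps_only_future.
have fB : P B \is a fin_num by exact: fin_num_measure.
pose E := [set z : measurableTypeR R * futureType tau xi k |
  [/\ a < z.1, z.1 <= a + r, B z.2 &
     renewal_step C m (shifted k.+1 z.2) 0 (a + r - z.1)]].
have shE w : (fun j => shifted k w j.+1) = shifted k.+1 w.
  by apply/funext => j; rewrite /shifted addSnnS.
rewrite (_ : B `&` _ = [set w | E (tau k w, w)]); last first.
  apply/seteqP; split => w /=; rewrite shE.
    by move=> [Bw [h1 h2 h3]]; split.
  by move=> [h1 h2 Bw h3]; split.
rewrite (disintegration wd); last first.
  have m1 : measurable_fun setT (fun z : measurableTypeR R * futureType tau xi k => z.1 : R).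
    exact: measurable_fst.
  rewrite (_ : E = [set z | a < z.1] `&` [set z | z.1 <= a + r] `&` (snd @^-1` B) `&`
     [set z | renewal_step C m (shifted k.+1 z.2) 0 (a + r - z.1)]); last first.
    by apply/seteqP; split => z; [case|move=> [[[]]]; split].
  apply: measurableI; first apply: measurableI; first apply: measurableI.
  - exact: measurable_lt_set.
  - exact: measurable_le_set.
  - rewrite -[X in measurable X]setTI; apply: measurable_snd => //.
    exact: jumps_only_future.
  - apply: (@measurable_renewal_step _ _ _ _ (mC k) m (fun j z => tau (j + k.+1)%N z.2) (fun=> 0) (fun z => a + r - z.1)) => //.
    + move=> j; apply: (@measurableT_comp _ _ _ _ _ _ (fun w : futureType tau xi k => tau (j + k.+1)%N w) setT snd).
        by apply: tau_future; rewrite ltn_addl.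
      exact: measurable_snd.
    + exact: measurable_funB.
transitivity (\int[lebesgue_measure]_(s in `]a, (a + r)%R])
   ((fine (P B) * c * expR (- (a + r)) / m`!%:R) * (a + r - s) ^+ m)%R%:E)%E.
  rewrite [RHS]integral_mkcond; apply: eq_integral => s _.
  rewrite patchE; case: ifPn.
    rewrite inE /= in_itv /= => /andP[s1 s2].
    rewrite exponential_pdfE; last exact: le_trans a0 (ltW s1).
    rewrite (_ : [set w | E (s, w)] = B `&` [set w | renewal_step C m (shifted k.+1 w) 0 (a + r - s)]); last first.
      by apply/seteqP; split => w /=; [case|case; split].
    rewrite IH// ?subr_ge0// -{1}(fineK fB) -!EFinM; congr (_%:E).
    rewrite /poisson_weight oppr0 expR0.
    rewrite mulN1r mul1r [expR (- (a + r))]expRN expRN expRN expRB; field.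
    by rewrite pnatr_eq0 -lt0n fact_gt0 !gt_eqF ?expR_gt0.
  rewrite notin_setE /= in_itv /= => h.
  rewrite (_ : [set w | E (s, w)] = set0) ?measure0 ?mule0//.
  by rewrite -subset0 => w [h1 h2 _ _]; apply: h; rewrite h1.
rewrite integral_expn_sub ?lerDl// -{2}(fineK fB) -EFinM; congr (_%:E).
rewrite (_ : a + r - a = r); last by rewrite addrC addKr.
rewrite /poisson_weight opprD expRD factS natrM.
field.
rewrite !pnatr_eq0 -?lt0n ?fact_gt0 /=.
by [].
Qed.

Lemma renewal_event_law l : (forall x, x \in l -> 0 <= x.1) -> forall k a B, 0 <= a ->
  <<s cylinders tau xi jumps_only >> B ->
  P (B `&` [set w | renewal_event l (shifted k w) a]) =
  (P B * (expR (- a) * \prod_(x <- l) poisson_weight x.1 x.2)%:E)%E.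
Proof.
elim: l => [|[r m] l IH] l0 k a B a0 cB /=.
  by rewrite big_nil mulr1 -(tau_tail k a0 cB).
rewrite big_cons /=.
apply: (@renewal_step_law (renewal_event l) (\prod_(x <- l) poisson_weight x.1 x.2)) => //.
- rewrite big_seq; apply: prodr_ge0 => x xl; rewrite mulr_ge0 ?expR_ge0// divr_ge0// exprn_ge0//.
  by apply: l0; rewrite inE xl orbT.
- by move=> j; exact: measurable_renewal_event.
- by move=> j b A b0 cA; apply: IH => // x xl; apply: l0; rewrite inE xl orbT.
- by apply: (l0 (r, m)); rewrite mem_head.
Qed.

End poisson_law.

(** * The law of the jumps in the cells of a time grid *)

Section paths.
Context (R : realType).
Implicit Types (t : nat -> R) (x : nat -> int).

Definition arrival t c : R := \sum_(i < c) t i.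

Definition count_is t s c : Prop := arrival t c <= s < arrival t c.+1.

Definition good_path t : Prop :=
  (forall i, 0 < t i) /\ (forall n : nat, exists c, n%:R < arrival t c).

Lemma arrivalS t c : arrival t c.+1 = t 0 + arrival (fun j => t j.+1) c.
Proof. by rewrite /arrival big_ord_recl. Qed.

Lemma arrival0 t : arrival t 0 = 0. Proof. by rewrite /arrival big_ord0. Qed.

Lemma arrival_mono t m n : (forall i, 0 < t i) -> (m <= n)%N -> arrival t m <= arrival t n.
Proof.
move=> t0 /subnKC <-; elim: (n - m)%N => [|j IH]; first by rewrite addn0.
by rewrite addnS {2}/arrival big_ord_recr /=; apply: le_trans IH _; rewrite lerDl ltW.
Qed.

Lemma arrival_ge0 t c : (forall i, 0 < t i) -> 0 <= arrival t c.
Proof. by move=> t0; rewrite -(arrival0 t) arrival_mono. Qed.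

Lemma count_is_jump_count t s c : (forall i, 0 < t i) -> count_is t s c ->
  jump_count t s = c.
Proof.
move=> t0 /andP[h1 h2]; rewrite /jump_count; case: pselect => [h|[]]; last by exists c.
case: ex_minnP => m hm mmin; apply/eqP; rewrite eqn_leq mmin ?andbT//=.
rewrite leqNgt; apply/negP => mc; move: hm; rewrite ltNge => /negP; apply.
by apply: le_trans h1; exact: arrival_mono.
Qed.

Lemma jump_count_is t s : good_path t -> 0 <= s -> count_is t s (jump_count t s).
Proof.
move=> [t0 tn] s0; rewrite /count_is /jump_count; case: pselect => [h|[]]; last first.
  have [c hc] := tn (Num.truncn s).+1.
  exists c; apply: (@lt_trans _ _ (Num.truncn s).+1%:R); first exact: truncnS_gt.
  by apply: lt_le_trans hc _; apply: arrival_mono.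
case: ex_minnP => m hm mmin; rewrite hm andbT.
case: m hm mmin => [|m] hm mmin; first by rewrite arrival0.
rewrite leNgt; apply/negP => h'.
by have := mmin m h'; rewrite ltnn.
Qed.

Lemma jump_count_mono t s s' : good_path t -> 0 <= s -> s <= s' ->
  (jump_count t s <= jump_count t s')%N.
Proof.
move=> gt s0 ss'; have /andP[h1 h2] := jump_count_is gt s0.
have /andP[h3 h4] := jump_count_is gt (le_trans s0 ss').
rewrite leqNgt; apply/negP => h.
have : s < s; last by rewrite ltxx.
apply: le_lt_trans ss' _; apply: lt_le_trans h4 _; apply: le_trans h1.
by apply: arrival_mono => //; case: gt.
Qed.

Lemma jump_count0 t : good_path t -> jump_count t 0 = 0%N.
Proof.
move=> gt; apply: count_is_jump_count; first by case: gt.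
by rewrite /count_is arrival0 lexx /= /arrival big_ord_recr /= big_ord0 add0r; case: gt.
Qed.

Definition elapsed (l : seq (R * nat)) k : R := \sum_(p <- take k l) p.1.
Definition renewals (l : seq (R * nat)) k : nat := sumn [seq p.2 | p <- take k l].

Lemma count_isS t s c : count_is t s c.+1 <-> count_is (fun j => t j.+1) (s - t 0) c.
Proof.
by rewrite /count_is !arrivalS lerBrDl ltrBlDl.
Qed.

(** Times are measured from the last renewal. A renewal moves the origin by [t 0] and lowers every
    count by one, as in [count_isS]; [count_is t a 0] amounts to [a < t 0]. *)
Lemma renewal_stepP (l : seq (R * nat)) C :
  (forall t a, (forall i, 0 < t i) -> 0 <= a -> C t a <->
     forall k, (k <= size l)%N -> count_is t (a + elapsed l k) (renewals l k)) ->
  forall m t a r, (forall i, 0 < t i) -> 0 <= a -> 0 <= r ->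
  renewal_step C m t a r <->
  (count_is t a 0 /\ forall k, (k <= size l)%N ->
     count_is t (a + r + elapsed l k) (m + renewals l k)).
Proof.
move=> hC; elim=> [|m IH] t a r t0 a0 r0 /=.
  rewrite hC ?addr_ge0//; split => [h|[_]//]; split => //.
  have := h 0%N isT; rewrite /count_is /elapsed /renewals take0 /= big_nil addr0.
  move=> /andP[h1 h2]; rewrite arrival0 a0 /=.
  by apply: le_lt_trans h2; rewrite lerDl.
have cE k : count_is t (a + r + elapsed l k) (m.+1 + renewals l k) <->
   count_is (fun j => t j.+1) (0 + (a + r - t 0) + elapsed l k) (m + renewals l k).
  by rewrite addSn count_isS add0r addrAC.
split.
- move=> [h1 h2 h3]; split.
    by rewrite /count_is arrival0 a0 /= arrivalS arrival0 addr0.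
  move=> k kl; apply/cE.
  have := (IH _ _ _ (fun i => t0 i.+1) (lexx 0) (_ : 0 <= a + r - t 0)).1 h3.
  by move=> /(_ _)[]; [rewrite subr_ge0|move=> _; exact].
- move=> [h1 h2].
  have ta : t 0 <= a + r.
    have := h2 0%N isT; rewrite /count_is /elapsed take0 big_nil addr0 => /andP[h _].
    by apply: le_trans h; rewrite addSn arrivalS lerDl arrival_ge0.
  split => //; first by move: h1; rewrite /count_is arrivalS !arrival0 addr0 => /andP[].
  apply/IH => //; first by rewrite subr_ge0.
  split; last by move=> k kl; apply/cE; exact: h2.
  by rewrite /count_is arrival0 lexx /= arrivalS arrival0 addr0.
Qed.

Lemma renewal_eventP (l : seq (R * nat)) t a : (forall p, p \in l -> 0 <= p.1) ->
  (forall i, 0 < t i) -> 0 <= a -> renewal_event l t a <->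
  forall k, (k <= size l)%N -> count_is t (a + elapsed l k) (renewals l k).
Proof.
move=> l0; elim: l l0 t a => [|[r m] l IH] l0 t a t0 a0 /=.
  split => [h [|k]// _|/(_ 0%N isT)].
    rewrite /count_is /elapsed /renewals /= big_nil addr0 arrival0 a0 /=.
    by rewrite arrivalS arrival0 addr0.
  rewrite /count_is /elapsed /renewals /= big_nil addr0 => /andP[_].
  by rewrite arrivalS arrival0 addr0.
have r0 : 0 <= r by apply: (l0 (r, m)); rewrite mem_head.
have IH' := IH (fun p pl => l0 p (ltac:(by rewrite inE pl orbT))).
rewrite (@renewal_stepP l)//; split.
- move=> [h1 h2] [_|k kl]; first by rewrite /elapsed /renewals take0 big_nil addr0.
  by rewrite /elapsed /renewals /= big_cons /= addrA; exact: h2.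
- move=> h; split; first by have := h 0%N isT; rewrite /elapsed /renewals take0 big_nil addr0.
  move=> k kl; have := h k.+1 kl.
  by rewrite /elapsed /renewals /= big_cons /= addrA.
Qed.

Definition block t x d k : seq int :=
  let c := jump_count t (k%:R * d) in
  [seq x i | i <- iota c (jump_count t (k.+1%:R * d) - c)].

Lemma flatten_blocks t x d n : good_path t -> 0 <= d ->
  flatten (mkseq (block t x d) n) = [seq x i | i <- iota 0 (jump_count t (n%:R * d))].
Proof.
move=> gt d0; elim: n => [|n IH]; first by rewrite mul0r jump_count0.
rewrite mkseqS flatten_rcons IH /block -map_cat -{2}[jump_count t (n%:R * d)]add0n -iotaD.
by rewrite subnKC// jump_count_mono ?mulr_ge0// ler_wpM2r// ler_nat.
Qed.

Lemma shape_blocks t x d n : shape (mkseq (block t x d) n) =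
  mkseq (fun k => jump_count t (k.+1%:R * d) - jump_count t (k%:R * d))%N n.
Proof.
by rewrite /shape /mkseq -map_comp; apply: eq_map => k; rewrite /= /block size_map size_iota.
Qed.

Lemma sumn_shape_blocks t x d n k : good_path t -> 0 <= d -> (k <= n)%N ->
  sumn (take k (shape (mkseq (block t x d) n))) = jump_count t (k%:R * d).
Proof.
move=> gt d0 kn; rewrite shape_blocks.
elim: k kn => [|k IH] kn; first by rewrite take0 mul0r jump_count0.
rewrite (take_nth 0%N) ?size_mkseq// sumn_rcons IH ?(ltnW kn)// nth_mkseq//.
by rewrite subnKC// jump_count_mono ?mulr_ge0// ler_wpM2r// ler_nat.
Qed.

(** A list of lists is determined by its flattening and its shape. The first constrains only the
    jump values and the second only the counts at grid times, so the event splits into one event for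
    [x] and one for [t]. *)
Lemma blocks_eqP t x d (Ls : seq (seq int)) : good_path t -> 0 <= d ->
  mkseq (block t x d) (size Ls) = Ls <->
  (forall i, (i < size (flatten Ls))%N -> x i = nth 0 (flatten Ls) i) /\
  renewal_event [seq (d, size L) | L <- Ls] t 0.
Proof.
move=> gt d0; set l := [seq _ | L <- Ls].
have lsz : size l = size Ls by rewrite size_map.
have elE k : (k <= size Ls)%N -> 0 + elapsed l k = k%:R * d.
  move=> kl; rewrite add0r /elapsed -map_take big_map big_const_seq count_predT.
  by rewrite iter_addr_0 size_takel// mulr_natl.
have reE k : renewals l k = sumn (take k (shape Ls)).
  by rewrite /renewals /l -map_take -map_comp /shape map_take.
rewrite renewal_eventP//; last 2 first.
- by move=> p /mapP[L _ ->].
- by case: gt.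
rewrite lsz; split.
- move=> E; split.
    move=> i; rewrite -{1 2}E flatten_blocks// size_map size_iota => ic.
    by rewrite (nth_map 0%N) ?size_iota// nth_iota.
  move=> k kl; rewrite elE// reE -E sumn_shape_blocks//.
  by apply: jump_count_is => //; rewrite mulr_ge0.
- move=> [hx hc].
  have cE k : (k <= size Ls)%N -> jump_count t (k%:R * d) = sumn (take k (shape Ls)).
    move=> kl; apply: count_is_jump_count; first by case: gt.
    by have := hc k kl; rewrite elE// reE.
  have sh : shape (mkseq (block t x d) (size Ls)) = shape Ls.
    rewrite shape_blocks; apply: (@eq_from_nth _ 0%N); rewrite size_mkseq ?size_map// => k kl.
    rewrite nth_mkseq// !cE ?(ltnW kl)// (take_nth 0%N) ?size_map// sumn_rcons.
    by rewrite addKn.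
  rewrite -[LHS]flattenK -[RHS]flattenK sh; congr reshape.
  rewrite flatten_blocks// cE// take_oversize ?size_map// -size_flatten.
  apply: (@eq_from_nth _ 0); rewrite size_map size_iota// => i il.
  by rewrite (nth_map 0%N) ?size_iota// nth_iota// add0n hx.
Qed.

End paths.

Section almost_sure.
Context (R : realType) (d : measure_display) (Omega : measurableType d).
Variable P : probability Omega R.
Local Open Scope ereal_scope.

Lemma probability_bigcap1 (A : nat -> set Omega) : (forall n, measurable (A n)) ->
  (forall n, P (A n) = 1) -> P (\bigcap_n A n) = 1.
Proof.
move=> mA A1; have mI : measurable (\bigcap_n A n) by exact: bigcapT_measurable.
suff : P (~` \bigcap_n A n) = 0.
  rewrite probability_setC// => /eqP; rewrite sube_eq ?fin_num_measure//.
  by rewrite add0e => /eqP.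
apply/eqP; rewrite eq_le measure_ge0 andbT setC_bigcap.
apply: (@le_trans _ _ (\sum_(0 <= n <oo) P (~` A n))).
  apply: generalized_Boole_inequality => [n|]; first exact: measurableC.
  by apply: bigcupT_measurable => n; exact: measurableC.
rewrite eseries0// => n _ _; rewrite /= probability_setC// A1.
by rewrite subee.
Qed.

Lemma probability_setI1 (A G : set Omega) : measurable A -> measurable G ->
  P G = 1 -> P (A `&` G) = P A.
Proof.
move=> mA mG G1; apply/eqP; rewrite eq_le; apply/andP; split.
  by apply: le_measure; rewrite ?inE//; exact: measurableI.
apply: (@le_trans _ _ (P ((A `&` G) `|` ~` G))).
  apply: le_measure; rewrite ?inE//.
    by apply: measurableU; [exact: measurableI|exact: measurableC].
  by move=> w Aw; have [Gw|Gw] := pselect (G w); [left|right].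
apply: (@le_trans _ _ (P (A `&` G) + P (~` G))).
  by apply: measureU2; [exact: measurableI|exact: measurableC].
by rewrite probability_setC// G1 subee// adde0.
Qed.

End almost_sure.

(** * The joint law of the jump lists of the cells *)

Section block_law.
Context (R : realType) (d : measure_display) (Omega : measurableType d).
Variables (P : probability Omega R) (J : int -> R).
Variables (tau : nat -> {RV P >-> R}) (xi : nat -> Omega -> int).
Hypothesis wd : walk_data J tau xi.

Let J0 x : 0 <= J x.
Proof. by case: wd => _ _ h _; rewrite -lee_fin -(h 0%N x). Qed.

Lemma esum_expR (x : R) : 0 <= x ->
  (\esum_(m in [set: nat]) (x ^+ m / m`!%:R)%:E = (expR x)%:E)%E.
Proof.
move=> x0; rewrite -nneseries_esumT; last first.
  by move=> m; rewrite lee_fin divr_ge0// exprn_ge0.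
rewrite /expR -EFin_lim; last exact: is_cvg_series_exp_coeff.
apply: congr_lim; apply/funext => n /=.
by rewrite sumEFin /series /=.
Qed.

Lemma esum_poisson_weight (r : R) : 0 <= r ->
  (\esum_(m in [set: nat]) (poisson_weight r m)%:E = 1)%E.
Proof.
move=> r0; rewrite /poisson_weight.
under eq_esum => m _ do rewrite EFinM.
rewrite esumZl ?lee_fin ?expR_ge0//; last first.
  by move=> m; rewrite lee_fin divr_ge0// exprn_ge0.
by rewrite esum_expR// -EFinM -expRD addrC subrr expR0.
Qed.

Definition good : set Omega := [set w | good_path (tau ^~ w)].

Let positive : set Omega := [set w | forall i, 0 < tau i w].

Let sT (A : set (set Omega)) : <<s A >> setT.
Proof.
move=> B [[h0 hC _] _]; rewrite -setC0 -setTD; exact: hC.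
Qed.

Let measurable_positive : measurable positive.
Proof.
rewrite (_ : positive = \bigcap_i [set w | 0 < tau i w]); last first.
  by apply/seteqP; split => w h i; [move=> _|]; apply: h.
by apply: bigcapT_measurable => i; exact: measurable_lt_set.
Qed.

Let P_positive : P positive = 1%E.
Proof.
rewrite (_ : positive = \bigcap_i [set w | 0 < tau i w]); last first.
  by apply/seteqP; split => w h i; [move=> _|]; apply: h.
apply: probability_bigcap1 => i; first exact: measurable_lt_set.
have := tau_tail wd i (lexx 0) (@sT (cylinders tau xi jumps_only)).
by rewrite setTI probability_setT oppr0 expR0 mule1.
Qed.

Let measurable_arrival c : measurable_fun setT (fun w => arrival (tau ^~ w) c).
Proof. by apply: measurable_sum => i. Qed.

Lemma good_bigcap : good = positive `&`
  \bigcap_(n in [set: nat]) \bigcup_c [set w | n%:R < arrival (tau ^~ w) c].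
Proof.
apply/seteqP; split => [w [h1 h2]|w [h1 h2]].
  by split => // n _; have [c hc] := h2 n; exists c.
by split => // n; have [c _ hc] := h2 n I; exists c.
Qed.

Let measurable_unbounded n : measurable (\bigcup_c [set w | n%:R < arrival (tau ^~ w) c]).
Proof. by apply: bigcupT_measurable => c; exact: measurable_lt_set. Qed.

Lemma measurable_good : measurable good.
Proof.
rewrite good_bigcap; apply: measurableI => //.
by apply: bigcap_measurableType => n _.
Qed.
Let measurable_renewal (l : seq (R * nat)) : measurable [set w | renewal_event l (tau ^~ w) 0].
Proof.
exact: (@measurable_renewal_event _ _ _ l (fun j => tau j : Omega -> R) (fun=> 0)).
Qed.

Let shifted0 w : shifted tau 0 w = tau ^~ w.
Proof. by apply/funext => j; rewrite /shifted addn0. Qed.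

(** Non-explosion comes from the Poisson law: for fixed [n] the events of exactly [c] renewals by
    time [n] are disjoint, and their probabilities sum to [1], so almost surely some arrival lies
    beyond [n]. *)
Lemma P_good : P good = 1%E.
Proof.
have mD : measurable (\bigcap_(n in [set: nat]) \bigcup_c [set w | n%:R < arrival (tau ^~ w) c]).
  by apply: bigcap_measurableType => n _.
rewrite good_bigcap setIC probability_setI1//.
apply: probability_bigcap1 => // n.
pose E c := [set w | renewal_event [:: (n%:R : R, c)] (tau ^~ w) 0] `&` positive.
have mE c : measurable (E c) by exact: measurableI.
have EP c w : E c w -> count_is (tau ^~ w) n%:R c.
  move=> [/= h pw]; have := (@renewal_eventP _ [:: (n%:R : R, c)] _ _ _ pw (lexx 0)).1 h.
  rewrite /elapsed /renewals => /(_ _ 1%N isT) /=.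
  by rewrite big_seq1 add0r addn0; apply => p; rewrite inE => /eqP ->.
have PE c : P (E c) = (poisson_weight n%:R c)%:E.
  rewrite probability_setI1//.
  have := @renewal_event_law _ _ _ _ _ _ _ wd [:: (n%:R : R, c)] _ 0%N 0 _ (lexx 0) (@sT (cylinders tau xi jumps_only)).
  rewrite setTI probability_setT mul1e oppr0 expR0 mul1r big_seq1 /= => <-.
    congr (P _); apply/seteqP; split => w /=; rewrite (shifted0 w); exact.
  by move=> p; rewrite inE => /eqP ->.
have tE : trivIset setT E.
  apply/trivIsetP => i j _ _ ij; rewrite -subset0 => w [/[dup] [[_ pw]] /EP hi /EP hj].
  by move/eqP: ij; apply; rewrite -(count_is_jump_count pw hi) -(count_is_jump_count pw hj).
apply/eqP; rewrite eq_le probability_le1//=.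
apply: (@le_trans _ _ (P (\bigcup_c E c))); last first.
  apply: le_measure; rewrite ?inE//; first exact: bigcupT_measurable.
  by move=> w [c _ /EP /andP[_ h]]; exists c.+1.
rewrite measure_semi_bigcup//; last exact: bigcupT_measurable.
rewrite nneseries_esumT//.
rewrite -(@esum_poisson_weight n%:R)//.
by apply: le_esum => c _; have := PE c; rewrite /= => ->.
Qed.

Definition block_weight (r : R) (L : seq int) : R :=
  poisson_weight r (size L) * \prod_(z <- L) J z.

(** Off [good] a fixed list of the right length is used, so the variable takes values in a countable
    type and always has size [n]. *)
Definition blocks (r : R) n w : seq (seq int) :=
  if `[< good w >] then mkseq (block (tau ^~ w) (xi ^~ w) r) n else nseq n [::].

Lemma size_blocks r n w : size (blocks r n w) = n.
Proof. by rewrite /blocks; case: asboolP => _; rewrite ?size_mkseq ?size_nseq. Qed.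

Let jumps_event (s : seq int) : set Omega :=
  [set w | forall i, (i < size s)%N -> xi i w = nth 0 s i].

Let jumps_event_cyl s : cylinders tau xi jumps_only (jumps_event s).
Proof.
pose A (i : nat + nat) : set Omega := match i with
  | inl _ => setT
  | inr n => if (n < size s)%N then xi n @^-1` [set nth 0 s n] else setT end.
exists A, [seq inr n | n <- iota 0 (size s)]; split.
- move=> [n|n]; first exact: index_eventsT.
  by rewrite /A; case: ifP => _ /=; [exists [set nth 0 s n]|exists setT].
- move=> [n|n] //=; rewrite mem_map; last by move=> ? ? [].
  by rewrite mem_iota add0n leq0n /= => /negbTE ->.
- apply/seteqP; split => [w h [n|n] _|w h n nl] //=.
    by case: ifP => // nl; exact: h.
  by have := h (inr n) I; rewrite /A nl.
Qed.

Let P_jumps_event s : P (jumps_event s) = (\prod_(z <- s) J z)%:E.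
Proof.
case: wd => _ _ Pxi ind.
pose A (i : nat + nat) : set Omega := match i with
  | inl _ => setT | inr n => xi n @^-1` [set nth 0 s n] end.
have -> : jumps_event s = \bigcap_(i in [set` [seq inr n | n <- iota 0 (size s)]]) A i.
  apply/seteqP; split => w h.
    move=> i /= /mapP[n]; rewrite mem_iota add0n leq0n /= => ns ->; exact: h.
  move=> n ns; apply: (h (inr n)) => /=; apply/mapP; exists n => //.
  by rewrite mem_iota.
rewrite ind; last 2 first.
- by rewrite map_inj_uniq ?iota_uniq// => ? ? [].
- by move=> i /mapP[n _ ->] /=; exists [set nth 0 s n].
rewrite big_map; under eq_bigr => n _ do rewrite /A Pxi.
by rewrite prodEFin [in RHS](big_nth 0) /index_iota subn0.
Qed.

Lemma blocks_good r Ls : 0 <= r -> [set w | blocks r (size Ls) w = Ls] `&` good =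
  (jumps_event (flatten Ls) `&`
   [set w | renewal_event [seq (r, size L) | L <- Ls] (tau ^~ w) 0]) `&` good.
Proof.
move=> r0; apply/seteqP; split => w [/= h gw]; split => //; move: h.
  by rewrite /blocks; case: asboolP => // _ /(blocks_eqP _ _ gw r0).
by rewrite /blocks; case: asboolP => // _ h; apply/(blocks_eqP _ _ gw r0).
Qed.

Let measurable_jumps_event s : measurable (jumps_event s).
Proof. by apply: (cylinders_measurable wd); exact: jumps_event_cyl. Qed.

Lemma measurable_blocks r n Ls : 0 <= r -> measurable [set w | blocks r n w = Ls].
Proof.
move=> r0; have [<-|sz] := eqVneq (size Ls) n; last first.
  rewrite (_ : [set w | _] = set0)//; rewrite -subset0 => w /= h.
  by move: sz; rewrite -h size_blocks eqxx.
have h2 : [set w | blocks r (size Ls) w = Ls] `&` ~` good =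
   (if nseq (size Ls) [::] == Ls then ~` good else set0).
  apply/seteqP; split => [w [/= h gw]|w].
    by move: h; rewrite /blocks; case: asboolP => // _ ->; rewrite eqxx.
  by case: eqP => // h gw; split => //=; rewrite /blocks; case: asboolP.
rewrite -[X in measurable X]setIT -(setUv good) setIUr blocks_good// h2.
have mg := measurable_good.
apply: measurableU; first by apply: measurableI => //; apply: measurableI.
by case: ifP => _ //; exact: measurableC.
Qed.

(** On [good] the event splits by [blocks_eqP]. The jump part has probability the product of the
    [J z], and [renewal_event_law] multiplies it by the Poisson weights of the cell sizes. *)
Lemma blocks_law r Ls : 0 <= r ->
  P [set w | blocks r (size Ls) w = Ls] = (\prod_(L <- Ls) block_weight r L)%:E.
Proof.
move=> r0.
have cyl : <<s cylinders tau xi jumps_only >> (jumps_event (flatten Ls)).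
  by apply: sub_sigma_algebra; exact: jumps_event_cyl.
rewrite -(probability_setI1 _ measurable_good P_good); last exact: measurable_blocks.
rewrite blocks_good// probability_setI1 ?P_good//; last 2 first.
- exact: measurableI.
- exact: measurable_good.
transitivity (P (jumps_event (flatten Ls) `&`
    [set w | renewal_event [seq (r, size L) | L <- Ls] (shifted tau 0 w) 0])).
  by congr (P (_ `&` _)); apply/funext => w; rewrite /= shifted0.
rewrite (renewal_event_law wd) //; last by move=> p /mapP[L _ ->].
rewrite P_jumps_event oppr0 expR0 mul1r -EFinM; congr (_%:E).
rewrite big_map /block_weight [in RHS]big_split /= [RHS]mulrC; congr (_ * _).
by rewrite big_flatten.
Qed.

End block_law.

(** * Iterated sums over cells *)

Section sequence_sums.
Context (R : realType) (T : choiceType).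
Local Open Scope ereal_scope.

Lemma esum_seq (g : seq T -> \bar R) : (forall s, 0 <= g s) ->
  \esum_(s in [set: seq T]) g s =
  g [::] + \esum_(x in [set: T]) \esum_(s in [set: seq T]) g (x :: s).
Proof.
move=> g0; rewrite (esumID [set [::]])//; congr (_ + _).
  by rewrite setTI esum_set1.
rewrite setTI esum_esum//.
rewrite (@reindex_esum _ _ _ ([set: T] `*`` (fun=> [set: seq T])) _ (fun p => p.1 :: p.2))//.
split => //.
- by move=> [x s] [y t] _ _ /= [-> ->].
- by case=> [h|x s _]; [case: h|exists (x, s)].
Qed.

Lemma esum_seq_size (g : seq T -> \bar R) : (forall s, 0 <= g s) ->
  \esum_(s in [set: seq T]) g s =
  \esum_(n in [set: nat]) \esum_(s in [set: seq T]) (if size s == n then g s else 0).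
Proof.
move=> g0; rewrite esumC; last by move=> n s; case: ifP.
apply: eq_esum => s _.
rewrite -[LHS](@esum_delta _ _ (size s) (fun=> g s))//.
by apply: eq_esum => n _; rewrite eq_sym.
Qed.

(** The expectation of [f] over [n] independent entries with weights [q]; the recursive form is
    suited to one-cell-at-a-time arguments. *)
Fixpoint isum (q : T -> R) n (f : seq T -> \bar R) : \bar R :=
  if n is n'.+1 then
    \esum_(x in [set: T]) ((q x)%:E * isum q n' (fun s => f (x :: s)))
  else f [::].

Section isum_theory.
Variable q : T -> R.
Hypothesis q0 : forall x, (0 <= q x)%R.

Lemma isum_ge0 n f : (forall s, 0 <= f s) -> 0 <= isum q n f.
Proof.
elim: n f => [|n IH] f f0 //=; apply: esum_ge0 => x _.
by rewrite mule_ge0 ?lee_fin// IH.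
Qed.

Lemma isum_le n f g : (forall s, 0 <= f s) -> (forall s, size s = n -> f s <= g s) ->
  isum q n f <= isum q n g.
Proof.
elim: n f g => [|n IH] f g f0 fg /=; first exact: fg.
apply: le_esum => x _; rewrite lee_wpmul2l ?lee_fin//; apply: IH => // s sn.
by apply: fg => /=; rewrite sn.
Qed.

Lemma eq_isum n f g : (forall s, size s = n -> f s = g s) -> isum q n f = isum q n g.
Proof.
elim: n f g => [|n IH] f g fg /=; first exact: fg.
apply: eq_esum => x _; congr (_ * _); apply: IH => // s sn.
by apply: fg => /=; rewrite sn.
Qed.

Lemma isumZ n c f : 0 <= c -> (forall s, 0 <= f s) ->
  isum q n (fun s => c * f s) = c * isum q n f.
Proof.
move=> c0; elim: n f => [|n IH] f f0 //=.
rewrite -esumZl//; last by move=> x; rewrite mule_ge0 ?lee_fin ?isum_ge0.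
by apply: eq_esum => x _; rewrite IH// muleCA.
Qed.

Lemma isumD n f g : (forall s, 0 <= f s) -> (forall s, 0 <= g s) ->
  isum q n (fun s => f s + g s) = isum q n f + isum q n g.
Proof.
elim: n f g => [|n IH] f g f0 g0 //=.
rewrite -esumD; last 2 first.
- by move=> x _; rewrite mule_ge0 ?lee_fin ?isum_ge0.
- by move=> x _; rewrite mule_ge0 ?lee_fin ?isum_ge0.
by apply: eq_esum => x _; rewrite IH// ge0_muleDr ?isum_ge0.
Qed.

Lemma isum_esum (U : choiceType) n (f : U -> seq T -> \bar R) :
  (forall u s, 0 <= f u s) ->
  isum q n (fun s => \esum_(u in [set: U]) f u s) =
  \esum_(u in [set: U]) isum q n (f u).
Proof.
elim: n f => [|n IH] f f0 //=.
rewrite esumC; last by move=> *; rewrite mule_ge0 ?lee_fin ?isum_ge0.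
by apply: eq_esum => x _; rewrite IH// esumZl ?lee_fin// => u; rewrite isum_ge0.
Qed.

Lemma isum_cst n (c : \bar R) : 0 <= c -> \esum_(x in [set: T]) (q x)%:E = 1 ->
  isum q n (fun=> c) = c.
Proof.
move=> c0 q1; elim: n => //= n ->; rewrite -[RHS]mule1 -q1 -esumZl//.
by apply: eq_esum => x _; rewrite muleC.
Qed.

Lemma isumE n f : (forall s, 0 <= f s) -> isum q n f =
  \esum_(s in [set: seq T]) (if size s == n then f s * (\prod_(x <- s) q x)%:E else 0).
Proof.
have p0 s : (0 <= \prod_(x <- s) q x)%R by apply: prodr_ge0.
elim: n f => [|n IH] f f0 /=.
  rewrite -[LHS](@esum_delta _ _ [::] f)//; apply: eq_esum => s _.
  by rewrite size_eq0; case: eqP => // ->; rewrite big_nil mule1.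
rewrite [RHS]esum_seq; last by move=> s; case: ifP => // _; rewrite mule_ge0 ?lee_fin.
rewrite /= add0e; apply: eq_esum => x _; rewrite IH// -esumZl ?lee_fin//; last first.
  by move=> s; case: ifP => // _; rewrite mule_ge0 ?lee_fin.
apply: eq_esum => s _; rewrite eqSS; case: ifP => _; last by rewrite mule0.
by rewrite big_cons EFinM muleCA.
Qed.

Lemma isum_sum n (h : T -> \bar R) : (forall x, 0 <= h x) ->
  \esum_(x in [set: T]) (q x)%:E = 1 ->
  isum q n (fun s => \sum_(x <- s) h x) =
  n%:R%:E * \esum_(x in [set: T]) ((q x)%:E * h x).
Proof.
move=> h0 q1; have e0 : 0 <= \esum_(x in [set: T]) ((q x)%:E * h x).
  by apply: esum_ge0 => x _; rewrite mule_ge0 ?lee_fin.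
elim: n => [|n IH] /=; first by rewrite big_nil mul0e.
transitivity (\esum_(x in [set: T]) ((q x)%:E * h x +
   (q x)%:E * (n%:R%:E * \esum_(x in [set: T]) ((q x)%:E * h x)))).
  apply: eq_esum => x _; rewrite -IH -ge0_muleDr//; last first.
    by apply: isum_ge0 => s; rewrite sume_ge0.
  congr (_ * _); rewrite -{1}(@isum_cst n (h x))// -isumD//; last first.
    by move=> s; rewrite sume_ge0.
  by apply: eq_isum => s _; rewrite big_cons.
rewrite esumD; last 2 first.
- by move=> x _; rewrite mule_ge0 ?lee_fin.
- by move=> x _; rewrite !mule_ge0 ?lee_fin.
rewrite -natr1 EFinD ge0_muleDl ?lee_fin// mul1e addeC; congr (_ + _).
under eq_esum do rewrite muleC.
by rewrite esumZl ?q1 ?mule1// mule_ge0 ?lee_fin.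
Qed.

End isum_theory.

End sequence_sums.

(** * Integrals of functions of a discrete variable *)

Section discrete_integral.
Context (R : realType) (d : measure_display) (Omega : measurableType d).
Variable P : probability Omega R.
Local Open Scope ereal_scope.

(* No measurability: the integral is a supremum over simple functions.  It is
   needed because the paths are controlled only on an almost sure event. *)
Lemma ge0_le_integral_any (d' : measure_display) (T : measurableType d')
    (mu : {measure set T -> \bar R}) (D : set T) (f g : T -> \bar R) :
  (forall x, D x -> 0 <= f x) -> (forall x, D x -> f x <= g x) ->
  \int[mu]_(x in D) f x <= \int[mu]_(x in D) g x.
Proof.
move=> f0 fg; have g0 x : D x -> 0 <= g x by move=> Dx; exact: le_trans (f0 x Dx) (fg x Dx).
rewrite !ge0_integralE//; apply: le_ereal_sup => _ [h hf <-]; exists h => // x.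
apply: le_trans (hf x) _; rewrite !patchE; case: ifPn => // xD.
by apply: fg; rewrite inE in xD.
Qed.

Variables (C : countType) (D : Omega -> C).
Hypothesis mD : forall c, measurable [set w | D w = c].

Lemma measurable_discrete (f : C -> \bar R) : measurable_fun setT (fun w => f (D w)).
Proof.
move=> _ A mA; rewrite setTI.
rewrite (_ : _ @^-1` A = \bigcup_c (if f c \in A then [set w | D w = c] else set0)); last first.
  apply/seteqP; split => [w Aw|w [c _]].
    by exists (D w) => //; rewrite mem_set.
  by case: ifPn => // /set_mem Ac /= Dw; rewrite /preimage /= Dw.
by apply: countable_bigcupT_measurable => // c; case: ifP.
Qed.

Lemma integral_discrete (f : C -> \bar R) : (forall c, 0 <= f c) ->
  \int[P]_w f (D w) = \esum_(c in [set: C]) (f c * P [set w | D w = c]).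
Proof.
move=> f0; pose F n := [set w | pickle (D w) = n].
have mF n : measurable (F n).
  rewrite (_ : F n = \bigcup_c (if pickle c == n then [set w | D w = c] else set0)); last first.
    apply/seteqP; split => [w <-|w [c _]]; first by exists (D w) => //; rewrite eqxx.
    by case: eqP => // <- /= Dw; rewrite /F /= Dw.
  by apply: countable_bigcupT_measurable => // c; case: ifP.
have UF : \bigcup_n F n = setT by rewrite -subTset => w _; exists (pickle (D w)).
rewrite -UF ge0_integral_bigcup//; last 2 first.
- by apply: measurable_funTS; exact: measurable_discrete.
- by apply/trivIsetP => i j _ _ ij; rewrite -subset0 => w [/= h1 h2]; rewrite -h1 h2 eqxx in ij.
rewrite nneseries_esumT; last by move=> n; apply: integral_ge0.
have Fc c : F (pickle c) = [set w | D w = c].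
  by apply/seteqP; split => w /=; [move/(pcan_inj pickleK)|rewrite /F /= => <-].
transitivity (\esum_(n in range (@pickle C)) \int[P]_(x in F n) f (D x)).
  rewrite [RHS]esum_mkcond; apply: eq_esum => n _; case: ifPn => //.
  rewrite notin_setE => hn; rewrite (_ : F n = set0) ?integral_set0//.
  by rewrite -subset0 => w /= Dw; apply: hn; exists (D w).
rewrite esum_image; last by move=> a b _ _; exact: (pcan_inj pickleK).
apply: eq_esum => c _; rewrite Fc -integral_cst//.
by apply: eq_integral => w; rewrite inE /= => ->.
Qed.

End discrete_integral.

Section block_integral.
Context (R : realType) (d : measure_display) (Omega : measurableType d).
Variables (P : probability Omega R) (J : int -> R).
Variables (tau : nat -> {RV P >-> R}) (xi : nat -> Omega -> int).
Hypothesis wd : walk_data J tau xi.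
Variable r : R.
Hypothesis r0 : 0 <= r.

Lemma jump_law_ge0 x : 0 <= J x.
Proof. by case: wd => _ _ h _; rewrite -lee_fin -(h 0%N x). Qed.

Lemma block_weight_ge0 L : 0 <= block_weight J r L.
Proof.
rewrite mulr_ge0//; last by apply: prodr_ge0 => z _; exact: jump_law_ge0.
by rewrite mulr_ge0 ?expR_ge0// divr_ge0// exprn_ge0.
Qed.

Lemma integral_blocks n (f : seq (seq int) -> \bar R) : (forall s, (0 <= f s)%E) ->
  (\int[P]_w f (blocks tau xi r n w) = isum (block_weight J r) n f)%E.
Proof.
move=> f0; rewrite integral_discrete//; last by move=> s; exact: (measurable_blocks wd).
rewrite isumE//; last exact: block_weight_ge0.
apply: eq_esum => s _; case: eqP => [<-|sn]; first by rewrite (blocks_law wd).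
rewrite (_ : [set w | _] = set0) ?measure0 ?mule0//.
by rewrite -subset0 => w /= h; apply: sn; rewrite -h size_blocks.
Qed.

Lemma measurable_blocks_fun n (f : seq (seq int) -> \bar R) :
  measurable_fun setT (fun w => f (blocks tau xi r n w)).
Proof. by apply: measurable_discrete => s; exact: (measurable_blocks wd). Qed.

(** Read off from the law: the constant [1] is integrated as a function of a single cell. *)
Lemma block_weight_mass : (\esum_(L in [set: seq int]) (block_weight J r L)%:E = 1)%E.
Proof.
have := @integral_blocks 1 (fun=> 1%E) (fun=> lee01).
rewrite (_ : (\int[P]__ 1)%E = 1%E); last first.
  by rewrite integral_cst// mul1e; exact: probability_setT.
move=> /= ->; by apply: eq_esum => L _; rewrite mule1.
Qed.

End block_integral.

(** * The exponential growth of the tilted weights *)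

Section block_sums.
Context (R : realType) (J : int -> R).
Hypothesis J0 : forall x, 0 <= J x.
Local Open Scope ereal_scope.

Definition displacement (L : seq int) : int := (\sum_(z <- L) z)%R.

Lemma displacement_cons z L : displacement (z :: L) = (z + displacement L)%R.
Proof. by rewrite /displacement big_cons. Qed.

Lemma displacement_nil : displacement [::] = 0%R.
Proof. by rewrite /displacement big_nil. Qed.

Lemma poisson_weight_ge0 (r : R) m : (0 <= r)%R -> (0 <= poisson_weight r m)%R.
Proof. by move=> r0; rewrite mulr_ge0 ?expR_ge0// divr_ge0// exprn_ge0. Qed.

Lemma esum_block (r : R) (g : seq int -> \bar R) : (0 <= r)%R -> (forall L, 0 <= g L) ->
  \esum_(L in [set: seq int]) ((block_weight J r L)%:E * g L) =
  \esum_(m in [set: nat]) ((poisson_weight r m)%:E * isum J m g).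
Proof.
move=> r0 g0.
have b0 L : (0 <= block_weight J r L)%R.
  by rewrite mulr_ge0 ?poisson_weight_ge0// prodr_ge0.
rewrite esum_seq_size; last by move=> L; rewrite mule_ge0 ?lee_fin.
apply: eq_esum => m _; rewrite isumE// -esumZl ?lee_fin ?poisson_weight_ge0//; last first.
  by move=> L; case: ifP => // _; rewrite mule_ge0 ?lee_fin ?prodr_ge0.
apply: eq_esum => L _; case: eqP => [<-|_]; last by rewrite mule0.
by rewrite /block_weight EFinM -muleA (muleC (g L)).
Qed.

(** A function that [J] multiplies by at most [Lam] grows by at most [Lam] per jump, so a cell with
    [m] jumps costs at most [Lam ^+ m]. *)
Lemma isum_kop_le (f : int -> \bar R) (Lam : R) : (0 <= Lam)%R -> (forall x, 0 <= f x) ->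
  (forall x, kop J f x <= Lam%:E * f x) ->
  forall m s, isum J m (fun L => f (s + displacement L)%R) <= (Lam ^+ m)%:E * f s.
Proof.
move=> L0 f0 hf; elim => [|m IH] s /=; first by rewrite displacement_nil addr0 mul1e.
apply: (@le_trans _ _ (\esum_(z in [set: int]) ((J z)%:E * ((Lam ^+ m)%:E * f (s + z)%R)))).
  apply: le_esum => z _; rewrite lee_wpmul2l ?lee_fin//.
  apply: le_trans (IH (s + z)%R); rewrite le_eqVlt; apply/orP; left; apply/eqP.
  by apply: eq_isum => L _; rewrite displacement_cons addrA.
rewrite -/(kop J (fun y => (Lam ^+ m)%:E * f y) s) kopZ ?exprn_ge0//.
by rewrite exprSr EFinM -muleA lee_wpmul2l ?lee_fin ?exprn_ge0.
Qed.

Lemma kop_opp k (f : int -> \bar R) x : (forall z, k (- z)%R = k z :> R) ->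
  kop k (fun y => f (- y)%R) x = kop k f (- x)%R.
Proof.
move=> ke; rewrite /kop -[RHS]esum_int_opp; apply: eq_esum => z _.
by rewrite ke opprD.
Qed.

Definition exp_tail2 (x : R) : R := expR x - 1 - x.

Section poisson_tails.
Variables (r Lam : R).
Hypotheses (r0 : (0 <= r)%R) (L0 : (0 <= Lam)%R).

Let t m : \bar R := (poisson_weight r m * Lam ^+ m)%:E.
Let t0 m : 0 <= t m.
Proof. by rewrite lee_fin mulr_ge0 ?poisson_weight_ge0 ?exprn_ge0. Qed.

Lemma poisson_moment :
  \esum_(m in [set: nat]) (poisson_weight r m * Lam ^+ m)%:E = (expR (- r) * expR (r * Lam))%:E.
Proof.
rewrite [RHS]EFinM -(@esum_expR R (r * Lam)) ?mulr_ge0// -esumZl ?lee_fin ?expR_ge0//; last first.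
  by move=> m; rewrite lee_fin divr_ge0// exprn_ge0// mulr_ge0.
apply: eq_esum => m _; rewrite -EFinM /poisson_weight exprMn; congr (_%:E); ring.
Qed.

Let adde_eq_fin (a b : R) (X : \bar R) : a%:E + X = b%:E -> X = (b - a)%:E.
Proof. by case: X => [x| |] //= [<-]; congr (_%:E); ring. Qed.

Lemma poisson_moment1 :
  \esum_(m in [set: nat]) (poisson_weight r m.+1 * Lam ^+ m.+1)%:E =
  (expR (- r) * (expR (r * Lam) - 1))%:E.
Proof.
have := poisson_moment; rewrite esum_nat_recl// => /adde_eq_fin ->.
by rewrite /poisson_weight !expr0 fact0 divr1 !mulr1 mulrBr mulr1.
Qed.

Lemma poisson_moment2 :
  \esum_(m in [set: nat]) (poisson_weight r m.+2 * Lam ^+ m.+2)%:E =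
  (expR (- r) * exp_tail2 (r * Lam))%:E.
Proof.
have := poisson_moment1; rewrite esum_nat_recl//; last by move=> m; exact: t0.
move=> /adde_eq_fin ->; rewrite /exp_tail2 /poisson_weight !expr1 divr1.
by congr (_%:E); ring.
Qed.

End poisson_tails.

End block_sums.

(** * Supersolution estimates for one cell and for the whole grid *)

Section step_inequality.
Context (R : realType) (J : int -> R) (K : nat) (rho beta delta Lam : R).
Variable (vr : int -> R).
Hypothesis J0 : forall x, 0 <= J x.
Hypothesis Jev : forall x, J (- x) = J x.
Hypothesis rho01 : 0 < rho < 1.
Hypothesis beta0 : 0 < beta.
Hypothesis delta0 : 0 < delta.
Hypothesis Lam0 : 0 <= Lam.
Hypothesis vr0 : forall x, 0 <= vr x.

Let far := far_kernel J K.
Let E1 : R := expR 1.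
Let v x : \bar R := (vr x)%:E.
Let r := (1 - rho) * delta.
Let r' := rho * delta.

(** A jump of the difference walk belongs to [Y] with probability [rho], and only those of [Y] are
    reweighted: this is [(1 - rho) * J + rho * (J + (E1 - 1) * far)]. *)
Definition tilted_kernel (z : int) : R := J z + rho * (E1 - 1) * far z.

Hypothesis hv : forall s,
  (kop tilted_kernel v s + beta%:E * (edelta s * v s) <= Lam%:E * v s)%E.

(** Only cells with exactly one jump are tilted. This keeps [tilt] between [1] and [E1] in every
    cell and changes the count of long jumps only through cells of probability of order
    [delta ^ 2]. *)
Definition far_block (L : seq int) : bool := if L is [:: z] then (K <= `|z|)%N else false.

Definition tilt (L : seq int) : R := if far_block L then E1 else 1.

Definition step_weight (s : int) (L L' : seq int) : R :=
  (if [|| s == 0, L != [::] | L' != [::]] then expR (beta * delta) else 1).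

(* Blocks with at most one jump are computed exactly; the other ones contribute
   terms of order [delta ^ 2], collected in [exp_tail2]. *)
Lemma step_upper (lam : R) :
  1 + expR (beta * delta) * (delta * Lam + E1 * exp_tail2 (delta * Lam)) <= expR ((1 + lam) * delta) ->
  forall s,
  (\esum_(L' in [set: seq int]) ((block_weight J r' L')%:E *
   \esum_(L in [set: seq int]) ((block_weight J r L)%:E *
     ((step_weight s L L' * tilt L')%:E * v (s + displacement L - displacement L')%R)))
   <= (expR (lam * delta))%:E * v s)%E.
Proof.
move=> hd s; have [rho0 rho1] := andP rho01.
have r0 : 0 <= r by rewrite mulr_ge0 ?(ltW delta0)// subr_ge0 ltW.
have r0' : 0 <= r' by rewrite mulr_ge0 ?(ltW delta0)// ltW.
have E11 : 1 <= E1 by apply: ltW; rewrite expR_gt1.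
have W1 : 1 <= expR (beta * delta) by rewrite -expR0 ler_expR mulr_ge0// ltW.
have W0 : 0 <= expR (beta * delta) by exact: expR_ge0.
have E10' : 0 <= E1 by exact: expR_ge0.
have far0 z : 0 <= far z by exact: far_kernel_ge0.
have v0 x : (0 <= v x)%E by rewrite lee_fin.
set W := expR (beta * delta) in hd W1 W0 *.
pose f (L' L : seq int) : \bar R := ((step_weight s L L' * tilt L')%:E *
  v (s + displacement L - displacement L')%R)%E.
have tl1 L : 1 <= tilt L <= E1 by rewrite /tilt; case: ifP => _; rewrite ?lexx ?E11.
have sw1 L L' : 1 <= step_weight s L L' <= W.
  by rewrite /step_weight -/W; case: ifP => _; rewrite ?lexx ?W1.
have cw L L' : 0 <= step_weight s L L' * tilt L' <= W * E1.
  have /andP[h1 h2] := tl1 L'; have /andP[h3 h4] := sw1 L L'.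
  rewrite mulr_ge0 ?(le_trans ler01)//= ler_pM// (le_trans ler01)//.
have f0 L' L : (0 <= f L' L)%E.
  by rewrite mule_ge0// lee_fin; case/andP: (cw L L').
pose Bs m' m := isum J m' (fun L' => isum J m (f L')).
have B0 m' m : (0 <= Bs m' m)%E by apply: isum_ge0 => // L'; exact: isum_ge0.
have p0 := @poisson_weight_ge0 R r; have p0' := @poisson_weight_ge0 R r'.
rewrite (_ : (\esum_(L' in _) _ = \esum_(m' in [set: nat]) ((poisson_weight r' m')%:E *
   \esum_(m in [set: nat]) ((poisson_weight r m)%:E * Bs m' m)))%E); last first.
  transitivity (\esum_(L' in [set: seq int]) ((block_weight J r' L')%:E *
     \esum_(m in [set: nat]) ((poisson_weight r m)%:E * isum J m (f L'))))%E.
    by apply: eq_esum => L' _; rewrite (esum_block J0 r0 (f0 L')).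
  rewrite esum_block//; last first.
    by move=> L'; apply: esum_ge0 => m _; rewrite mule_ge0 ?lee_fin ?p0// isum_ge0.
  apply: eq_esum => m' _; congr (_ * _)%E; rewrite isum_esum//; last first.
    by move=> m L'; rewrite mule_ge0 ?lee_fin ?p0// isum_ge0.
  apply: eq_esum => m _; rewrite isumZ ?lee_fin ?p0//.
  by move=> L'; exact: isum_ge0.
have E10 : 0 <= rho * (E1 - 1) by rewrite mulr_ge0 ?subr_ge0// ltW.
have tkE x : kop tilted_kernel v x = (kop J v x + (rho * (E1 - 1))%:E * kop far v x)%E.
  rewrite /tilted_kernel kopDl//; last by move=> z; rewrite mulr_ge0.
  by rewrite kopZl.
have jle x : (kop J v x <= Lam%:E * v x)%E.
  apply: le_trans (hv x); rewrite tkE -addeA leeDl// adde_ge0// mule_ge0 ?lee_fin//.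
  - exact: kop_ge0.
  - exact: ltW.
  - by rewrite mulr_ge0.
have fle : (kop far v s <= kop J v s)%E.
  by apply: kop_le => // z; rewrite /far /far_kernel; case: ifP.
have jfin : kop J v s \is a fin_num.
  by rewrite ge0_fin_numE ?kop_ge0// (le_lt_trans (jle s))// -EFinM ltry.
have ffin : kop far v s \is a fin_num.
  by rewrite ge0_fin_numE ?kop_ge0// (le_lt_trans fle)// -ge0_fin_numE ?kop_ge0.
pose jv := fine (kop J v s); pose fv := fine (kop far v s); pose V := vr s.
have jvE : kop J v s = jv%:E by rewrite fineK.
have fvE : kop far v s = fv%:E by rewrite fineK.
pose ind : R := (s == 0)%:R.
have key : jv + rho * (E1 - 1) * fv + beta * (ind * V) <= Lam * V.
  by have := hv s; rewrite tkE jvE fvE /edelta -!EFinM -!EFinD lee_fin.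
have B00 : Bs 0%N 0%N = ((1 + ind * (W - 1)) * V)%:E.
  rewrite /Bs /= /f displacement_nil addr0 subr0 -EFinM /step_weight /tilt /= mulr1 orbF.
  by rewrite /ind; congr (_ * _)%:E; case: eqP => _; rewrite ?mul1r ?mul0r ?addr0 // addrC subrK.
have B01 : Bs 0%N 1%N = (W * jv)%:E.
  rewrite /Bs /= EFinM -jvE -kopZ//.
  apply: eq_esum => z _; rewrite /f /step_weight /tilt /= orbT mulr1.
  by rewrite displacement_cons displacement_nil addr0 subr0.
have B10 : Bs 1%N 0%N = (W * (jv + (E1 - 1) * fv))%:E.
  rewrite /Bs /= EFinM EFinD EFinM -jvE -fvE -kopZl ?subr_ge0// -kopDl//; last first.
    by move=> z; rewrite mulr_ge0 ?subr_ge0.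
  rewrite -kopZ//; last by move=> z; rewrite addr_ge0// mulr_ge0 ?subr_ge0.
  rewrite /kop -[RHS]esum_int_opp; apply: eq_esum => z _.
  rewrite /f /step_weight /tilt /= !orbT displacement_cons displacement_nil !addr0.
  rewrite muleA -EFinM Jev [far (- z)](_ : _ = far z); last first.
    by rewrite /far /far_kernel abszN Jev.
  rewrite /v -!EFinM; congr (_%:E); rewrite -/W /far /far_kernel.
  by case: ifP => _; ring.
pose M := W * E1.
have M0 : 0 <= M by rewrite mulr_ge0.
(* A crude bound for arbitrary numbers of jumps: the weights are at most [W * E1], and [v] is a
   supersolution for [J] alone. It is applied only to terms with at least two jumps in total. *)
have Bgen m' m : (Bs m' m <= (M * V * (Lam ^+ m' * Lam ^+ m))%:E)%E.
  apply: (@le_trans _ _ (isum J m' (fun L' => (M * Lam ^+ m)%:E * v (- (- s + displacement L'))%R)%E)).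
    apply: isum_le => // [L'|L' _]; first exact: isum_ge0.
    rewrite opprD opprK.
    apply: (@le_trans _ _ (M%:E * isum J m (fun L => v (s - displacement L' + displacement L)%R))%E).
      rewrite -isumZ ?lee_fin//; apply: isum_le => // L _.
      rewrite /f addrAC lee_wpmul2r// lee_fin; by case/andP: (cw L L').
    by rewrite [(M * Lam ^+ m)%:E]EFinM -[leRHS]muleA lee_wpmul2l ?lee_fin// isum_kop_le.
  rewrite isumZ ?lee_fin ?mulr_ge0 ?exprn_ge0//.
  have := @isum_kop_le _ _ J0 (fun y => v (- y)%R) Lam Lam0 (fun x => v0 (- x)) _ m' (- s).
  rewrite opprK => h.
  apply: le_trans (lee_wpmul2l _ (h _)) _; first by rewrite lee_fin mulr_ge0 ?exprn_ge0.
    by move=> x; rewrite kop_opp.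
  by rewrite -!EFinM lee_fin /V le_eqVlt; apply/orP; left; apply/eqP; ring.
have MV0 : 0 <= M * V by apply: mulr_ge0; [|exact: vr0].
have A0 : (\esum_(m in [set: nat]) ((poisson_weight r m)%:E * Bs 0%N m) <=
  (expR (- r) * ((1 + ind * (W - 1)) * V) + expR (- r) * r * (W * jv) +
   M * V * (expR (- r) * exp_tail2 (r * Lam)))%:E)%E.
  rewrite esum_nat_recl; last by move=> m; rewrite mule_ge0 ?lee_fin ?p0.
  rewrite esum_nat_recl; last by move=> m; rewrite mule_ge0 ?lee_fin ?p0.
  rewrite B00 B01 -!EFinM addeA -EFinD [leRHS]EFinD; apply: leeD.
    by rewrite lee_fin /poisson_weight expr0 expr1 fact0 !divr1 mulr1.
  rewrite EFinM -poisson_moment2// -esumZl; last 2 first.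
  - by rewrite lee_fin.
  - by move=> m; rewrite lee_fin mulr_ge0 ?p0 ?exprn_ge0.
  apply: le_esum => m _; apply: le_trans (lee_wpmul2l _ (Bgen _ _)) _; first by rewrite lee_fin p0.
  by rewrite -!EFinM lee_fin le_eqVlt; apply/orP; left; apply/eqP; rewrite expr0; ring.
have A1 : (\esum_(m in [set: nat]) ((poisson_weight r m)%:E * Bs 1%N m) <=
  (expR (- r) * (W * (jv + (E1 - 1) * fv)) +
   M * V * Lam * (expR (- r) * (expR (r * Lam) - 1)))%:E)%E.
  rewrite esum_nat_recl; last by move=> m; rewrite mule_ge0 ?lee_fin ?p0.
  rewrite B10 -!EFinM [leRHS]EFinD; apply: leeD.
    by rewrite lee_fin /poisson_weight expr0 fact0 !divr1 mulr1.
  rewrite EFinM -poisson_moment1// -esumZl; last 2 first.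
  - by rewrite lee_fin mulr_ge0.
  - by move=> m; rewrite lee_fin mulr_ge0 ?p0 ?exprn_ge0.
  apply: le_esum => m _; apply: le_trans (lee_wpmul2l _ (Bgen _ _)) _; first by rewrite lee_fin p0.
  by rewrite -!EFinM lee_fin le_eqVlt; apply/orP; left; apply/eqP; rewrite expr1; ring.
have A2 m' : (\esum_(m in [set: nat]) ((poisson_weight r m)%:E * Bs m' m) <=
  (M * V * (expR (- r) * expR (r * Lam)) * Lam ^+ m')%:E)%E.
  rewrite mulrAC EFinM -poisson_moment// -esumZl; last 2 first.
  - by rewrite lee_fin mulr_ge0 ?exprn_ge0.
  - by move=> m; rewrite lee_fin mulr_ge0 ?p0 ?exprn_ge0.
  apply: le_esum => m _; apply: le_trans (lee_wpmul2l _ (Bgen _ _)) _; first by rewrite lee_fin p0.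
  by rewrite -!EFinM lee_fin le_eqVlt; apply/orP; left; apply/eqP; ring.
have S0 m' : (0 <= \esum_(m in [set: nat]) ((poisson_weight r m)%:E * Bs m' m))%E.
  by apply: esum_ge0 => m _; rewrite mule_ge0 ?lee_fin ?p0.
pose G m' := (\esum_(m in [set: nat]) ((poisson_weight r m)%:E * Bs m' m))%E.
rewrite -[leLHS]/(\esum_(m' in [set: nat]) ((poisson_weight r' m')%:E * G m'))%E.
rewrite esum_nat_recl; last by move=> m; apply: mule_ge0; [rewrite lee_fin p0'|exact: S0].
rewrite esum_nat_recl; last by move=> m; apply: mule_ge0; [rewrite lee_fin p0'|exact: S0].
have T0 := lee_wpmul2l (ltac:(by rewrite lee_fin p0') : (0 <= (poisson_weight r' 0)%:E)%E) A0.
have T1 := lee_wpmul2l (ltac:(by rewrite lee_fin p0') : (0 <= (poisson_weight r' 1)%:E)%E) A1.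
have T2 : (\esum_(m' in [set: nat]) ((poisson_weight r' m'.+2)%:E *
    \esum_(m in [set: nat]) ((poisson_weight r m)%:E * Bs m'.+2 m)) <=
  (M * V * (expR (- r) * expR (r * Lam)) * (expR (- r') * exp_tail2 (r' * Lam)))%:E)%E.
  rewrite EFinM -poisson_moment2// -esumZl; last 2 first.
  - by rewrite lee_fin mulr_ge0// mulr_ge0 ?expR_ge0.
  - by move=> m; rewrite lee_fin mulr_ge0 ?p0' ?exprn_ge0.
  apply: le_esum => m _; apply: le_trans (lee_wpmul2l _ (A2 _)) _; first by rewrite lee_fin p0'.
  by rewrite -!EFinM lee_fin le_eqVlt; apply/orP; left; apply/eqP; ring.
apply: le_trans (leeD T0 (leeD T1 T2)) _.
rewrite -!EFinM -!EFinD lee_fin.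
rewrite [poisson_weight r' 0](_ : _ = expR (- r')); last by rewrite /poisson_weight expr0 fact0 divr1 mulr1.
rewrite [poisson_weight r' 1](_ : _ = expR (- r') * r'); last by rewrite /poisson_weight expr1 divr1.
have dE : delta = r + r' by rewrite /r /r'; ring.
have eE : expR (delta * Lam) = expR (r * Lam) * expR (r' * Lam) by rewrite dE mulrDl expRD.
have eD : expR (- r) * expR (- r') = expR (- delta) by rewrite -expRD dE opprD.
(* The three remainders add up exactly: with [x = r * Lam] and [y = r' * Lam], [exp_tail2 x + y *
   (expR x - 1) + expR x * exp_tail2 y = exp_tail2 (x + y)]. *)
have -> : expR (- r') * (expR (- r) * ((1 + ind * (W - 1)) * V) + expR (- r) * r * (W * jv) +
      M * V * (expR (- r) * exp_tail2 (r * Lam))) +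
   (expR (- r') * r' * (expR (- r) * (W * (jv + (E1 - 1) * fv)) +
      M * V * Lam * (expR (- r) * (expR (r * Lam) - 1))) +
    M * V * (expR (- r) * expR (r * Lam)) * (expR (- r') * exp_tail2 (r' * Lam))) =
   expR (- delta) * ((1 + ind * (W - 1)) * V + W * (delta * (jv + rho * (E1 - 1) * fv)) +
     M * V * exp_tail2 (delta * Lam)).
  by rewrite -eD /exp_tail2 eE dE /r /r'; ring.
have -> : expR (lam * delta) * vr s = expR (- delta) * (expR ((1 + lam) * delta) * V).
  by rewrite mulrA -expRD; congr (expR _ * _); ring.
rewrite ler_pM2l ?expR_gt0//.
(* The bonus at [0] is bounded by [W * beta * delta], so that, like the one-jump terms, it carries
   the factor [W * delta] and [key] absorbs both together. *)
have Wb : W - 1 <= W * (beta * delta).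
  rewrite lerBlDr -lerBlDl -{1}[W]mulr1 -mulrBr.
  have := expR_ge1Dx (- (beta * delta)).
  move=> h; apply: le_trans (ler_wpM2l W0 h) _.
  by rewrite /W -expRD subrr expR0.
have V0 : 0 <= V by exact: vr0.
have h1 : ind * (W - 1) * V <= ind * (W * (beta * delta)) * V.
  by rewrite ler_wpM2r// ler_wpM2l// /ind ler0n.
have h2 : W * delta * (jv + rho * (E1 - 1) * fv + beta * (ind * V)) <= W * delta * (Lam * V).
  by rewrite ler_wpM2l// mulr_ge0 ?(ltW delta0).
have h3 : (1 + W * (delta * Lam + E1 * exp_tail2 (delta * Lam))) * V <= expR ((1 + lam) * delta) * V.
  by rewrite ler_wpM2r.
apply: le_trans h3.
have -> : (1 + ind * (W - 1)) * V = V + ind * (W - 1) * V by ring.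
have -> : W * (delta * (jv + rho * (E1 - 1) * fv)) =
  W * delta * (jv + rho * (E1 - 1) * fv + beta * (ind * V)) - ind * (W * (beta * delta)) * V by ring.
have -> : (1 + W * (delta * Lam + E1 * exp_tail2 (delta * Lam))) * V =
  V + W * delta * (Lam * V) + M * V * exp_tail2 (delta * Lam) by rewrite /M; ring.
move: (ind * (W - 1) * V) (ind * (W * (beta * delta)) * V) h1 (W * delta * _) h2 => a1 a2 h1 a3 h2.
lra.
Qed.

(* Majorizes [expR (beta * collision time)]: a cell may contain a collision only
   if the walks agree at its left end or one of them jumps in it. *)
Fixpoint path_weight (s : int) (ls ls' : seq (seq int)) : R :=
  match ls, ls' with
  | L :: ls1, L' :: ls1' =>
      step_weight s L L' * path_weight (s + displacement L - displacement L') ls1 ls1'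
  | _, _ => 1
  end.

Definition path_tilt (ls : seq (seq int)) : R := \prod_(L <- ls) tilt L.

(** The supersolution acts as a potential: each cell multiplies it by at most [expR (lam * delta)],
    and [1 <= vr] dominates the empty product left at the end. The blocks of [Y] form the outer sum
    because the model averages [X] for a fixed [Y]. *)
Lemma path_upper (lam : R) :
  1 + expR (beta * delta) * (delta * Lam + E1 * exp_tail2 (delta * Lam)) <= expR ((1 + lam) * delta) ->
  (forall x, 1 <= vr x) ->
  forall n s,
  (isum (block_weight J r') n (fun ls' =>
     isum (block_weight J r) n (fun ls => (path_weight s ls ls' * path_tilt ls')%:E))
   <= (expR (lam * delta * n%:R) * vr s)%:E)%E.
Proof.
move=> hd vr1.
have r0 : 0 <= r by rewrite mulr_ge0 ?(ltW delta0)// subr_ge0 ltW//; case/andP: rho01.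
have r0' : 0 <= r' by rewrite mulr_ge0 ?(ltW delta0)// ltW//; case/andP: rho01.
have b0 t L : 0 <= t -> 0 <= block_weight J t L.
  by move=> t0; rewrite mulr_ge0 ?poisson_weight_ge0// prodr_ge0.
have sw0 s L L' : 0 <= step_weight s L L' by rewrite /step_weight; case: ifP => _; rewrite ?expR_ge0.
have pw0 s ls ls' : 0 <= path_weight s ls ls'.
  by elim: ls s ls' => [|L ls IH] s [|L' ls'] //=; rewrite mulr_ge0.
have tl0 L : 0 <= tilt L by rewrite /tilt; case: ifP => _ //; exact: expR_ge0.
have pt0 ls : 0 <= path_tilt ls by apply: prodr_ge0.
have ig0 t m f : 0 <= t -> (forall ls, (0 <= f ls)%E) -> (0 <= isum (block_weight J t) m f)%E.
  by move=> t0; apply: isum_ge0 => L; exact: b0.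
have pp0 s ls ls' : (0 <= (path_weight s ls ls' * path_tilt ls')%:E)%E.
  by rewrite lee_fin mulr_ge0.
elim => [|n IH] s /=.
  by rewrite /path_tilt big_nil mulr0 expR0 !mul1r lee_fin vr1.
pose G s' := isum (block_weight J r') n (fun ls' =>
     isum (block_weight J r) n (fun ls => (path_weight s' ls ls' * path_tilt ls')%:E)).
apply: (@le_trans _ _ (\esum_(L' in [set: seq int]) ((block_weight J r' L')%:E *
   \esum_(L in [set: seq int]) ((block_weight J r L)%:E *
     ((step_weight s L L' * tilt L')%:E * G (s + displacement L - displacement L')%R)))%E)).
  apply: le_esum => L' _; rewrite lee_wpmul2l ?lee_fin ?b0// le_eqVlt; apply/orP; left.
  (* The first block of [X] is summed before the remaining blocks of [Y], so that the first blocks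
     of both walks form one step. *)
  apply/eqP; rewrite isum_esum//; last 2 first.
  - by move=> L; exact: b0.
  - by move=> L ls; rewrite mule_ge0 ?lee_fin ?b0// ig0// => ls1; rewrite lee_fin !mulr_ge0.
  apply: eq_esum => L _.
  rewrite isumZ ?lee_fin ?b0//; last 2 first.
  - by move=> L1; exact: b0.
  - by move=> ls; apply: ig0 => // ls1; rewrite lee_fin !mulr_ge0.
  congr (_ * _)%E; rewrite /G -isumZ ?lee_fin ?mulr_ge0//; last 2 first.
  - by move=> L1; exact: b0.
  - by move=> ls; exact: ig0.
  apply: eq_isum => ls' _; rewrite -isumZ ?lee_fin ?mulr_ge0//; last first.
    by move=> L1; exact: b0.
  apply: eq_isum => ls _; rewrite -EFinM; congr (_%:E).
  by rewrite /path_tilt big_cons; ring.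
apply: (@le_trans _ _ (\esum_(L' in [set: seq int]) ((block_weight J r' L')%:E *
   \esum_(L in [set: seq int]) ((expR (lam * delta * n%:R))%:E * ((block_weight J r L)%:E *
     ((step_weight s L L' * tilt L')%:E * v (s + displacement L - displacement L')%R))))%E)).
  apply: le_esum => L' _; rewrite lee_wpmul2l ?lee_fin ?b0//.
  apply: le_esum => L _; rewrite [leRHS]muleCA lee_wpmul2l ?lee_fin ?b0//.
  rewrite [leRHS]muleCA lee_wpmul2l ?lee_fin ?mulr_ge0//.
  by apply: le_trans (IH _) _; rewrite EFinM.
under eq_esum => L' _.
  rewrite esumZl ?lee_fin ?expR_ge0//; last first.
    by move=> L; apply: mule_ge0; [by rewrite lee_fin b0|apply: mule_ge0; rewrite lee_fin// mulr_ge0].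
  rewrite muleCA; over.
rewrite esumZl ?lee_fin ?expR_ge0//; last first.
  by move=> L'; rewrite mule_ge0 ?lee_fin ?b0// esum_ge0// => L _; apply: mule_ge0; [by rewrite lee_fin b0|apply: mule_ge0; rewrite lee_fin// mulr_ge0].
apply: le_trans (lee_wpmul2l _ (step_upper hd s)) _; first by rewrite lee_fin expR_ge0.
rewrite -!EFinM lee_fin mulrA -expRD -natr1 mulrDr mulr1.
by rewrite addrC.
Qed.

End step_inequality.

(** * Collision times on a grid *)

Section positions.
Context (R : realType).
Implicit Types (t : nat -> R) (x : nat -> int).

Definition position t x s : int := \sum_(i < jump_count t s) x i.

Lemma position_block t x d k : good_path t -> 0 <= d ->
  position t x (k.+1%:R * d) = position t x (k%:R * d) + displacement (block t x d k).
Proof.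
move=> gt d0; rewrite /displacement /block big_map /position.
have h : (jump_count t (k%:R * d) <= jump_count t (k.+1%:R * d))%N.
  by apply: jump_count_mono => //; rewrite ?mulr_ge0// ler_wpM2r// ler_nat.
rewrite -(big_mkord xpredT x) (big_cat_nat (n := jump_count t (k%:R * d)))//=.
by rewrite big_mkord /index_iota.
Qed.

Lemma position_block_nil t x d k s : good_path t -> 0 <= d ->
  block t x d k = [::] -> k%:R * d <= s <= k.+1%:R * d ->
  position t x s = position t x (k%:R * d).
Proof.
move=> gt d0 /(congr1 size); rewrite size_map size_iota /= => /eqP; rewrite subn_eq0 => h /andP[h1 h2].
have k0 : 0 <= k%:R * d by rewrite mulr_ge0.
rewrite /position (_ : jump_count t s = jump_count t (k%:R * d))//.
apply/eqP; rewrite eqn_leq; apply/andP; split; last exact: jump_count_mono.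
by apply: leq_trans h; apply: jump_count_mono => //; exact: le_trans h1.
Qed.

Lemma position0 t x : good_path t -> position t x 0 = 0.
Proof. by move=> gt; rewrite /position jump_count0// big_ord0. Qed.

Local Notation leb := (@lebesgue_measure R).

Let leb_itv (a b : R) c e : a <= b ->
  leb [set` Interval (BSide c a) (BSide e b)] = (b - a)%:E.
Proof.
rewrite le_eqVlt => /predU1P[->|ab]; rewrite lebesgue_measure_itv/= lte_fin.
  by rewrite ltxx subrr.
by rewrite ab EFinB.
Qed.

Lemma integral_collision_fin (X Y : R -> int) (T : R) : 0 <= T ->
  ((collision_time X Y T)%:E = \int[leb]_(t in `[0%R, T]) (\1_[set s | X s = Y s] t : R)%:E)%E
  /\ 0 <= collision_time X Y T <= T.
Proof.
move=> T0; have i0 : (0 <= \int[leb]_(t in `[0%R, T]) (\1_[set s | X s = Y s] t : R)%:E)%E.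
  by apply: integral_ge0 => t _; rewrite lee_fin.
have i1 : (\int[leb]_(t in `[0%R, T]) (\1_[set s | X s = Y s] t : R)%:E <= T%:E)%E.
  apply: (@le_trans _ _ (\int[leb]_(t in `[0%R, T]) (cst 1%E t))%E).
    apply: ge0_le_integral_any => t _; first by rewrite lee_fin.
    by rewrite lee_fin /indic; case: (_ \in _).
  rewrite integral_cst//= mul1e; apply: le_trans (_ : (T - 0)%:E <= _)%E; last by rewrite subr0.
  by rewrite -(@leb_itv 0 T true false).
have fi : (\int[leb]_(t in `[0%R, T]) (\1_[set s | X s = Y s] t : R)%:E)%E \is a fin_num.
  by rewrite ge0_fin_numE// (le_lt_trans i1)// ltry.
rewrite /collision_time /Rintegral fineK//; split => //.
by rewrite -!lee_fin fineK// i0.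
Qed.

Definition step_sum (A : nat -> set (measurableTypeR R)) n (s : R) : \bar R :=
  (\sum_(k < n) (\1_(A k) s : R)%:E)%E.

Lemma integral_sum_indic (D : set (measurableTypeR R)) (A : nat -> set (measurableTypeR R)) n : measurable D ->
  (forall k, measurable (A k)) ->
  (\int[leb]_(s in D) step_sum A n s = \sum_(k < n) leb (A k `&` D))%E.
Proof.
move=> mD mA; rewrite /step_sum ge0_integral_sum//.
- by apply: eq_bigr => k _; rewrite integral_indic.
- by move=> k; apply/measurable_EFinP; exact: measurable_indic.
Qed.

Lemma grid_cell (d : R) n s : 0 < d -> 0 <= s <= n.+1%:R * d ->
  exists2 k, (k < n.+1)%N & k%:R * d <= s <= k.+1%:R * d.
Proof.
move=> d0; elim: n => [|n IH] /andP[s0 sn]; first by exists 0%N => //; rewrite mul0r s0.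
have [h|h] := leP s (n.+1%:R * d); last by exists n.+1 => //; rewrite ltW.
by have [k kn hk] := IH (ltac:(by rewrite s0)); exists k => //; exact: ltnW.
Qed.

Let cell_mass (d : R) k : k.+1%:R * d - k%:R * d = d.
Proof. by rewrite -natr1; ring. Qed.

(** Closed cells cover the whole time interval; their common endpoints only increase the upper
    bound. *)
Lemma collision_upper (X Y : R -> int) (d : R) n (b : nat -> bool) : 0 < d ->
  (forall k s, (k < n)%N -> k%:R * d <= s <= k.+1%:R * d -> X s = Y s -> b k) ->
  collision_time X Y (n%:R * d) <= d * \sum_(k < n) (b k)%:R.
Proof.
move=> d0 hb; have nd0 : 0 <= n%:R * d by rewrite mulr_ge0// ltW.
case: n nd0 hb => [|n] nd0 hb.
  have [_ /andP[_ h]] := @integral_collision_fin X Y _ nd0.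
  by apply: le_trans h _; rewrite mul0r big_ord0 mulr0.
pose A k : set (measurableTypeR R) := if b k then `[k%:R * d, k.+1%:R * d]%classic else set0.
have mA k : measurable (A k) by rewrite /A; case: (b k); [exact: measurable_itv|exact: measurable0].
rewrite -lee_fin (@integral_collision_fin X Y _ nd0).1.
apply: (@le_trans _ _ (\int[leb]_(s in `[0%R, (n.+1%:R * d)%R]) step_sum A n.+1 s)%E).
  apply: ge0_le_integral_any => s /=; first by rewrite lee_fin.
  rewrite in_itv /= => /(grid_cell d0)[k kn hk].
  rewrite /step_sum (bigD1 (Ordinal kn))//=; apply: (@le_trans _ _ (\1_(A k) s : R)%:E); last first.
    by rewrite leeDl// sume_ge0// => i _; rewrite lee_fin.
  rewrite lee_fin /indic; case: (boolP (s \in [set s | _])) => //; rewrite inE /= => XY.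
  by rewrite /A (hb k s)// mem_set//= in_itv.
rewrite integral_sum_indic//.
rewrite mulr_sumr -sumEFin; apply: lee_sum => k _.
apply: (@le_trans _ _ (leb (A k))).
  apply: le_measure; rewrite ?inE//.
  by apply: measurableI => //; exact: measurable_itv.
rewrite /A; case: (b k); last by rewrite measure0 mulr0.
by rewrite leb_itv ?cell_mass ?mulr1// ler_wpM2r ?ler_nat// ltW.
Qed.

(** Half-open cells are disjoint, so the sum of their indicators never exceeds [1] and stays below
    the collision indicator. *)
Lemma collision_lower (X Y : R -> int) (d : R) n (b : nat -> bool) : 0 < d ->
  (forall k s, (k < n)%N -> k%:R * d <= s < k.+1%:R * d -> b k -> X s = Y s) ->
  d * \sum_(k < n) (b k)%:R <= collision_time X Y (n%:R * d).
Proof.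
move=> d0 hb; have nd0 : 0 <= n%:R * d by rewrite mulr_ge0// ltW.
pose A k : set (measurableTypeR R) := if b k then `[k%:R * d, k.+1%:R * d[%classic else set0.
have mA k : measurable (A k) by rewrite /A; case: (b k); [exact: measurable_itv|exact: measurable0].
rewrite -lee_fin (@integral_collision_fin X Y _ nd0).1.
apply: (@le_trans _ _ (\int[leb]_(s in `[0%R, (n%:R * d)%R]) step_sum A n s)%E); last first.
  apply: ge0_le_integral_any => s _ /=; first by apply: sume_ge0 => k _; rewrite lee_fin.
  rewrite /step_sum; have [[k Aks]|none] := pselect (exists k : 'I_n, A k s); last first.
    rewrite big1 ?lee_fin// => k _; rewrite /indic memNset//= => h; apply: none; by exists k.
  rewrite (bigD1 k)//= big1 ?adde0.
    rewrite lee_fin /indic; case: (_ \in A k) => //; rewrite mem_set//=.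
    move: Aks; rewrite /A; case: ifP => // bk; rewrite /= in_itv /= => hs.
    exact: (hb k).
  move=> i ik; rewrite /indic memNset//= => Ais; move: Aks Ais; rewrite /A.
  case: ifP => // _; case: ifP => // _; rewrite /= !in_itv /= => /andP[k1 k2] /andP[i1 i2].
  have := le_lt_trans k1 i2; rewrite (ltr_pM2r d0) ltr_nat ltnS => ki.
  have := le_lt_trans i1 k2; rewrite (ltr_pM2r d0) ltr_nat ltnS => ik'.
  by move: ik; rewrite -val_eqE /= eqn_leq ki ik'.
rewrite integral_sum_indic//.
rewrite mulr_sumr -sumEFin; apply: lee_sum => k _.
rewrite (_ : A k `&` _ = A k); last first.
  apply/setIidl => s; rewrite /A; case: (b k) => //=; rewrite !in_itv/= => /andP[h1 h2].
  rewrite (le_trans _ h1) ?mulr_ge0 ?(ltW d0)//= (le_trans (ltW h2))// ler_wpM2r ?(ltW d0)//.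
  by rewrite ler_nat.
rewrite /A; case: (b k); last by rewrite measure0 mulr0.
by rewrite leb_itv ?cell_mass ?mulr1// ler_wpM2r ?ler_nat// ltW.
Qed.

End positions.

(** * Bounds on the partition function *)

Section weights.
Context (R : realType) (beta delta : R).

Lemma path_weightE n : forall (S : nat -> int) ls ls', size ls = n -> size ls' = n ->
  (forall k, (k < n)%N ->
     S k.+1 = S k + displacement (nth [::] ls k) - displacement (nth [::] ls' k)) ->
  path_weight beta delta (S 0%N) ls ls' = expR (beta * (delta *
    \sum_(k < n) [|| S k == 0, nth [::] ls k != [::] | nth [::] ls' k != [::]]%:R)).
Proof.
elim: n => [|n IH] S [|L ls] [|L' ls'] //=.
  by rewrite big_ord0 !mulr0 expR0.
move=> [sl] [sl'] hS; rewrite -(hS 0%N isT)/= (IH (S \o succn) ls ls')//; last first.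
  by move=> k kn /=; exact: (hS k.+1).
rewrite big_ord_recl /step_weight /= mulrDr mulrDr expRD; congr (_ * _).
by case: ifP => _; rewrite ?mulr1// !mulr0 expR0.
Qed.

(* Minorizes [expR (beta * collision time)] against the constant path [0]. *)
Fixpoint pinned_weight (s : int) (ls : seq (seq int)) : R :=
  if ls is L :: ls' then
    (if (s == 0) && (L == [::]) then expR (beta * delta) else 1) *
    pinned_weight (s + displacement L) ls'
  else 1.

Lemma pinned_weightE n : forall (S : nat -> int) ls, size ls = n ->
  (forall k, (k < n)%N -> S k.+1 = S k + displacement (nth [::] ls k)) ->
  pinned_weight (S 0%N) ls = expR (beta * (delta *
    \sum_(k < n) ((S k == 0) && (nth [::] ls k == [::]))%:R)).
Proof.
elim: n => [|n IH] S [|L ls] //=.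
  by rewrite big_ord0 !mulr0 expR0.
move=> [sl] hS; rewrite -(hS 0%N isT)/= (IH (S \o succn) ls)//; last first.
  by move=> k kn /=; exact: (hS k.+1).
rewrite big_ord_recl /= mulrDr mulrDr expRD; congr (_ * _).
by case: ifP => _; rewrite ?mulr1// !mulr0 expR0.
Qed.

End weights.

(** * Comparison of integrals on an almost sure event *)

Section almost_sure_integrals.
Context (R : realType) (d : measure_display) (Omega : measurableType d).
Variables (P : probability Omega R) (A : set Omega).
Hypotheses (mA : measurable A) (PA : (P A = 1)%E).
Local Open Scope ereal_scope.

Let PAC : P (~` A) = 0.
Proof. by rewrite probability_setC// PA subee. Qed.

Let restrict (g : Omega -> \bar R) : (forall w, 0 <= g w) -> measurable_fun setT g ->
  \int[P]_w g w = \int[P]_(w in A) g w.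
Proof.
move=> g0 mg; rewrite (@ge0_negligible_integral _ _ _ P setT (~` A))//; last exact: measurableC.
by rewrite setDE setCK setTI.
Qed.

(** Replacing [g] by [+oo] off [A] gives a measurable function that dominates [f] everywhere and has
    the same integral as [g]; [f] itself may fail to be measurable. *)
Lemma integral_le_as (f g : Omega -> \bar R) : (forall w, 0 <= f w) ->
  (forall w, 0 <= g w) -> measurable_fun setT g ->
  (forall w, A w -> f w <= g w) -> \int[P]_w f w <= \int[P]_w g w.
Proof.
move=> f0 g0 mg fg.
pose h w := if w \in A then g w else +oo.
have h0 w : 0 <= h w by rewrite /h; case: ifP.
have mh : measurable_fun setT h.
  apply: measurable_fun_ifT => //.
  by apply: (measurable_fun_bool true); rewrite setTI (_ : _ @^-1` _ = A)//;
    apply/seteqP; split => w /=; [move/set_mem|move/mem_set].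
apply: (@le_trans _ _ (\int[P]_w h w)).
  apply: ge0_le_integral_any => // w _; rewrite /h; case: ifPn => [/set_mem/fg//|_].
  exact: leey.
rewrite !restrict// le_eqVlt; apply/orP; left; apply/eqP; apply: eq_integral => w wA.
by rewrite /h wA.
Qed.

Lemma integral_ge_as (f g : Omega -> \bar R) : (forall w, 0 <= f w) ->
  (forall w, 0 <= g w) -> measurable_fun setT g ->
  (forall w, A w -> g w <= f w) -> \int[P]_w g w <= \int[P]_w f w.
Proof.
move=> f0 g0 mg gf; rewrite restrict// integral_mkcond.
apply: ge0_le_integral_any => w _; first by apply: erestrict_ge0.
rewrite patchE; case: ifPn => // /set_mem; exact: gf.
Qed.

End almost_sure_integrals.

Section partition_bounds.
Context (R : realType) (d : measure_display) (Omega : measurableType d).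
Variables (P : probability Omega R) (W : R -> Omega -> int) (rho beta T : R).
Hypotheses (b0 : 0 <= beta) (T0 : 0 <= T).

Lemma partition_functionE (Y : R -> int) :
  ((partition_function P W rho beta T Y)%:E =
    \int[P]_w (expR (beta * collision_time (fun t => W ((1 - rho) * t)%R w) Y T))%:E)%E
  /\ 1 <= partition_function P W rho beta T Y <= expR (beta * T).
Proof.
have PT : (P setT = 1)%E by exact: probability_setT.
have h w := (@integral_collision_fin R (fun t => W ((1 - rho) * t)%R w) Y T T0).2.
set I := (\int[P]_w _)%E.
have I1 : (1 <= I)%E.
  apply: (@le_trans _ _ (\int[P]_w (cst 1%E w))%E); first by rewrite integral_cst//= PT mule1.
  apply: ge0_le_integral_any => w _ //=; rewrite lee_fin -[leLHS]expR0 ler_expR mulr_ge0//.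
  by case/andP: (h w).
have I2 : (I <= (expR (beta * T))%:E)%E.
  apply: (@le_trans _ _ (\int[P]_w (cst (expR (beta * T))%:E w))%E); last first.
    by rewrite integral_cst//= PT mule1.
  apply: ge0_le_integral_any => w _ //=.
  by rewrite lee_fin ler_expR ler_wpM2l//; case/andP: (h w).
have fI : I \is a fin_num.
  by rewrite ge0_fin_numE ?(le_trans _ I1)// (le_lt_trans I2)// ltry.
have ZE : ((partition_function P W rho beta T Y)%:E = I)%E.
  by rewrite /partition_function unlock fineK.
by rewrite ZE -!lee_fin ZE I1 I2.
Qed.

Let lnZ w := ln (partition_function P W rho beta T (fun t => W (rho * t)%R w)).

Lemma ln_partition_function (Y : R -> int) :
  0 <= ln (partition_function P W rho beta T Y) <= beta * T.
Proof.
have [_ /andP[h1 h2]] := partition_functionE Y.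
rewrite ln_ge0//= -[leRHS]expRK ler_ln// posrE ?expR_gt0//.
exact: lt_le_trans h1.
Qed.

Lemma expected_lnE : ((fine 'E_P[lnZ])%:E = \int[P]_w (lnZ w)%:E)%E /\
  0 <= fine 'E_P[lnZ] <= beta * T.
Proof.
have PT : (P setT = 1)%E by exact: probability_setT.
have I1 : (0 <= \int[P]_w (lnZ w)%:E)%E.
  by apply: integral_ge0 => w _; rewrite lee_fin; case/andP: (ln_partition_function (fun t => W (rho * t)%R w)).
have I2 : (\int[P]_w (lnZ w)%:E <= (beta * T)%:E)%E.
  apply: (@le_trans _ _ (\int[P]_w (cst (beta * T)%:E w))%E); last first.
    by rewrite integral_cst//= PT mule1.
  by apply: ge0_le_integral_any => w _ //=; rewrite lee_fin; case/andP: (ln_partition_function (fun t => W (rho * t)%R w)).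
have fI : (\int[P]_w (lnZ w)%:E)%E \is a fin_num.
  by rewrite ge0_fin_numE// (le_lt_trans I2)// ltry.
have EE : ('E_P[lnZ] = \int[P]_w (lnZ w)%:E)%E by rewrite unlock.
by rewrite EE fineK// -!lee_fin fineK// I1 I2.
Qed.

End partition_bounds.

Section pathwise.
Context (R : realType) (d : measure_display) (Omega : measurableType d).
Variables (P : probability Omega R) (W : R -> Omega -> int).
Variables (tau : nat -> {RV P >-> R}) (xi : nat -> Omega -> int).
Hypothesis hW : forall t omega, 0 <= t ->
  W t omega = \sum_(i < jump_count (fun n => tau n omega) t) xi i omega.
Variables (beta delta : R).
Hypotheses (beta0 : 0 <= beta) (delta0 : 0 < delta).

Let WE t w : 0 <= t -> W t w = position (tau ^~ w) (xi ^~ w) t.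
Proof. exact: hW. Qed.

Let blocksE r n w : good tau w -> blocks tau xi r n w = mkseq (block (tau ^~ w) (xi ^~ w) r) n.
Proof. by move=> gw; rewrite /blocks; case: asboolP. Qed.

Let scaled_cell (a s : R) k : 0 <= a -> k%:R * delta <= s <= k.+1%:R * delta ->
  k%:R * (a * delta) <= a * s <= k.+1%:R * (a * delta).
Proof. by move=> a0 /andP[h1 h2]; rewrite ![_ * (a * _)]mulrCA !ler_wpM2l. Qed.

(** In a cell where neither walk jumps the difference is constant, so a collision there forces it to
    vanish at the left end. Every other cell is charged in full. *)
Lemma weight_upper rho n w w' : 0 <= rho <= 1 -> good tau w -> good tau w' ->
  expR (beta * collision_time (fun t => W ((1 - rho) * t) w) (fun t => W (rho * t) w') (n%:R * delta))
  <= path_weight beta delta 0 (blocks tau xi ((1 - rho) * delta) n w)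
       (blocks tau xi (rho * delta) n w').
Proof.
move=> /andP[r0 r1] gw gw'; have r0' : 0 <= 1 - rho by rewrite subr_ge0.
rewrite !blocksE//.
pose X s := position (tau ^~ w) (xi ^~ w) s.
pose Y s := position (tau ^~ w') (xi ^~ w') s.
pose S k : int := X (k%:R * ((1 - rho) * delta)) - Y (k%:R * (rho * delta)).
have S0 : S 0%N = 0 by rewrite /S !mul0r /X /Y !position0// subrr.
rewrite -S0 (@path_weightE _ _ _ n)//; last 3 first.
- by rewrite size_mkseq.
- by rewrite size_mkseq.
- move=> k kn; rewrite !nth_mkseq// /S /X /Y !position_block//; last 2 first.
  + by rewrite mulr_ge0// ltW.
  + by rewrite mulr_ge0// ltW.
  by rewrite opprD !addrA; congr (_ + _); rewrite -!addrA; congr (_ + _); exact: addrC.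
rewrite ler_expR ler_wpM2l//.
apply: (collision_upper (b := fun k => [|| S k == 0, nth [::] (mkseq (block (tau ^~ w) (xi ^~ w) ((1 - rho) * delta)) n) k != [::] | nth [::] (mkseq (block (tau ^~ w') (xi ^~ w') (rho * delta)) n) k != [::]])) => // k s kn hs XY.
rewrite !nth_mkseq//; apply/negP => /negP; rewrite !negb_or !negbK => /and3P[/eqP Sk /eqP e1 /eqP e2].
have s0 : 0 <= s by case/andP: hs => + _; apply: le_trans; rewrite mulr_ge0// ltW.
have d1 : 0 <= (1 - rho) * delta by rewrite mulr_ge0// ltW.
have d2 : 0 <= rho * delta by rewrite mulr_ge0// ltW.
apply: Sk; move: XY; rewrite !WE ?mulr_ge0// /S /X /Y.
rewrite (position_block_nil gw d1 e1 (scaled_cell r0' hs)).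
by rewrite (position_block_nil gw' d2 e2 (scaled_cell r0 hs)) => ->; rewrite subrr.
Qed.

Lemma weight_lower n w w' : good tau w -> good tau w' ->
  pinned_weight beta delta 0 (blocks tau xi delta n w) <=
  expR (beta * collision_time (fun t => W ((1 - 0) * t) w) (fun t => W (0 * t) w') (n%:R * delta)).
Proof.
move=> gw gw'; rewrite !blocksE//.
pose X s := position (tau ^~ w) (xi ^~ w) s.
pose S k : int := X (k%:R * delta).
have S0 : S 0%N = 0 by rewrite /S !mul0r /X !position0.
rewrite -S0 (@pinned_weightE _ _ _ n)//; last 2 first.
- by rewrite size_mkseq.
- by move=> k kn; rewrite !nth_mkseq// /S /X !position_block// ltW.
rewrite ler_expR ler_wpM2l//.
apply: (collision_lower (b := fun k => (S k == 0) && (nth [::] (mkseq (block (tau ^~ w) (xi ^~ w) delta) n) k == [::]))) => // k s kn /andP[h1 h2].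
rewrite !nth_mkseq// => /andP[/eqP Sk /eqP e1].
have s0 : 0 <= s by apply: le_trans h1; rewrite mulr_ge0// ltW.
rewrite subr0 mul1r mul0r !WE// position0//.
by rewrite (position_block_nil gw (ltW delta0) e1)// h1 ltW.
Qed.

End pathwise.

(** * The quenched upper bound *)

Section weight_bounds.
Context (R : realType) (beta delta : R).
Hypothesis bd0 : 0 <= beta * delta.

Let W1 : 1 <= expR (beta * delta).
Proof. by rewrite -[leLHS]expR0 ler_expR. Qed.

Let weight_step (b : bool) (x : R) m : 1 <= x <= expR (beta * delta) ^+ m ->
  1 <= (if b then expR (beta * delta) else 1) * x <= expR (beta * delta) ^+ m.+1.
Proof.
move=> /andP[x1 xm]; have x0 : 0 <= x by exact: le_trans x1.
rewrite exprS; case: b; rewrite ?mul1r.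
  rewrite (le_trans x1) ?ler_peMl//=.
  by rewrite ler_wpM2l// expR_ge0.
by rewrite x1 (le_trans xm)// ler_peMl// exprn_ge0// expR_ge0.
Qed.

Lemma path_weight_bounds s ls ls' :
  1 <= path_weight beta delta s ls ls' <= expR (beta * delta) ^+ size ls.
Proof.
elim: ls s ls' => [|L ls IH] s [|L' ls'] /=; rewrite ?lexx ?expr0 ?lexx//.
  by rewrite exprn_ege1.
exact: weight_step.
Qed.

Lemma pinned_weight_bounds s ls :
  1 <= pinned_weight beta delta s ls <= expR (beta * delta) ^+ size ls.
Proof.
elim: ls s => [|L ls IH] s /=; first by rewrite expr0 lexx.
exact: weight_step.
Qed.

Lemma isum_bounds (T : choiceType) (q : T -> R) n (f : seq T -> R) M :
  (forall x, 0 <= q x) -> (\esum_(x in [set: T]) (q x)%:E = 1)%E ->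
  (forall s, 1 <= f s) -> (forall s, size s = n -> f s <= M) ->
  (1 <= isum q n (fun s => (f s)%:E) <= M%:E)%E.
Proof.
move=> q0 q1 f1 fM; have f0 s : 0 <= f s by exact: le_trans (f1 s).
apply/andP; split.
  rewrite -(isum_cst (q := q) q0 n (c := 1%E))//.
  by apply: isum_le => // s _; rewrite lee_fin.
(* A list of size [n] is needed to compare [M] with a value of [f]; [T] is inhabited because the
   weights sum to [1]. *)
have M0 : 0 <= M.
  have [s sn] : exists s : seq T, size s = n.
    have [x _] : exists x : T, True.
      apply: contrapT => h; have : (\esum_(x in [set: T]) (q x)%:E = 0)%E.
        by apply: esum1 => x _; exfalso; apply: h; exists x.
      by rewrite q1 => /eqP; rewrite onee_eq0.
    by exists (nseq n x); rewrite size_nseq.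
  exact: le_trans (f0 s) (fM s sn).
rewrite -[leRHS](isum_cst (q := q) q0 n (c := M%:E))//.
by apply: isum_le => // s sn; rewrite lee_fin ?fM.
Qed.

End weight_bounds.

Section expected_log.
Context (R : realType) (d : measure_display) (Omega : measurableType d).
Variables (P : probability Omega R) (J : int -> R) (W : R -> Omega -> int).
Variables (tau : nat -> {RV P >-> R}) (xi : nat -> Omega -> int).
Hypothesis wd : walk_data J tau xi.
Hypothesis hW : forall t omega, 0 <= t ->
  W t omega = \sum_(i < jump_count (fun n => tau n omega) t) xi i omega.
Hypothesis Jev : forall x, J (- x) = J x.
Variables (beta delta : R).
Hypotheses (beta0 : 0 < beta) (delta0 : 0 < delta).

Let J0 : forall x, 0 <= J x := jump_law_ge0 wd.
Let bd0 : 0 <= beta * delta. Proof. by rewrite mulr_ge0 ?ltW. Qed.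

Section upper.
Variables (rho lam Lam : R) (K n : nat) (vr : int -> R) (t : R).
Hypotheses (rho01 : 0 < rho < 1) (Lam0 : 0 <= Lam) (vr1 : forall x, 1 <= vr x).
Hypothesis lam0 : 0 <= lam.
Hypothesis ht : (\esum_(z in [set: int]) (far_kernel J K z)%:E = t%:E)%E.
Hypothesis hv : forall s, (kop (tilted_kernel J K rho) (fun x => (vr x)%:E) s +
  beta%:E * (edelta s * (vr s)%:E) <= Lam%:E * (vr s)%:E)%E.
Hypothesis hd : 1 + expR (beta * delta) *
  (delta * Lam + expR 1 * exp_tail2 (delta * Lam)) <= expR ((1 + lam) * delta).

Let r := (1 - rho) * delta.
Let r' := rho * delta.
Let r0 : 0 <= r.
Proof. by rewrite mulr_ge0 ?(ltW delta0)// subr_ge0 ltW//; case/andP: rho01. Qed.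
Let r0' : 0 <= r'.
Proof. by rewrite mulr_ge0 ?(ltW delta0)// ltW//; case/andP: rho01. Qed.
Let q0 s L : 0 <= s -> 0 <= block_weight J s L.
Proof. by move=> s0; exact: (block_weight_ge0 wd). Qed.
Let q1 s : 0 <= s -> (\esum_(L in [set: seq int]) (block_weight J s L)%:E = 1)%E.
Proof. by move=> s0; exact: (block_weight_mass wd). Qed.

Let zhat ls' : \bar R :=
  isum (block_weight J r) n (fun ls => (path_weight beta delta 0 ls ls')%:E).
Let z ls' := fine (zhat ls').
Let cnt (ls' : seq (seq int)) : R := \sum_(L <- ls') (far_block K L)%:R.

Let zhat_bounds ls' : (1 <= zhat ls' <= (expR (beta * delta) ^+ n)%:E)%E.
Proof.
apply: isum_bounds; [by move=> L; exact: q0|exact: q1| |].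
- by move=> s; case/andP: (path_weight_bounds bd0 0 s ls').
- by move=> s <-; case/andP: (path_weight_bounds bd0 0 s ls').
Qed.

Let zE ls' : zhat ls' = (z ls')%:E.
Proof.
have /andP[h1 h2] := zhat_bounds ls'.
by rewrite /z fineK// ge0_fin_numE ?(le_trans _ h1)// (le_lt_trans h2)// ltry.
Qed.

Let z1 ls' : 1 <= z ls'.
Proof. by rewrite -lee_fin -zE; case/andP: (zhat_bounds ls'). Qed.

Let tiltE ls' : path_tilt R K ls' = expR (cnt ls').
Proof.
rewrite /path_tilt /cnt expR_sum; apply: eq_bigr => L _.
by rewrite /tilt; case: ifP => _; rewrite ?expR0.
Qed.

(** In each cell only the term with exactly one jump is kept: its Poisson weight is
    [rho * delta * expR (- (rho * delta))], and the jump is long with probability [t]. *)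
Let mean_count : ((n%:R * (rho * delta * expR (- (rho * delta)) * t))%:E <=
  isum (block_weight J r') n (fun ls' => (cnt ls')%:E))%E.
Proof.
pose h (L : seq int) : \bar R := ((far_block K L)%:R)%:E.
have h0 L : (0 <= h L)%E by rewrite lee_fin.
rewrite (@eq_isum _ _ _ _ _ (fun s => \sum_(L <- s) h L)%E); last first.
  by move=> s _; rewrite /h sumEFin.
rewrite isum_sum//; last 2 first.
- by move=> L; exact: q0.
- exact: q1.
rewrite EFinM lee_wpmul2l ?lee_fin// esum_block//.
apply: le_trans (@esum_term_le _ _ 1%N _ _); last first.
  by move=> m; rewrite mule_ge0 ?lee_fin ?poisson_weight_ge0// isum_ge0.
rewrite EFinM; apply: lee_pmul.
- by rewrite lee_fin mulr_ge0// expR_ge0.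
- by rewrite -ht; apply: esum_ge0 => x _; rewrite lee_fin far_kernel_ge0.
- by rewrite lee_fin /poisson_weight expr1 divr1 mulrC.
rewrite -ht /=; apply: le_esum => x _.
by rewrite /h /far_block /far_kernel; case: ifP => _; rewrite -EFinM ?mulr1 ?mulr0.
Qed.

Lemma expected_ln_upper :
  fine 'E_P[fun w' => ln (partition_function P W rho beta (n%:R * delta) (fun t => W (rho * t) w'))]
  <= lam * delta * n%:R + ln (vr 0) - n%:R * (rho * delta * expR (- (rho * delta)) * t).
Proof.
have T0 : 0 <= n%:R * delta by rewrite mulr_ge0// ltW.
have [mg Pg] := (measurable_good tau, P_good wd).
have rho01' : 0 <= rho <= 1 by case/andP: rho01 => *; rewrite !ltW.
have [EE _] := expected_lnE P W rho (ltW beta0) T0.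
have lnz0 ls : 0 <= ln (z ls) by rewrite ln_ge0.
have cnt0 ls : 0 <= cnt ls by apply: sumr_ge0 => L _.
pose c := expR (lam * delta * n%:R) * vr 0.
have c1 : 1 <= c.
  rewrite mulr_ege1//; first by rewrite -[leLHS]expR0 ler_expR !mulr_ge0// ltW.
have c0 : 0 < c by exact: lt_le_trans c1.
have upper : (\int[P]_w' (ln (partition_function P W rho beta (n%:R * delta) (fun t => W (rho * t)%R w')))%:E
   <= isum (block_weight J r') n (fun ls' => (ln (z ls'))%:E))%E.
  rewrite -(integral_blocks wd r0' n (f := fun ls' => (ln (z ls'))%:E)); last first.
    by move=> s; rewrite lee_fin.
  apply: (integral_le_as mg Pg).
  - move=> w; rewrite lee_fin.
    by case/andP: (ln_partition_function P W rho (ltW beta0) T0 (fun t => W (rho * t)%R w)).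
  - by move=> w; rewrite lee_fin.
  - exact: (measurable_blocks_fun wd r0' n (fun ls' => (ln (z ls'))%:E)).
  move=> w' gw'; rewrite lee_fin.
  have [ZE /andP[Z1 _]] := partition_functionE P W rho (ltW beta0) T0 (fun t => W (rho * t)%R w').
  rewrite ler_ln ?posrE ?(lt_le_trans _ Z1)// ?(lt_le_trans _ (z1 _))//.
  rewrite -lee_fin -zE ZE /zhat -(integral_blocks wd r0); last first.
    by move=> s; rewrite lee_fin (le_trans ler01)//; case/andP: (path_weight_bounds bd0 0 s (blocks tau xi r' n w')).
  apply: (integral_le_as mg Pg).
  - by move=> w; rewrite lee_fin expR_ge0.
  - by move=> w; rewrite lee_fin (le_trans ler01)//; case/andP: (path_weight_bounds bd0 0 (blocks tau xi r n w) (blocks tau xi r' n w')).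
  - exact: (measurable_blocks_fun wd r0 n (fun ls => (path_weight beta delta 0 ls (blocks tau xi r' n w'))%:E)).
  - by move=> w gw; rewrite lee_fin; exact: (weight_upper hW (ltW beta0)).
pose q' := block_weight J r'.
have q0' L : 0 <= q' L by exact: q0.
have q1' : (\esum_(L in [set: seq int]) (q' L)%:E = 1)%E by exact: q1.
(* Jensen's inequality in tangent form: [ln Q <= Q - 1] for [Q = z * expR cnt / c]. As [c] is the
   bound of [path_upper], the mean of [Q] is at most [1]. *)
have young ls : ln (z ls) + cnt ls + 1 <= c^-1 * (z ls * expR (cnt ls)) + ln c.
  have zp : 0 < z ls by exact: lt_le_trans (z1 ls).
  have e0 := expR_gt0 (cnt ls).
  set Q := c^-1 * _; have y0 : 0 < Q by rewrite !mulr_gt0// invr_gt0.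
  have lnQ : ln Q = - ln c + (ln (z ls) + cnt ls).
    rewrite (@lnM _ c^-1) ?posrE ?invr_gt0//; last exact: mulr_gt0.
    by rewrite lnV ?posrE// (@lnM _ (z ls)) ?posrE// expRK.
  have : ln Q <= Q - 1.
    by rewrite -{1}(subrK 1 Q) addrC le_ln1Dx// ltrBrDr addrC subrr.
  by rewrite lnQ; move: (ln c) (ln (z ls)) => x2 x3 h; lra.
have sum_young : (isum q' n (fun ls => (ln (z ls))%:E) + isum q' n (fun ls => (cnt ls)%:E) + 1
    <= 1 + (ln c)%:E)%E.
  rewrite -{1}(isum_cst (q := q') q0' n (c := 1%E))// -!isumD//; last first.
    by move=> s; rewrite -EFinD lee_fin addr_ge0.
  apply: (@le_trans _ _ (isum q' n (fun ls => (c^-1)%:E * (z ls * expR (cnt ls))%:E + (ln c)%:E)%E)).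
    apply: isum_le => [L|s|s _]; [exact: q0'|by rewrite -!EFinD lee_fin !addr_ge0|].
    by rewrite -EFinM -!EFinD lee_fin.
  have lnc0 : 0 <= ln c by rewrite ln_ge0.
  have ci0 : 0 <= c^-1 by rewrite invr_ge0 ltW.
  have zc0 s : (0 <= (z s * expR (cnt s))%:E)%E.
    by rewrite lee_fin mulr_ge0 ?expR_ge0// (le_trans ler01).
  rewrite isumD//; last by move=> s; rewrite mule_ge0.
  rewrite isum_cst//; apply: leeD => //; rewrite isumZ//.
  rewrite -(lee_pmul2l (x := c%:E)) ?lte_fin// muleA -EFinM divff ?gt_eqF// mul1e mule1.
  have := path_upper J0 Jev rho01 beta0 delta0 Lam0 (fun x => le_trans ler01 (vr1 x)) hv hd vr1 n 0.
  apply: le_trans; rewrite le_eqVlt; apply/orP; left; apply/eqP.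
  apply: eq_isum => ls' _; rewrite -tiltE EFinM -zE muleC -isumZ//.
  - by apply: eq_isum => ls _; rewrite -EFinM mulrC.
  - by move=> L; exact: q0.
  - by rewrite lee_fin tiltE expR_ge0.
  - by move=> s; rewrite lee_fin (le_trans ler01)//; case/andP: (path_weight_bounds bd0 0 s ls').
have lnc : ln c = lam * delta * n%:R + ln (vr 0).
  by rewrite lnM ?posrE ?expR_gt0 ?expRK// (lt_le_trans _ (vr1 0)).
have := le_trans (leeD (leeD upper mean_count) (lexx 1%E)) sum_young.
by rewrite -EE -!EFinD lee_fin lnc; lra.
Qed.

End upper.
End expected_log.

(** * The homogeneous lower bound *)

(** Multiply by [1 - x <= expR (- x)]: the claim reduces to [(1 + x + 2 * x ^+ 2) * (1 - x) >= 1],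
    which holds for [x <= 1 / 2]. *)
Lemma expR_le_quad (R : realType) (x : R) : 0 <= x <= 1 / 2 -> expR x <= 1 + x + 2 * x ^+ 2.
Proof.
move=> /andP[x0 x2]; have x1 : 0 < 1 - x by lra.
rewrite -(ler_pM2r x1); apply: (@le_trans _ _ (expR x * expR (- x))).
  by rewrite ler_wpM2l ?expR_ge0// expR_ge1Dx.
rewrite -expRD subrr expR0 -subr_ge0.
have -> : (1 + x + 2 * x ^+ 2) * (1 - x) - 1 = x ^+ 2 * (1 - 2 * x) by ring.
by rewrite mulr_ge0 ?sqr_ge0//; lra.
Qed.

Lemma esum_geometric_fin (R : realType) (y : R) : 0 <= y < 1 ->
  (\esum_(n in [set: nat]) (y ^+ n)%:E <= ((1 - y)^-1)%:E)%E.
Proof.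
move=> /andP[y0 y1]; have p : 0 < 1 - y by rewrite subr_gt0.
apply: esum_nat_le => [n|n]; first by rewrite lee_fin exprn_ge0.
rewrite sumEFin lee_fin -[leRHS]mul1r ler_pdivlMr//.
suff -> : (\sum_(0 <= i < n) y ^+ i) * (1 - y) = 1 - y ^+ n by rewrite gerBl exprn_ge0.
elim: n => [|n IH]; first by rewrite big_nil mul0r expr0 subrr.
by rewrite big_nat_recr//= mulrDl IH exprS; ring.
Qed.

Section homogeneous.
Context (R : realType) (d : measure_display) (Omega : measurableType d).
Variables (P : probability Omega R) (J : int -> R) (W : R -> Omega -> int).
Variables (tau : nat -> {RV P >-> R}) (xi : nat -> Omega -> int).
Hypothesis wd : walk_data J tau xi.
Hypothesis hW : forall t omega, 0 <= t ->
  W t omega = \sum_(i < jump_count (fun n => tau n omega) t) xi i omega.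
Variables (beta : R).
Hypotheses (beta0 : 0 < beta).

Let J0 : forall x, 0 <= J x := jump_law_ge0 wd.

Section grid.
Variable delta : R.
Hypothesis delta0 : 0 < delta.

Let bd0 : 0 <= beta * delta. Proof. by rewrite mulr_ge0 ?ltW. Qed.
Let q0 L : 0 <= block_weight J delta L.
Proof. exact: (block_weight_ge0 wd (ltW delta0)). Qed.

Definition pinned_sum n (s : int) : \bar R :=
  isum (block_weight J delta) n (fun ls => (pinned_weight beta delta s ls)%:E).

Let pw0 s ls : (0 <= (pinned_weight beta delta s ls)%:E)%E.
Proof. by rewrite lee_fin (le_trans ler01)//; case/andP: (pinned_weight_bounds bd0 s ls). Qed.

Lemma pinned_sum_ge0 n s : (0 <= pinned_sum n s)%E.
Proof. exact: isum_ge0. Qed.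

Lemma pinned_sum_bounds n s :
  (1 <= pinned_sum n s <= (expR (beta * delta) ^+ n)%:E)%E.
Proof.
apply: isum_bounds => //; first exact: (block_weight_mass wd (ltW delta0)).
- by move=> ls; case/andP: (pinned_weight_bounds bd0 s ls).
- by move=> ls <-; case/andP: (pinned_weight_bounds bd0 s ls).
Qed.

(** Only cells with no jump or one jump are kept, with weights [expR (- delta)] and
    [expR (- delta) * delta]; the bonus at [0] belongs to the empty cell. *)
Lemma pinned_sum_step n (s : int) : ((expR (- delta))%:E *
   ((1 + (s == 0)%:R * (expR (beta * delta) - 1))%:E * pinned_sum n s +
    delta%:E * kop J (pinned_sum n) s) <= pinned_sum n.+1 s)%E.
Proof.
pose w (L : seq int) : R := if (s == 0) && (L == [::]) then expR (beta * delta) else 1.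
have w0 L : 0 <= w L by rewrite /w; case: ifP; rewrite ?expR_ge0.
pose g (L : seq int) : \bar R := ((w L)%:E * pinned_sum n (s + displacement L)%R)%E.
have g0 L : (0 <= g L)%E by rewrite mule_ge0 ?lee_fin ?pinned_sum_ge0.
have -> : pinned_sum n.+1 s = (\esum_(L in [set: seq int]) ((block_weight J delta L)%:E * g L))%E.
  rewrite /pinned_sum /=; apply: eq_esum => L _; congr (_ * _)%E.
  by rewrite /g -isumZ ?lee_fin//; apply: eq_isum => ls _; rewrite -EFinM.
have p0 m : 0 <= poisson_weight delta m by rewrite poisson_weight_ge0 ?ltW.
have pg0 m : (0 <= (poisson_weight delta m)%:E * isum J m g)%E.
  by rewrite mule_ge0 ?lee_fin ?p0// isum_ge0.
rewrite esum_block ?(ltW delta0)// esum_nat_recl// esum_nat_recl//.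
rewrite addeA; apply: (@le_trans _ _ ((poisson_weight delta 0)%:E * isum J 0 g +
    (poisson_weight delta 1)%:E * isum J 1 g)%E); last by rewrite leeDl// esum_ge0.
have w1 : 0 <= 1 + (s == 0)%:R * (expR (beta * delta) - 1).
  by rewrite addr_ge0// mulr_ge0// subr_ge0 -[leLHS]expR0 ler_expR.
rewrite ge0_muleDr; last 2 first.
- by rewrite mule_ge0 ?lee_fin ?pinned_sum_ge0.
- by rewrite mule_ge0 ?lee_fin ?(ltW delta0)// kop_ge0// => y; exact: pinned_sum_ge0.
rewrite le_eqVlt; apply/orP; left; apply/eqP; congr (_ + _)%E.
  rewrite /= /g /w displacement_nil addr0 eqxx andbT /poisson_weight expr0 fact0 divr1 mulr1.
  by case: (s == 0); rewrite ?mul1r ?mul0r ?addr0// addrC subrK.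
rewrite muleA -EFinM /poisson_weight expr1 divr1; congr (_ * _)%E.
apply: eq_esum => z _; rewrite /= /g /w andbF mul1e.
by rewrite displacement_cons displacement_nil addr0.
Qed.

(** For [rho = 0] the path [Y] stays at [0] almost surely, so the logarithm of the pinned sum is a
    constant lower bound for [ln Z], and integrating over the environment preserves it. *)
Lemma pinned_sum_le n : (pinned_sum n 0 <= (expR (fine 'E_P[fun w' =>
    ln (partition_function P W 0 beta (n%:R * delta) (fun t => W (0 * t) w'))]))%:E)%E.
Proof.
have T0 : 0 <= n%:R * delta by rewrite mulr_ge0// ltW.
have [mg Pg] := (measurable_good tau, P_good wd).
have /andP[u1 u2] := pinned_sum_bounds n 0.
have fu : pinned_sum n 0 \is a fin_num.
  by rewrite ge0_fin_numE ?pinned_sum_ge0// (le_lt_trans u2)// ltry.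
rewrite -(fineK fu) lee_fin; set u := fine _.
have u1' : 1 <= u by rewrite -lee_fin fineK.
have up : 0 < u by exact: lt_le_trans u1'.
rewrite -[leLHS]lnK ?posrE// ler_expR -lee_fin.
have [-> _] := expected_lnE P W 0 (ltW beta0) T0.
apply: (@le_trans _ _ (\int[P]_w (cst (ln u)%:E w))%E).
  by rewrite integral_cst//= probability_setT mule1.
apply: (integral_ge_as mg Pg).
- move=> w; rewrite lee_fin.
  by case/andP: (ln_partition_function P W 0 (ltW beta0) T0 (fun t => W (0 * t) w)).
- by move=> w; rewrite lee_fin ln_ge0.
- exact: measurable_cst.
move=> w' gw'; rewrite lee_fin.
have [ZE /andP[Z1 _]] := partition_functionE P W 0 (ltW beta0) T0 (fun t => W (0 * t) w').
rewrite ler_ln ?posrE// ?(lt_le_trans _ Z1)// -lee_fin fineK// ZE.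
rewrite /pinned_sum -(integral_blocks wd (ltW delta0))//.
apply: (integral_ge_as mg Pg).
- by move=> w; rewrite lee_fin expR_ge0.
- by move=> w; exact: pw0.
- exact: (measurable_blocks_fun wd (ltW delta0) n (fun ls => (pinned_weight beta delta 0 ls)%:E)).
- by move=> w gw; rewrite lee_fin; exact: (weight_lower hW (ltW beta0)).
Qed.

End grid.

(** The discounted sum [u] of the pinned sums over time is finite at [0] because [lam] exceeds the
    growth rate, and it satisfies [J u + beta * u 0 * delta_0 + 1 / delta <= (1 + lam) * u]. The
    minimum principle bounds [u 0] below by [beta * u 0 * G 0] plus a positive constant; dividing by
    [u 0] gives the strict inequality. *)
Lemma resolvent_subcritical (lam1 lam T0 : R) : 0 <= lam1 < lam ->
  (forall T, T0 <= T -> T^-1 * fine 'E_P[fun w' =>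
    ln (partition_function P W 0 beta T (fun t => W (0 * t) w'))] <= lam1) ->
  (\esum_(x in [set: int]) (J x)%:E = 1)%E ->
  (beta%:E * resolvent J (1 + lam) 0 < 1)%E.
Proof.
move=> /andP[l10 l1l] hF J1.
(* Discounting at the midpoint [lam2] leaves [lam2 - lam1] for convergence and [g = lam - lam2] for
   the discretization error. *)
pose lam2 := (lam1 + lam) / 2; pose a := 1 + lam2; pose g := lam - lam2.
have a1 : 1 <= a by rewrite /a /lam2; lra.
have a0 : 0 < a by exact: lt_le_trans a1.
have g0 : 0 < g by rewrite /g /lam2; lra.
(* The mesh [1 / M] ensures [a * delta <= 1 / 2] and [2 * a ^+ 2 * delta <= g], hence [expR (a *
   delta) - 1 <= delta * (1 + lam)]. *)
pose M := 2 * a + 2 * a ^+ 2 / g.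
have q0 : 0 < 2 * a ^+ 2 / g by rewrite divr_gt0// mulr_gt0// exprn_gt0.
have M0 : 0 < M by rewrite addr_gt0// mulr_gt0.
pose delta := M^-1; have delta0 : 0 < delta by rewrite invr_gt0.
have dM : delta * M = 1 by rewrite /delta mulVf// gt_eqF.
have ad : a * delta <= 1 / 2.
  have : delta * (2 * a) <= delta * M by rewrite ler_wpM2l ?(ltW delta0)// lerDl ltW.
  by rewrite dM; lra.
have a2d : 2 * a ^+ 2 * delta <= g.
  have : delta * (2 * a ^+ 2 / g) <= delta * M.
    by rewrite ler_wpM2l ?(ltW delta0)// lerDr mulr_ge0// ltW.
  by rewrite dM mulrA ler_pdivrMr// mul1r mulrC.
have expE : expR (a * delta) - 1 <= delta * (1 + lam).
  have := @expR_le_quad R (a * delta); rewrite ad mulr_ge0 ?(ltW a0) ?(ltW delta0)//= => /(_ isT) h.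
  have : delta * (2 * a ^+ 2 * delta) <= delta * g by rewrite ler_wpM2l ?(ltW delta0).
  by move: h; rewrite /g /a; lra.
pose U := pinned_sum delta.
have U0 n s : (0 <= U n s)%E by exact: pinned_sum_ge0.
pose x := expR (- lam2 * delta); have x0 : 0 <= x by exact: expR_ge0.
pose u s := (\esum_(n in [set: nat]) ((x ^+ n)%:E * U n s))%E.
have xU0 n s : (0 <= (x ^+ n)%:E * U n s)%E by rewrite mule_ge0 ?lee_fin ?exprn_ge0.
have u0 s : (0 <= u s)%E by apply: esum_ge0.
have u0fin : u 0 \is a fin_num.
  (* From index [N0] on, times exceed [T0] and the growth bound applies. The finitely many earlier
     terms are covered by [C], and the whole series is below [C] times the geometric series in
     [y]. *)
  pose N0 := (Num.truncn (T0 / delta)).+1; pose y := expR (- (lam2 - lam1) * delta).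
  have y01 : 0 <= y < 1.
    rewrite expR_ge0 /= -[ltRHS]expR0 ltr_expR mulNr oppr_lt0 mulr_gt0// subr_gt0 /lam2; lra.
  pose C := expR (beta * delta * N0%:R).
  rewrite ge0_fin_numE//; apply: (@le_lt_trans _ _ (C%:E * ((1 - y)^-1)%:E)%E); last by rewrite -EFinM ltry.
  apply: (@le_trans _ _ (C%:E * \esum_(n in [set: nat]) (y ^+ n)%:E)%E); last first.
    by rewrite lee_wpmul2l ?lee_fin ?expR_ge0// esum_geometric_fin.
  rewrite -esumZl ?lee_fin ?expR_ge0//; last first.
    by move=> n; rewrite lee_fin exprn_ge0// expR_ge0.
  apply: le_esum => n _; rewrite -EFinM /C /y /x -!expRM_natr -expRD.
  have [N0n|nN0] := leqP N0 n.
    have n0 : (0 < n)%N by exact: leq_trans N0n.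
    have nd : 0 < n%:R * delta by rewrite mulr_gt0// ltr0n.
    have Tn : T0 <= n%:R * delta.
      rewrite -ler_pdivrMr//; apply: (@le_trans _ _ N0%:R); last by rewrite ler_nat.
      by apply: ltW; exact: truncnS_gt.
    apply: le_trans (lee_wpmul2l _ (pinned_sum_le delta0 n)) _; first by rewrite lee_fin expR_ge0.
    have := hF _ Tn; rewrite ler_pdivrMl// => h.
    rewrite -EFinM lee_fin -expRD ler_expR.
    have : 0 <= beta * delta * N0%:R by rewrite !mulr_ge0 ?ltW.
    by lra.
  have /andP[_ h] := pinned_sum_bounds delta0 n 0.
  apply: le_trans (lee_wpmul2l _ h) _; first by rewrite lee_fin expR_ge0.
  rewrite -EFinM lee_fin -expRM_natr -expRD ler_expR.
  have : beta * delta * n%:R <= beta * delta * N0%:R.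
    by rewrite ler_wpM2l ?mulr_ge0 ?ltW// ltr_nat.
  have : 0 <= lam1 * delta * n%:R by rewrite mulr_ge0// mulr_ge0// ltW.
  by lra.
have uE s : u s = (1 + \esum_(n in [set: nat]) ((x ^+ n.+1)%:E * U n.+1 s))%E.
  by rewrite /u esum_nat_recl// expr0 mul1e /U {1}/pinned_sum /=.
have u1s s : (1 <= u s)%E by rewrite uE leeDl// esum_ge0.
have ku s : kop J u s = (\esum_(n in [set: nat]) ((x ^+ n)%:E * kop J (U n) s))%E.
  rewrite kop_esum//; apply: eq_esum => n _; rewrite kopZ ?exprn_ge0//; exact: U0.
have kU0 n s : (0 <= kop J (U n) s)%E by apply: kop_ge0.
pose b := expR (beta * delta) - 1.
have b0 : beta * delta <= b by rewrite lerBrDr addrC expR_ge1Dx.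
have b0' : 0 <= b by apply: le_trans b0; rewrite mulr_ge0 ?ltW.
pose E := expR (a * delta).
have rec s : (E%:E + ((1 + (s == 0)%:R * b)%:E * u s + delta%:E * kop J u s) <= E%:E * u s)%E.
  have w1 : 0 <= 1 + (s == 0)%:R * b by rewrite addr_ge0// mulr_ge0.
  rewrite [in leRHS]uE ge0_muleDr//; last by apply: esum_ge0.
  rewrite mule1; apply: leeD => //.
  rewrite ku /u -!esumZl ?lee_fin ?(ltW delta0) ?expR_ge0//; last by move=> n; rewrite mule_ge0// lee_fin exprn_ge0.
  rewrite -esumD; last 2 first.
  - by move=> n _; rewrite mule_ge0 ?lee_fin.
  - by move=> n _; rewrite mule_ge0 ?lee_fin ?(ltW delta0)// mule_ge0// lee_fin exprn_ge0.
  apply: le_esum => n _.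
  have := lee_wpmul2l (ltac:(by rewrite lee_fin mulr_ge0 ?expR_ge0 ?exprn_ge0) : (0 <= (E * x ^+ n.+1)%:E)%E) (pinned_sum_step delta0 n s).
  move=> h; rewrite [leRHS]muleA -EFinM; apply: le_trans h.
  rewrite [leRHS]muleA -[((E * x ^+ n.+1)%:E * (expR (- delta))%:E)%E]EFinM.
  have -> : E * x ^+ n.+1 * expR (- delta) = x ^+ n.
    rewrite exprS; have -> : E * (x * x ^+ n) * expR (- delta) = (E * x * expR (- delta)) * x ^+ n by ring.
    rewrite /E /x -!expRD (_ : _ + _ = 0) ?expR0 ?mul1r//.
    by rewrite /a; ring.
  rewrite ge0_muleDr ?mule_ge0 ?lee_fin ?(ltW delta0)//.
  by rewrite muleCA [X in (_ + X <= _)%E]muleCA.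
pose u1 := fine (u 0).
have u1E : u 0 = u1%:E by rewrite fineK.
have E1 : 1 <= E by rewrite -[leLHS]expR0 ler_expR mulr_ge0 ?ltW.
(* Finiteness is known only at [0]. Where [u s] is [+oo] the claim is trivial, and where it is
   finite, [rec] forces [kop J u s] to be finite too. *)
have hmin s : (kop J u s + (beta * u1)%:E * edelta s + (delta^-1)%:E <= (1 + lam)%:E * u s)%E.
  have := rec s; have := u1s s; have := kop_ge0 J0 u0 s.
  have us0 : s == 0 -> u s = u1%:E by move=> /eqP ->.
  case: (u s) us0 => [us| |] us0 k0 us1; last 2 first.
  - move=> _; rewrite [leRHS]gt0_muley ?leey//.
    by rewrite lte_fin; lra.
  - by rewrite leNgt ltNyr in us1.
  case: (kop J u s) k0 => [k| |] // k0; last first.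
    by rewrite [(delta%:E * +oo)%E]gt0_muley ?lte_fin// !addey// leye_eq.
  move=> hr; have {}hr : E + ((1 + (s == 0)%:R * b) * us + delta * k) <= E * us by rewrite -lee_fin.
  have {}k0 : 0 <= k by rewrite -lee_fin.
  have {}us1 : 1 <= us by rewrite -lee_fin.
  have h2 : us * (E - 1) <= us * (delta * (1 + lam)) by rewrite ler_wpM2l// (le_trans ler01).
  have h3 : (s == 0)%:R * (beta * delta) * u1 <= (s == 0)%:R * b * us.
    case: (s == 0) us0 => [/(_ isT)[<-]|_]; last by rewrite !mul0r.
    by rewrite !mul1r ler_wpM2r// (le_trans ler01).
  suff : k + beta * u1 * (s == 0)%:R + delta^-1 <= (1 + lam) * us by rewrite -lee_fin.
  rewrite -(ler_pM2l delta0) mulrDr divff ?(gt_eqF delta0)//.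
  move: h3 hr h2 E1; generalize ((s == 0)%:R : R) => i0 h3 hr h2 E1; lra.
have lam0 : 0 < 1 + lam by lra.
have u1p : 0 < u1 by rewrite -lte_fin -u1E (lt_le_trans lte01).
have Gfin : resolvent J (1 + lam) 0 \is a fin_num.
  by apply: (resolvent_fin J0 _ J1); lra.
have := @resolvent_min R J (1 + lam) J0 lam0 u (beta * u1) delta^-1 _ _ u0 hmin 0.
rewrite u1E -(fineK Gfin) -!EFinM -EFinD !lee_fin lte_fin => h.
have {}h := h (ltac:(by rewrite mulr_ge0 ?ltW)) (ltac:(by rewrite invr_ge0 ltW)).
have dl : 0 < delta^-1 / (1 + lam) by rewrite divr_gt0 ?invr_gt0.
rewrite -(ltr_pM2l u1p) mulr1 mulrA (mulrC u1); apply: lt_le_trans h.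
by rewrite ltrDl.
Qed.

End homogeneous.

(** * The free energy gap *)

(** Take [v = 1 + c * h] with [h] the resolvent. Then [(a - k) v] is the positive constant [a - kap]
    plus [c] times the point mass, and [c = beta / (1 - beta * h 0)] solves [beta * v 0 = c]. The
    summand [1] gives the lower bound on [v]. *)
Lemma exists_supersolution (R : realType) (k : int -> R) (kap a beta : R) :
  (forall z, 0 <= k z) -> (\esum_(z in [set: int]) (k z)%:E = kap%:E)%E ->
  kap < a -> 0 < beta -> (beta%:E * resolvent k a 0 < 1)%E ->
  exists2 v : int -> R, (forall x, 1 <= v x) &
    forall s, (kop k (fun x => (v x)%:E) s + beta%:E * (edelta s * (v s)%:E) <=
               a%:E * (v s)%:E)%E.
Proof.
move=> k0 km ka b0 hb.
have kap0 : 0 <= kap by rewrite -lee_fin -km esum_ge0// => z _; rewrite lee_fin.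
have a0 : 0 < a by exact: le_lt_trans ka.
have Hfin := resolvent_fin k0 ka km.
pose h x := fine (resolvent k a x).
have hE x : resolvent k a x = (h x)%:E by rewrite fineK.
have h0 x : 0 <= h x by rewrite fine_ge0// resolvent_ge0// ltW.
have bh : beta * h 0 < 1 by rewrite -lte_fin EFinM -hE.
pose c := beta / (1 - beta * h 0).
have d0 : 0 < 1 - beta * h 0 by rewrite subr_gt0.
have c0 : 0 <= c by rewrite divr_ge0// ltW.
have cE : c - c * (beta * h 0) = beta.
  by rewrite -[X in X - _]mulr1 -mulrBr /c mulfVK// gt_eqF.
exists (fun x => 1 + c * h x) => [x|s]; first by rewrite lerDl mulr_ge0.
have vE : kop k (fun x => (1 + c * h x)%:E) s = (kap%:E + c%:E * kop k (resolvent k a) s)%E.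
  rewrite -[X in (X + _)%E]mule1 -(kop_cst (c := 1%E) _ k0 km s)//.
  rewrite -kopZ//; last by move=> x; rewrite resolvent_ge0// ltW.
  rewrite -kopD//; last by move=> x; rewrite hE lee_fin mulr_ge0.
  by apply: eq_esum => z _; rewrite hE.
have := resolventE k0 a0 s; rewrite !hE vE.
have : (0 <= kop k (resolvent k a) s)%E.
  by apply: kop_ge0 => // x; rewrite resolvent_ge0// ltW.
case: (kop k (resolvent k a) s) => [y| |] // y0.
move=> e; have {}e : a * h s = (s == 0)%:R + y by have := congr1 fine e.
suff : kap + c * y + beta * ((s == 0)%:R * (1 + c * h s)) <= a * (1 + c * h s) by rewrite -lee_fin.
have -> : a * (1 + c * h s) = a + c * (a * h s) by ring.
rewrite e; case: eqP => [->|_] /=; last by rewrite mul0r mulr0 add0r addr0 lerD2r ltW.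
have : beta * c * h 0 = c - beta by rewrite -[X in _ = c - X]cE; ring.
by move=> hc; lra.
Qed.

(** Both sides agree to first order in [delta] up to the slack [nu * delta]; [K] bounds the
    second-order coefficient on the left, and [M] is large enough that [delta * K <= nu]. *)
Lemma small_step (R : realType) (beta Lam nu : R) : 0 < beta -> 1 <= Lam -> 0 < nu ->
  exists2 delta : R, 0 < delta <= 1 / 4 &
    1 + expR (beta * delta) * (delta * Lam + expR 1 * exp_tail2 (delta * Lam)) <=
    expR ((Lam + nu) * delta).
Proof.
move=> b0 L1 n0; have L0 : 0 < Lam by exact: lt_le_trans L1.
pose e : R := expR 1; have e0 : 0 < e by exact: expR_gt0.
pose K := 2 * beta * Lam + 2 * e * Lam ^+ 2 + 4 * beta * e * Lam ^+ 2.
have K0 : 0 < K by rewrite !addr_gt0// !mulr_gt0// exprn_gt0.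
pose M := 4 + 2 * beta + 2 * Lam + K / nu.
have q0 : 0 < K / nu by rewrite divr_gt0.
have M0 : 0 < M by rewrite !addr_gt0// mulr_gt0.
pose delta := M^-1; have d0 : 0 < delta by rewrite invr_gt0.
have le_M (y : R) : y <= M -> delta * y <= 1.
  by move=> yM; rewrite -(mulVf (lt0r_neq0 M0)) ler_wpM2l// ltW.
have d4 : delta * 4 <= 1 by apply: le_M; rewrite /M; lra.
have db : delta * (2 * beta) <= 1 by apply: le_M; rewrite /M; lra.
have dL : delta * (2 * Lam) <= 1 by apply: le_M; rewrite /M; lra.
have dK : delta * K <= nu.
  have : delta * (K / nu) <= 1 by apply: le_M; rewrite /M; lra.
  by rewrite mulrA ler_pdivrMr// mul1r.
exists delta; first by rewrite d0 /=; lra.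
apply: (@le_trans _ _ (1 + (Lam + nu) * delta)); last exact: expR_ge1Dx.
rewrite lerD2l; set p := expR (beta * delta).
have p0 : 0 <= p by exact: expR_ge0.
have bd0 : 0 <= beta * delta by rewrite mulr_ge0 ?ltW.
have dL0 : 0 <= delta * Lam by rewrite mulr_ge0 ?ltW.
have hp : p <= 1 + 2 * (beta * delta).
  apply: le_trans (expR_le_quad _) _; first by rewrite bd0 /=; lra.
  have : (beta * delta) ^+ 2 <= (beta * delta) * (1 / 2).
    by rewrite expr2 ler_wpM2l//; lra.
  lra.
have ht : exp_tail2 (delta * Lam) <= 2 * (delta * Lam) ^+ 2.
  rewrite /exp_tail2; have := @expR_le_quad R (delta * Lam).
  by rewrite dL0 /= => /(_ (ltac:(lra))); lra.
have ht' : delta * Lam + e * exp_tail2 (delta * Lam) <= delta * Lam + e * (2 * (delta * Lam) ^+ 2).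
  by rewrite lerD2l ler_wpM2l// ltW.
apply: le_trans (ler_wpM2l p0 ht') _.
have s0 : 0 <= delta * Lam + e * (2 * (delta * Lam) ^+ 2).
  by rewrite addr_ge0// !mulr_ge0 ?sqr_ge0// ltW.
apply: le_trans (ler_wpM2r s0 hp) _.
have -> : (1 + 2 * (beta * delta)) * (delta * Lam + e * (2 * (delta * Lam) ^+ 2)) =
  delta * (Lam + delta * (2 * beta * Lam + 2 * e * Lam ^+ 2 + 4 * beta * e * Lam ^+ 2 * delta)) by ring.
rewrite [leRHS]mulrC ler_wpM2l ?(ltW d0)// lerD2l; apply: le_trans dK.
rewrite ler_wpM2l ?(ltW d0)// /K lerD2l ler_piMr//; last by lra.
by rewrite !mulr_ge0 ?sqr_ge0// ltW.
Qed.

Section free_energy_gap.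
Context (R : realType) (d : measure_display) (Omega : measurableType d).
Variables (P : probability Omega R) (J : int -> R) (W : R -> Omega -> int).
Variables (tau : nat -> {RV P >-> R}) (xi : nat -> Omega -> int).
Hypothesis wd : walk_data J tau xi.
Hypothesis hW : forall t omega, 0 <= t ->
  W t omega = \sum_(i < jump_count (fun n => tau n omega) t) xi i omega.
Hypothesis Jev : forall x, J (- x) = J x.
Hypothesis Jmass : (\esum_(x in [set: int]) (J x)%:E = 1)%E.
Hypothesis Jmono : forall x y : int, (`|x| <= `|y|)%N -> J y <= J x.
Variable beta : R.
Hypothesis beta0 : 0 < beta.

Let J0 : forall x, 0 <= J x := jump_law_ge0 wd.

Definition expected_ln rho T := fine 'E_P[fun w' =>
  ln (partition_function P W rho beta T (fun t => W (rho * t) w'))].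

(** From [e <= 4], the perturbation is at most [3 * rho * J K]; so [64 * s * N <= eta] follows from
    [768 * J K * N <= t], with [768 = 64 * 3 * 4]. The rate is [lam + 2 * eta] minus the mean count
    per unit of time, at least [3 / 4 * rho * t] since [delta <= 1 / 4]. *)
Lemma expected_ln_linear (rho lam m t : R) (N K : nat) : 0 < rho < 1 -> 0 < lam ->
  (beta%:E * resolvent J (1 + lam) 0 < 1)%E -> (0 < N)%N ->
  (\esum_(z in [set: int]) (J z * testf N%:R z)%:E = m%:E)%E -> m <= lam / 8 ->
  (\esum_(z in [set: int]) (far_kernel J K z)%:E = t%:E)%E -> 0 < t <= lam / 8 ->
  768 * J K%:Z * N%:R <= t ->
  exists2 delta : R, 0 < delta & exists C : R, forall n : nat,
    expected_ln rho (n%:R * delta) <= (lam - rho * t / 4) * (n%:R * delta) + C.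
Proof.
move=> /[dup] rho01 /andP[r0 r1] l0 hsub N0 hm ml ht /andP[t0 tl] hA.
pose eps := rho * (expR 1 - 1); pose eta := rho * t / 4.
have e1 : 1 <= expR 1 :> R by rewrite -[leLHS]expR0 ler_expR.
have e4 : expR 1 <= 4 :> R.
  have -> : 1 = 1 / 2 + 1 / 2 :> R by field.
  have h : expR (1 / 2) <= 2 :> R.
    by apply: le_trans (expR_le_quad _) _; lra.
  rewrite expRD; have := expR_ge0 (1 / 2 : R) => h0.
  by apply: le_trans (ler_pM h0 h0 h h) _; lra.
have eps0 : 0 <= eps by rewrite mulr_ge0 ?(ltW r0)// subr_ge0.
have eps3 : eps <= 3 * rho by rewrite /eps mulrC ler_wpM2r ?(ltW r0)//; lra.
have rt : rho * t <= t by rewrite ler_piMl ?(ltW t0)// ltW.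
have rt0 : 0 < rho * t by rewrite mulr_gt0.
have et : eps * t <= 3 * rho * t by rewrite ler_wpM2r// ltW.
have far0 z : 0 <= far_kernel J K z by exact: far_kernel_ge0.
have ef0 z : 0 <= eps * far_kernel J K z by rewrite mulr_ge0.
have efm : (\esum_(z in [set: int]) (eps * far_kernel J K z)%:E = (eps * t)%:E)%E.
  by rewrite EFinM -ht -esumZl ?lee_fin.
have eta0 : 0 < eta by rewrite divr_gt0.
have green : (resolvent (tilted_kernel J K rho) (1 + (lam + eta)) 0 <= resolvent J (1 + lam) 0)%E.
  apply: (@green_comparison _ J (fun z => eps * far_kernel J K z) N m lam eta (eps * t) (eps * J K%:Z)) => //.
  - lra.
  - by rewrite (ltW eta0) /= /eta; lra.
  - lra.
  - move=> z; rewrite ler_wpM2l// /far_kernel; case: ifPn => // Kz.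
    by apply: Jmono; rewrite absz_nat.
  - have JN : 0 <= J K%:Z * N%:R by rewrite mulr_ge0.
    have : eps * (J K%:Z * N%:R) <= 3 * rho * (J K%:Z * N%:R) by rewrite ler_wpM2r.
    have : rho * (768 * J K%:Z * N%:R) <= rho * t by rewrite ler_wpM2l// ltW.
    by rewrite /eta; lra.
have km : (\esum_(z in [set: int]) (tilted_kernel J K rho z)%:E = (1 + eps * t)%:E)%E.
  rewrite EFinD -efm -Jmass -esumD//; by [move=> z _; rewrite lee_fin|apply: eq_esum].
have kt0 z : 0 <= tilted_kernel J K rho z by rewrite addr_ge0//; exact: ef0.
have [v v1 hv] : exists2 v : int -> R, (forall x, 1 <= v x) &
    forall s, (kop (tilted_kernel J K rho) (fun x => (v x)%:E) s +
      beta%:E * (edelta s * (v s)%:E) <= (1 + (lam + eta))%:E * (v s)%:E)%E.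
  apply: exists_supersolution kt0 km _ beta0 _; first lra.
  by apply: le_lt_trans hsub; rewrite lee_wpmul2l// lee_fin ltW.
have L1 : 1 <= 1 + (lam + eta) by lra.
have [delta /andP[d0 d4] hd] := small_step beta0 L1 eta0.
exists delta => //; exists (ln (v 0)) => n.
have lam20 : 0 <= lam + eta + eta by lra.
have hd' : 1 + expR (beta * delta) * (delta * (1 + (lam + eta)) +
    expR 1 * exp_tail2 (delta * (1 + (lam + eta)))) <= expR ((1 + (lam + eta + eta)) * delta).
  by rewrite (_ : 1 + (lam + eta + eta) = 1 + (lam + eta) + eta)//; ring.
have L0 : 0 <= 1 + (lam + eta) by lra.
have := expected_ln_upper wd hW Jev beta0 d0 n rho01 L0 v1 lam20 ht hv hd'.
rewrite -/(expected_ln rho (n%:R * delta)) => h; apply: le_trans h _.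
have x34 : 3 / 4 <= expR (- (rho * delta)).
  apply: le_trans (expR_ge1Dx _); have : rho * delta <= 1 * delta by rewrite ler_wpM2r ?(ltW d0)// ltW.
  by lra.
have nd0 : 0 <= n%:R * delta * (rho * t) by rewrite !mulr_ge0// ltW.
have := ler_wpM2l nd0 x34; rewrite /eta; lra.
Qed.

Let pinfty_forall (A : set R) : (\forall x \near +oo, A x) -> exists M, forall x, M < x -> A x.
Proof. by move=> [M [_ hM]]; exists M. Qed.

Let time_ge (delta M : R) : 0 < delta -> exists2 n : nat, (0 < n)%N & M < n%:R * delta.
Proof.
move=> d0; exists (Num.truncn `|M / delta|).+1 => //.
rewrite -ltr_pdivrMr//; apply: le_lt_trans (ler_norm _) _; exact: truncnS_gt.
Qed.

(** The additive constant is beaten along the grid: at a time beyond [C / e] it is smaller than the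
    excess [e * T] that [g < f] would produce. *)
Lemma rate_le (rho f g delta C : R) : 0 < delta ->
  T^-1 * expected_ln rho T @[T --> +oo] --> f ->
  (forall n : nat, expected_ln rho (n%:R * delta) <= g * (n%:R * delta) + C) -> f <= g.
Proof.
move=> d0 hf hC; rewrite leNgt; apply/negP => gf.
pose e := (f - g) / 2.
have e0 : 0 < e by rewrite /e; lra.
have [M hM] := pinfty_forall (cvgr_gt _ hf (g + e) (ltac:(rewrite /e; lra))).
have [n n0 hn] := time_ge (Num.max M (C / e)) d0.
move: hn; rewrite gt_max => /andP[h1 h2].
have T0 : 0 < n%:R * delta by rewrite mulr_gt0// ltr0n.
have := hM _ h1; rewrite -(ltr_pM2l T0) mulrA divff ?gt_eqF// mul1r => h3.
have := hC n; rewrite leNgt => /negP; apply; apply: le_lt_trans h3.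
by rewrite mulrDr mulrC lerD2l -ler_pdivrMr ?ltW// mulrC.
Qed.

Lemma rate_bounds (rho f : R) :
  T^-1 * expected_ln rho T @[T --> +oo] --> f -> 0 <= f <= beta.
Proof.
move=> hf; have hb T : 0 < T -> 0 <= T^-1 * expected_ln rho T <= beta.
  move=> T0; have [_ /andP[h1 h2]] := expected_lnE P W rho (ltW beta0) (ltW T0).
  by rewrite mulr_ge0 ?invr_ge0 ?(ltW T0)//= ler_pdivrMl// mulrC.
pose T M : R := Num.max M 0 + 1.
have TM M : M < T M by rewrite ltr_pwDr// le_max lexx.
have T0 M : 0 < T M by rewrite ltr_pwDr// le_max lexx orbT.
apply/andP; split; rewrite leNgt; apply/negP => h.
  have [M hM] := pinfty_forall (cvgr_lt _ hf _ h).
  by have := hM _ (TM M); rewrite ltNge; case/andP: (hb _ (T0 M)) => ->.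
have [M hM] := pinfty_forall (cvgr_gt _ hf _ h).
by have := hM _ (TM M); rewrite ltNge; case/andP: (hb _ (T0 M)) => _ ->.
Qed.

(** For every [lam] in [(F, F + 1]] the rate is at most [lam - rho * t / 4], and [c * lam <= t]
    makes this a fixed proportion of [lam]; then [lam] decreases to [F], which may be [0]. The range
    of [lam] fits below [B] because [F <= beta]. *)
Lemma rate_gap (c B rho f F : R) : 0 < c -> 0 < rho < 1 ->
  (forall lam, 0 < lam <= B -> exists N K : nat, exists m t : R,
    [/\ (0 < N)%N,
     (\esum_(z in [set: int]) (J z * testf N%:R z)%:E = m%:E)%E /\ m <= lam / 8,
     (\esum_(z in [set: int]) (far_kernel J K z)%:E = t%:E)%E /\ (0 < K)%N,
     c * lam <= t <= lam / 8 &
     768 * J K%:Z * N%:R <= t]) ->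
  beta + 1 <= B ->
  T^-1 * expected_ln rho T @[T --> +oo] --> f ->
  T^-1 * expected_ln 0 T @[T --> +oo] --> F ->
  f <= F * (1 - Num.min (c / 4) (1 / 2) * rho).
Proof.
move=> c0 rho01 hsc bB hf hF; have [r0 r1] := andP rho01.
have /andP[F0 Fb] := rate_bounds hF.
set q := 1 - _ * rho.
have q0 : 0 <= q.
  have : Num.min (c / 4) (1 / 2) * rho <= 1 / 2 * rho by rewrite ler_wpM2r ?(ltW r0)// ge_min lexx orbT.
  by rewrite /q; lra.
have q1 : q <= 1.
  by rewrite /q gerBl mulr_ge0 ?(ltW r0)// le_min; apply/andP; split; lra.
have qc : 1 - rho * c / 4 <= q.
  have : Num.min (c / 4) (1 / 2) * rho <= c / 4 * rho by rewrite ler_wpM2r ?(ltW r0)// ge_min lexx.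
  by rewrite /q; lra.
have key lam : F < lam <= F + 1 -> f <= lam * q.
  move=> /andP[Fl lF].
  have l0 : 0 < lam by exact: le_lt_trans Fl.
  have [|N [K [m [t [N0 [hm ml] [ht _] /andP[ct tl] hA]]]]] := hsc lam.
    by rewrite l0 /=; lra.
  have t0 : 0 < t by apply: lt_le_trans ct; rewrite mulr_gt0.
  pose lam1 := (F + lam) / 2.
  have [M hM] := pinfty_forall (cvgr_lt _ hF lam1 (ltac:(rewrite /lam1; lra))).
  have hsub : (beta%:E * resolvent J (1 + lam) 0 < 1)%E.
    apply: (resolvent_subcritical wd hW beta0 (lam1 := lam1) (T0 := M + 1)) => //.
      by rewrite /lam1; lra.
    by move=> T MT; apply/ltW/hM; lra.
  have tt : 0 < t <= lam / 8 by rewrite t0.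
  have [delta d0 [C hC]] := expected_ln_linear rho01 l0 hsub N0 hm ml ht tt hA.
  apply: le_trans (rate_le d0 hf hC) _.
  apply: (@le_trans _ _ (lam * (1 - rho * c / 4))); last by rewrite ler_wpM2l// ltW.
  have : rho * (c * lam) <= rho * t by rewrite ler_wpM2l// ltW.
  lra.
apply/ler_addgt0Pr => e e0.
pose e' := Num.min e 1.
have e'0 : 0 < e' by rewrite lt_min e0 ltr01.
have e'e : e' <= e by rewrite ge_min lexx.
have e'1 : e' <= 1 by rewrite ge_min lexx orbT.
apply: le_trans (key (F + e') _) _; first by rewrite ltrDl e'0 lerD2l.
by rewrite mulrDl lerD2l (le_trans _ e'e)// ler_piMr// ltW.
Qed.

End free_energy_gap.

(* A divergent [lim] is the default point of [R], namely [0]. *)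
Lemma free_energy_dvg (R : realType) (d : measure_display)
    (Omega : measurableType d) (P : probability Omega R) (W : R -> Omega -> int) rho beta :
  ~ cvg (T^-1 * expected_ln P W beta rho T @[T --> +oo]) ->
  free_energy P W rho beta = 0.
Proof. exact: dvgP. Qed.

(** One constant serves all [rho] and all [beta] up to [B]. If a limit diverges or the homogeneous
    free energy is [0], the quotient is [0] by the conventions for [lim] and inverse, and
    [c <= 1 / 2] keeps the bound nonnegative. *)
Lemma free_energy_ratio_bound (R : realType) (d : measure_display)
    (Omega : measurableType d) (P : probability Omega R)
    (gamma : R) (J : int -> R) (W : R -> Omega -> int) :
  0 < gamma < 1 -> jump_kernel gamma J ->
  J x / `|x|%N%:R `^ (- (1 + gamma)) @[x --> int_infty] --> (1 : R) ->
  is_ctrw P J W ->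
  forall B, 0 < B -> exists2 c : R, 0 < c <= 1 / 2 &
    forall rho beta, 0 < rho < 1 -> 0 < beta <= B ->
      free_energy P W rho beta / hom_free_energy P W beta <= 1 - c * rho.
Proof.
move=> hg [J0 Jev Jmass Jmono _] hJ [tau [xi [wd hW]]] B B0.
have A0 : 0 < 768 :> R by rewrite ltr0n.
have B1 : 0 < B + 1 by lra.
have [c c0 hc] := kernel_scales hg J0 Jev Jmass Jmono hJ A0 B1.
exists (Num.min (c / 4) (1 / 2)).
  by rewrite lt_min ge_min lexx orbT andbT; apply/andP; split; lra.
move=> rho beta rho01 /andP[b0 bB]; have [r0 r1] := andP rho01.
have q0 : 0 <= 1 - Num.min (c / 4) (1 / 2) * rho.
  have : Num.min (c / 4) (1 / 2) * rho <= 1 / 2 * rho by rewrite ler_wpM2r ?(ltW r0)// ge_min lexx orbT.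
  lra.
have [hF|hF] := pselect (cvg (T^-1 * expected_ln P W beta 0 T @[T --> +oo])); last first.
  by rewrite /hom_free_energy (free_energy_dvg hF) invr0 mulr0.
have [hf|hf] := pselect (cvg (T^-1 * expected_ln P W beta rho T @[T --> +oo])); last first.
  by rewrite (free_energy_dvg hf) mul0r.
have bB1 : beta + 1 <= B + 1 by lra.
have gap : free_energy P W rho beta <=
    hom_free_energy P W beta * (1 - Num.min (c / 4) (1 / 2) * rho).
  exact: (rate_gap wd hW Jev Jmass Jmono b0 c0 rho01 hc bB1 hf hF).
have F0 : 0 <= hom_free_energy P W beta by have /andP[] := rate_bounds b0 hF.
have [->|Fn0] := eqVneq (hom_free_energy P W beta) 0; first by rewrite invr0 mulr0.
by rewrite ler_pdivrMr 1?mulrC// lt_neqAle eq_sym Fn0.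
Qed.

Theorem proposition1p5 (R : realType) (d : measure_display)
    (Omega : measurableType d) (P : probability Omega R)
    (gamma : R) (J : int -> R) (W : R -> Omega -> int)
    (hgamma : 2 / 3 < gamma < 1)
    (hJ : jump_kernel gamma J)
    (hJasymp : J x / `|x|%N%:R `^ (- (1 + gamma)) @[x --> int_infty] --> (1 : R))
    (hW : is_ctrw P J W) :
  exists2 c : R, 0 < c &
    forall rho : R, 0 < rho < 1 ->
      (limf_esup
         (fun beta : R => (free_energy P W rho beta / hom_free_energy P W beta)%:E)
         (beta0 P W)^'+ <= (1 - c * rho)%:E)%E
      /\ 1 - c * rho < 1.
Proof.
have hg : 0 < gamma < 1 by lra.
have b0 : 0 <= beta0 P W by rewrite invr_ge0 fine_ge0// integral_ge0.
have B0 : 0 < beta0 P W + 1 by lra.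
have [c /andP[c0 _] hc] := free_energy_ratio_bound hg hJ hJasymp hW B0.
exists c => // rho rho01; split; last by rewrite gtrBl mulr_gt0//; case/andP: rho01.
rewrite limf_esupE.
(* On this right neighbourhood [beta] is positive and at most [beta0 P W + 1], so the uniform bound
   applies; the supremum over it dominates the upper limit. *)
pose V := [set b | beta0 P W < b < beta0 P W + 1].
have hV : (beta0 P W)^'+ V.
  by near=> b; rewrite /V /=; apply/andP; split; near: b;
    [exact: nbhs_right_gt|apply: nbhs_right_lt; rewrite ltrDl].
apply: (@le_trans _ _ (ereal_sup [set (free_energy P W rho b / hom_free_energy P W b)%:E | b in V])).
  by apply: ereal_inf_lbound; exists V.
apply: ge_ereal_sup => _ [b /andP[h1 h2] <-]; rewrite lee_fin; apply: hc => //.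
by rewrite (le_lt_trans b0 h1) ltW.
Unshelve. all: by end_near.
Qed.
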